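(* Let $\mathcal{H}$ be a separable, infinite dimensional complex Hilbert space, and let $A\in\mathcal{B}(\mathcal{H})$ be a positive contraction (i.e. $0\leq A\leq I$). The following four conditions are equivalent: (i) $A$ arises asymptotically from a contraction $T\in\mathcal{B}(\mathcal{H})$; (ii) $A$ arises asymptotically from a contraction $T\in\mathcal{B}(\mathcal{H})$ in uniform convergence; (iii) $r_e(A)=1$ or $A$ is a projection of finite rank; (iv) $\dim\mathcal{H}((0,1])=\dim\mathcal{H}((\delta,1])$ for every $0\leq\delta<1$. Moreover, if one of these conditions holds and $\dim\ker(A-I)=0$ or $\dim\ker(A-I)=\aleph_0$, then the contraction $T$ inducing $A$ (in (i) and (ii)) can be chosen to be a $C_{\cdot 0}$-contraction.
   Context: $\mathcal{B}(\mathcal{H})$ is the algebra of bounded linear operators on $\mathcal{H}$; $T\in\mathcal{B}(\mathcal{H})$ is a contraction if $\|T\|\leq1$. For a contraction $T$, the sequence $T^{*n}T^n$ is decreasing and converges in the strong operator topology to an operator $A_T:=\lim_{n\to\infty}T^{*n}T^n$. ''$A$ arises asymptotically from $T$'' means $A=A_T$. ''$A$ arises asymptotically from $T$ in uniform convergence'' means that $\|T^{*n}T^n-A\|\to0$. A contraction $T$ is a $C_{\cdot0}$-contraction if $\lim_{n\to\infty}\|T^{*n}x\|=0$ for every $x\in\mathcal{H}$. $r_e(A)$ is the essential spectral radius of $A$ (the largest modulus of an element of the essential spectrum, the spectrum of the image of $A$ modulo compact operators). $E$ denotes the spectral measure of $A$, and $\mathcal{H}(\omega):=E(\omega)\mathcal{H}$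 for a Borel set $\omega\subset\mathbb{R}$. ''Projection'' means orthogonal projection (the zero operator is included as a finite rank projection). $\dim$ is the Hilbert space dimension (cardinality of an orthonormal basis). *)

(* Defs.v *)
From HB Require Import structures.
From mathcomp Require Import all_boot all_order all_algebra sesquilinear.
From mathcomp Require Import all_classical all_reals all_analysis.
From mathcomp Require Import complex.

Set Implicit Arguments.
Unset Strict Implicit.
Unset Printing Implicit Defensive.

Import Order.TTheory GRing.Theory Num.Theory Num.Def.
Import numFieldNormedType.Exports.

Local Open Scope classical_set_scope.
Local Open Scope ring_scope.
Local Open Scope complex_scope.

(* A complex Hilbert space is a complete normed space H over R[i] together
   with an inner product dot, linear in its first argument, that induces the
   norm. The norm of H takes its values in the nonnegative reals of R[i]. *)
Definition induces_norm (R : realType) (H : completeNormedModType R[i])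
    (dot : {dot H for conjC}) : Prop :=
  forall x : H, `|x| ^+ 2 = dot x x.

Section Operators.
Variables (R : realType) (H : completeNormedModType R[i]).

Definition separable_space : Prop :=
  exists2 D : set H, countable D & dense D.

Definition finite_dim (M : set H) : Prop :=
  exists (n : nat) (e : 'I_n -> H),
    forall x, M x -> exists c : 'I_n -> R[i], x = \sum_(i < n) c i *: e i.

(* Meaningful when T is bounded on the unit ball. *)
Definition opnorm (T : H -> H) : R :=
  sup [set complex.Re `|T x| | x in [set x : H | `|x| <= 1]].

Definition contraction_op (T : {linear H -> H}) : Prop :=
  continuous T /\ opnorm T <= 1.

Definition compact_op (K : H -> H) : Prop :=
  precompact (K @` [set x : H | `|x| <= 1]).

(* T has a two-sided inverse modulo the compact operators, i.e. its image in
   the quotient of the bounded operators by the compact ones is invertible. *)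
Definition calkin_invertible (T : H -> H) : Prop :=
  exists S : {linear H -> H},
    [/\ continuous S,
        compact_op (fun x => S (T x) - x) &
        compact_op (fun x => T (S x) - x)].

Definition ess_spectrum (A : H -> H) : set R[i] :=
  [set lambda : R[i] | ~ calkin_invertible (fun x => A x - lambda *: x)].

(* For a bounded operator of an infinite dimensional space, the essential
   spectrum is compact and nonempty, so this supremum is a maximum. *)
Definition ess_spectral_radius (A : H -> H) : R :=
  sup [set complex.Re `|lambda| | lambda in ess_spectrum A].

Definition ker_sub_id (A : H -> H) : set H := [set x | A x - x = 0].

Variable dot : {dot H for (@conjC R[i])}.

(* S = T^*; S is determined by T, and exists for every bounded T. *)
Definition is_adjoint (T S : H -> H) : Prop :=
  forall x y : H, dot (T x) y = dot x (S y).

(* 0 <= A <= I. In the order of R[i], 0 <= z says that z is a nonnegative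
   real. *)
Definition positive_contraction (A : {linear H -> H}) : Prop :=
  continuous A /\ forall x : H, 0 <= dot (A x) x <= dot x x.

Definition arises_asymptotically (A T : H -> H) : Prop :=
  exists2 Ts : H -> H, is_adjoint T Ts &
    forall x : H, iter n Ts (iter n T x) @[n --> \oo] --> A x.

Definition arises_uniformly (A T : H -> H) : Prop :=
  exists2 Ts : H -> H, is_adjoint T Ts &
    opnorm (fun x => iter n Ts (iter n T x) - A x) @[n --> \oo] --> (0 : R).

Definition C_dot0 (T : H -> H) : Prop :=
  exists2 Ts : H -> H, is_adjoint T Ts &
    forall x : H, iter n Ts x @[n --> \oo] --> (0 : H).

Definition orthogonal_projection (P : H -> H) : Prop :=
  is_adjoint P P /\ forall x, P (P x) = P x.

Definition finite_rank_projection (P : H -> H) : Prop :=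
  orthogonal_projection P /\ finite_dim (range P).

(* An orthonormal basis of a closed subspace M is a maximal orthonormal subset
   of M. *)
Definition orthonormal_basis (M B : set H) : Prop :=
  [/\ B `<=` M,
      forall b, B b -> dot b b = 1,
      forall b c, B b -> B c -> b <> c -> dot b c = 0 &
      forall x, M x -> (forall b, B b -> dot x b = 0) -> x = 0].

(* The Hilbert space dimension of M is the cardinality of K. *)
Definition hdim_is (M : set H) (U : Type) (K : set U) : Prop :=
  exists2 B : set H, orthonormal_basis M B & (B #= K)%card.

Definition hdim_eq (M N : set H) : Prop :=
  exists2 B : set H, orthonormal_basis M B & hdim_is N B.

(* E is the (unique) spectral measure of A: a projection-valued measure on the
   Borel sets of R with A = \int t dE(t), this identity being expressed by
   means of the scalar measures w |-> <E(w) x, x>. The values of E outside the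
   Borel sets are irrelevant. *)
Record is_spectral_measure (A : H -> H) (E : set R -> {linear H -> H}) : Prop := {
  spectral_proj : forall w, measurable w -> orthogonal_projection (E w) ;
  spectral_setT : forall x, E setT x = x ;
  spectral_setI : forall v w, measurable v -> measurable w ->
    forall x, E (v `&` w) x = E v (E w x) ;
  spectral_sigma_additive : forall F : nat -> set R,
    (forall n, measurable (F n)) -> trivIset setT F ->
    forall x, (\sum_(0 <= k < n) E (F k) x) @[n --> \oo] -->
              E (\bigcup_n F n) x ;
  spectral_integral : forall x,
    exists mu : {measure set R -> \bar R},
      [/\ forall w, measurable w -> (mu w = (complex.Re (dot (E w x) x))%:E)%E,
          mu.-integrable setT (EFin : R -> \bar R) &
          dot (A x) x = (\int[mu]_(t in setT) t)%:C] }.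

End Operators.

(* Main.v *)
Require Import Defs.
From HB Require Import structures.
From mathcomp Require Import all_boot all_order all_algebra sesquilinear.
From mathcomp Require Import all_classical all_reals all_analysis.
From mathcomp Require Import complex.
From mathcomp Require Import ring lra.

Set Implicit Arguments.
Unset Strict Implicit.
Unset Printing Implicit Defensive.

Import Order.TTheory GRing.Theory Num.Theory Num.Def.
Import numFieldNormedType.Exports.

Local Open Scope classical_set_scope.
Local Open Scope ring_scope.
Local Open Scope complex_scope.

(* The operator [T] with [T^*n T^n --> A] is a weighted shift. Cut ]0, 1] into
   the blocks {1} and ]k/(k+1), (k+1)/(k+2)] and apply Gram-Schmidt, for the
   form <Ax, y>, to the projections of a dense sequence on the spectral
   subspaces of the blocks. The resulting vectors [f j] lie each in one block and
   satisfy <A (f i), f j> = 0 for i <> j and Parseval's identity for <Ax, x>.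
   If s is an injection that moves every [f j] to a higher block (or keeps it in
   the block {1}), then T x = \sum_j <x, A (f j)> f (s j) is a contraction with
   <A T x, T x> = <A x, x>, and T^n x lies in blocks above n/(n+1), where the
   form is at least n/(n+1) |.|^2; this forces uniform convergence. Such an s
   exists as soon as every E(]d, 1]) with d < 1 has infinite rank.
   Otherwise E(]d, 1[) = 0 for some d < 1 and ker (A - I) is finite-dimensional;
   if A = lim T^*n T^n, then T preserves the orthogonal complement of
   ker (A - I), on which <A x, x> = <A T^n x, T^n x> <= d |T^n x|^2 --> d <A x, x>,
   so A is the projection on ker (A - I). *)

(** * Complex scalars and normed spaces *)

Section ComplexNumbers.
Variable R : realType.
Implicit Types (a b c : R[i]).

(** Put e_j = A^(1/2) (f j). The nonzero e_j form an orthonormal basis of the closure of the range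
    of A, V e_j = e_(s j) defines an isometry there, and T is formally A^(-1/2) V A^(1/2). Working
    with the form <Ax, y> avoids square roots and multiplicity theory. The obstacle is that A^(-1/2)
    may be unbounded: T is a contraction because the growth under A^(-1/2) on the target block is
    compensated by the decrease under A^(1/2) on the source block, which is why [s] climbs by whole
    blocks. Nothing lies above 1, so {1} must be a block sent into itself. If its rank is infinite,
    every f j can be sent into it; if its rank is finite and nonzero, T is the identity on it and is
    not C_.0, whence the condition on ker (A - I). All four conditions are compared with one
    alternative: every E(]d, 1]) with d < 1 has infinite rank, or A is a projection of finite rank.
    For the essential spectrum, 1 belongs to it in the first case, while a finite rank of E(]d, 1])
    confines it to the disc of radius d. For the dimensions, equality with a finite-dimensional
    E(]d, 1]) leaves no room in ]0, d]. *)

Definition sqnormc c : R := complex.Re c ^+ 2 + complex.Im c ^+ 2.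

Lemma mul_conjc c : c * c^*%C = (sqnormc c)%:C.
Proof. by case: c => x y; simpc; rewrite /sqnormc /=; congr (_ +i* _); ring. Qed.

Lemma sqnormc_ge0 c : 0 <= sqnormc c.
Proof. by rewrite addr_ge0 ?sqr_ge0. Qed.

Lemma sqnormc0 : sqnormc 0 = 0.
Proof. by rewrite /sqnormc /= expr0n addr0. Qed.

Lemma sqnormc_eq0 c : sqnormc c = 0 -> c = 0.
Proof.
move/eqP; rewrite paddr_eq0 ?sqr_ge0 // !sqrf_eq0; case: c => x y /=.
by case/andP => /eqP -> /eqP ->.
Qed.

Lemma sqnormcM a b : sqnormc (a * b) = sqnormc a * sqnormc b.
Proof. by case: a b => x y [z t]; rewrite /sqnormc /=; ring. Qed.

Lemma sqnormcN c : sqnormc (- c) = sqnormc c.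
Proof. by case: c => x y; rewrite /sqnormc /= !sqrrN. Qed.

Lemma sqnormc_real (x : R) : sqnormc x%:C = x ^+ 2.
Proof. by rewrite /sqnormc /= [0 ^+ 2]expr0n /= addr0. Qed.

Lemma normc_sqnormc c : `|c| = (Num.sqrt (sqnormc c))%:C.
Proof. by rewrite normc_def. Qed.

Lemma ReD a b : complex.Re (a + b) = complex.Re a + complex.Re b.
Proof. by case: a b => ? ? []. Qed.

Lemma ImD a b : complex.Im (a + b) = complex.Im a + complex.Im b.
Proof. by case: a b => ? ? []. Qed.

Lemma ReN a : complex.Re (- a) = - complex.Re a.
Proof. by case: a. Qed.

Lemma Re_conjc a : complex.Re a^*%C = complex.Re a.
Proof. by case: a. Qed.

Lemma ger0_Re c : 0 <= c -> c = (complex.Re c)%:C /\ 0 <= complex.Re c.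
Proof. by case: c => x y; rewrite lecE /= => /andP [/eqP -> ->]. Qed.

Lemma sqr_Re_le c : complex.Re c ^+ 2 <= sqnormc c.
Proof. by rewrite lerDl sqr_ge0. Qed.

(** The discriminant argument behind Cauchy-Schwarz: [a] and [b] are the two squared norms, [d] is
    the squared modulus of the inner product, and the quadratic is the squared norm of x - t <x, y>
    y, minimal at [t = 1 / b]. *)
Lemma quadratic_discr (a b d : R) : 0 <= a -> 0 <= b -> 0 <= d ->
  (forall t, 0 <= a - 2 * t * d + t ^+ 2 * d * b) -> d <= a * b.
Proof.
move=> a0 b0 d0 h; have [bE|bn0] := eqVneq b 0.
  rewrite bE mulr0; rewrite leNgt; apply/negP => dp.
  (* For [b = 0] the expression is affine in [t]; this value of [t] makes it equal to -1. *)
  have := h ((a + 1) / (2 * d)); rewrite bE mulr0 addr0.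
  have -> : 2 * ((a + 1) / (2 * d)) * d = a + 1 by field; rewrite gt_eqF.
  by lra.
have bp : 0 < b by rewrite lt_def bn0.
have := h b^-1.
have -> : a - 2 * b^-1 * d + b^-1 ^+ 2 * d * b = a - d / b by field.
by rewrite subr_ge0 ler_pdivrMr.
Qed.

End ComplexNumbers.

Section Hilbert.
Variables (R : realType) (H : completeNormedModType R[i]).
Implicit Types (x y z : H) (c : R[i]).

Definition rnorm x : R := complex.Re `|x|.

Lemma normE x : `|x| = (rnorm x)%:C.
Proof. by have [-> _] := ger0_Re (normr_ge0 x). Qed.

Lemma rnorm_ge0 x : 0 <= rnorm x.
Proof. by have [] := ger0_Re (normr_ge0 x). Qed.

Lemma rnorm0 : rnorm 0 = 0.
Proof. by rewrite /rnorm normr0. Qed.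

Lemma rnorm_eq0 x : rnorm x = 0 -> x = 0.
Proof. by move=> h; apply/normr0_eq0; rewrite normE h. Qed.

Lemma rnormN x : rnorm (- x) = rnorm x.
Proof. by rewrite /rnorm normrN. Qed.

Lemma rnormB x y : rnorm (x - y) = rnorm (y - x).
Proof. by rewrite /rnorm distrC. Qed.

Lemma ler_rnormD x y : rnorm (x + y) <= rnorm x + rnorm y.
Proof. by rewrite -lecR -normE rmorphD /= -!normE ler_normD. Qed.

Lemma ler_rnormB x y z : rnorm (x - z) <= rnorm (x - y) + rnorm (y - z).
Proof. by rewrite (_ : x - z = (x - y) + (y - z)) ?ler_rnormD // addrA subrK. Qed.

Lemma rnormZ c x : rnorm (c *: x) = complex.Re `|c| * rnorm x.
Proof.
by rewrite /rnorm normrZ normE normc_sqnormc /= mulr0 subr0.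
Qed.

Lemma cvg_rnormP (u : nat -> H) (l : H) :
  u n @[n --> \oo] --> l <->
  (forall e : R, 0 < e -> exists N, forall n, (N <= n)%N -> rnorm (u n - l) < e).
Proof.
split=> [ul e e0|h].
  have e0' : 0 < e%:C by rewrite ltcR.
  have /cvgrPdist_lt /(_ _ e0') := ul.
  move=> [N _ hN]; exists N => n Nn; have := hN n Nn => /=.
  by rewrite normE ltcR rnormB.
apply/cvgrPdist_lt => e e0.
have [eE _] := ger0_Re (ltW e0).
move: e0; rewrite eE ltcR => e0.
have [N hN] := h _ e0; exists N => // n /= Nn.
by rewrite normE ltcR rnormB; exact: hN.
Qed.

Lemma cvg_rnorm0 (u : nat -> H) (l : H) :
  u n @[n --> \oo] --> l <-> rnorm (u n - l) @[n --> \oo] --> (0 : R).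
Proof.
rewrite cvg_rnormP; split=> [h|h].
  apply/cvgrPdist_lt => e /h [N hN]; exists N => // n /= Nn.
  by rewrite sub0r normrN ger0_norm ?rnorm_ge0 //; exact: hN.
move=> e e0; have /cvgrPdist_lt /(_ _ e0) [N _ hN] := h.
exists N => n Nn; have := hN n Nn => /=.
by rewrite sub0r normrN ger0_norm ?rnorm_ge0.
Qed.

Lemma cauchy_rnorm_cvg (u : nat -> H) :
  (forall e : R, 0 < e -> exists N, forall m n, (N <= m)%N -> (m <= n)%N ->
     rnorm (u n - u m) < e) ->
  exists l : H, u n @[n --> \oo] --> l.
Proof.
move=> h; suff : cvgn u by move=> /cvg_ex [l ul]; exists l.
apply/cauchy_cvgP/cauchyP => e e0.
have [eE _] := ger0_Re (ltW e0).
move: e0; rewrite eE ltcR => e0.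
have [N hN] := h _ e0; exists (u N); exists N => // n /= Nn.
by rewrite -ball_normE /ball_ /= normE ltcR rnormB; exact: hN.
Qed.

Lemma cvg_rnorm_le (u : nat -> H) (l : H) (b : R) :
  u n @[n --> \oo] --> l -> (forall n, rnorm (u n) <= b) -> rnorm l <= b.
Proof.
move=> /cvg_rnormP ul ub; apply/ler_addgt0Pr => e /ul [N /(_ N (leqnn N))].
rewrite rnormB => lt_e; have := ler_rnormD (l - u N) (u N); rewrite subrK.
have := ub N; lra.
Qed.

Lemma cvg_uniqueH (u : nat -> H) (l l' : H) :
  u n @[n --> \oo] --> l -> u n @[n --> \oo] --> l' -> l = l'.
Proof. by move=> ul ul'; apply: (cvg_unique _ ul ul'); exact: norm_hausdorff. Qed.

Definition bounded_by (b : R) (T : H -> H) := forall x, rnorm (T x) <= b * rnorm x.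

Lemma bounded_continuous (T : {linear H -> H}) (b : R) :
  bounded_by b T -> continuous T.
Proof.
move=> Tb; apply: bounded_linear_continuous; apply/linear_boundedP.
exists (`|b|%:C); split; first by rewrite complex_real.
move=> r rb x; have [rE _] : r = (complex.Re r)%:C /\ 0 <= complex.Re r.
  by apply/ger0_Re/ltW/(le_lt_trans _ rb); rewrite ler0c.
move: rb; rewrite rE ltcR => rb.
rewrite !normE -rmorphM lecR (le_trans (Tb x)) // ler_wpM2r ?rnorm_ge0 //.
by rewrite (le_trans (ler_norm b)) // ltW.
Qed.

Lemma continuous_bounded (T : {linear H -> H}) :
  continuous T -> exists2 b : R, 0 < b & bounded_by b T.
Proof.
move=> /linear_bounded_continuous/linear_boundedP/pinfty_ex_gt0 [r r0 h].
have [rE rge0] := ger0_Re (ltW r0).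
move: r0 h; rewrite rE ltcR => r0 h; exists (complex.Re r) => // x.
by have := h x; rewrite !normE -rmorphM lecR.
Qed.

Lemma rnorm1_ball x : `|x| <= 1 -> rnorm x <= 1.
Proof. by rewrite normE lecR. Qed.

Lemma opnorm_le (T : H -> H) (b : R) : 0 <= b ->
  (forall x, rnorm x <= 1 -> rnorm (T x) <= b) -> opnorm T <= b.
Proof.
move=> b0 h; apply: ge_sup.
  by exists (rnorm (T 0)); exists 0 => //=; rewrite normr0.
by move=> _ [x /= /rnorm1_ball x1 <-]; exact: h.
Qed.

Lemma opnorm_ub (T : H -> H) (b : R) x : bounded_by b T -> 0 <= b ->
  rnorm x <= 1 -> rnorm (T x) <= opnorm T.
Proof.
move=> Tb b0 x1; apply: ub_le_sup; last by exists x => //=; rewrite normE lecR.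
exists b => _ [y /= /rnorm1_ball y1 <-].
by rewrite (le_trans (Tb y)) // ler_piMr.
Qed.

Lemma opnorm_ge0 (T : H -> H) (b : R) : bounded_by b T -> 0 <= b -> 0 <= opnorm T.
Proof.
move=> Tb b0; have : rnorm (0 : H) <= 1 by rewrite rnorm0.
by move=> /(opnorm_ub Tb b0); apply: le_trans; exact: rnorm_ge0.
Qed.

Lemma opnorm_bound (T : {linear H -> H}) : continuous T -> bounded_by (opnorm T) T.
Proof.
move=> /continuous_bounded [b b0 Tb] x.
have [->|x0] := eqVneq x 0; first by rewrite linear0 rnorm0 mulr0.
have nx : rnorm x != 0 by apply: contra x0 => /eqP/rnorm_eq0 ->.
have px : 0 < rnorm x by rewrite lt_def nx rnorm_ge0.
have := opnorm_ub (x := ((rnorm x)^-1)%:C *: x) Tb (ltW b0).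
rewrite linearZ !rnormZ normc_sqnormc sqnormc_real /= sqrtr_sqr.
rewrite ger0_norm ?invr_ge0 ?rnorm_ge0 // mulVf // => /(_ (lexx _)).
by rewrite mulrC ler_pdivrMr.
Qed.

Lemma contraction_opP (T : {linear H -> H}) :
  contraction_op T <-> bounded_by 1 T.
Proof.
split=> [[cT T1] x|Tb].
  by rewrite (le_trans (opnorm_bound cT x)) // ler_wpM2r ?rnorm_ge0.
split; first exact: bounded_continuous Tb.
by apply: opnorm_le => // x x1; rewrite (le_trans (Tb x)) // mul1r.
Qed.

Lemma bounded_cvg (T : {linear H -> H}) (b : R) (u : nat -> H) (l : H) :
  bounded_by b T -> u n @[n --> \oo] --> l -> T (u n) @[n --> \oo] --> T l.
Proof. by move=> /bounded_continuous cT ul; apply: continuous_cvg => //; exact: cT. Qed.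

Lemma fixed_cvg (P : {linear H -> H}) (b : R) (u : nat -> H) (l : H) :
  bounded_by b P -> (forall n, P (u n) = u n) -> u n @[n --> \oo] --> l -> P l = l.
Proof.
move=> Pb uP ul; have Pul := bounded_cvg Pb ul.
have PuE : (fun n => P (u n)) = u by apply/funext.
by rewrite PuE in Pul; exact: cvg_uniqueH Pul ul.
Qed.

End Hilbert.

(** * Inner products and positive semidefinite forms *)

Section InnerProduct.
Variables (R : realType) (H : completeNormedModType R[i]).
Variables (dot : {dot H for (@conjC R[i])}) (dot_norm : induces_norm dot).
Implicit Types (x y z : H) (c : R[i]).

Lemma dotC x y : dot x y = (dot y x)^*%C.
Proof. by rewrite (hermC dot) /= expr0 mul1r. Qed.

Lemma dotDl x y z : dot (x + y) z = dot x z + dot y z.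
Proof. by rewrite (linearDl dot). Qed.

Lemma dotDr x y z : dot x (y + z) = dot x y + dot x z.
Proof. by rewrite (linearDr dot). Qed.

Lemma dotZl c x y : dot (c *: x) y = c * dot x y.
Proof. by rewrite (linearZl_LR dot). Qed.

Lemma dotZr c x y : dot x (c *: y) = c^*%C * dot x y.
Proof. by rewrite (linearZr_LR dot). Qed.

Lemma dotNl x y : dot (- x) y = - dot x y.
Proof. by rewrite (linearNl dot). Qed.

Lemma dotNr x y : dot x (- y) = - dot x y.
Proof. by rewrite (linearNr dot). Qed.

Lemma dotBl x y z : dot (x - y) z = dot x z - dot y z.
Proof. by rewrite dotDl dotNl. Qed.

Lemma dotBr x y z : dot x (y - z) = dot x y - dot x z.
Proof. by rewrite dotDr dotNr. Qed.

Lemma dot0l x : dot 0 x = 0.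
Proof. by rewrite -(scale0r 0) dotZl mul0r. Qed.

Lemma dot0r x : dot x 0 = 0.
Proof. by rewrite dotC dot0l conjc0. Qed.

Lemma dot_suml I (r : seq I) (P : pred I) (F : I -> H) y :
  dot (\sum_(i <- r | P i) F i) y = \sum_(i <- r | P i) dot (F i) y.
Proof. by apply: (big_morph (dot^~ y)) => [? ?|]; rewrite ?dotDl ?dot0l. Qed.

Lemma dot_sumr I (r : seq I) (P : pred I) (F : I -> H) y :
  dot y (\sum_(i <- r | P i) F i) = \sum_(i <- r | P i) dot y (F i).
Proof. by apply: (big_morph (dot y)) => [? ?|]; rewrite ?dotDr ?dot0r. Qed.

Definition qform (B : H -> H) x : R := complex.Re (dot (B x) x).
Definition psd (B : H -> H) : Prop := forall x, 0 <= dot (B x) x.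

Lemma psd_id : psd idfun.
Proof. by move=> x; rewrite /= -dot_norm exprn_ge0. Qed.

Lemma psdE (B : H -> H) x : psd B -> dot (B x) x = (qform B x)%:C.
Proof. by move=> Bp; have [-> _] := ger0_Re (Bp x). Qed.

Lemma qform_ge0 (B : H -> H) x : psd B -> 0 <= qform B x.
Proof. by move=> Bp; have [_] := ger0_Re (Bp x). Qed.

Lemma rnorm_sqr x : rnorm x ^+ 2 = complex.Re (dot x x).
Proof. by rewrite -dot_norm normE -rmorphXn. Qed.

Lemma dot_rnorm x : dot x x = (rnorm x ^+ 2)%:C.
Proof. by rewrite -dot_norm normE -rmorphXn. Qed.

Lemma dot_eq0 x : dot x x = 0 -> x = 0.
Proof.
rewrite dot_rnorm => /complexI/eqP; rewrite sqrf_eq0 => /eqP; exact: rnorm_eq0.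
Qed.

Lemma dot_ext x y : (forall z, dot x z = dot y z) -> x = y.
Proof.
by move=> h; apply/eqP; rewrite -subr_eq0; apply/eqP/dot_eq0; rewrite dotBl h subrr.
Qed.

Section Forms.
Variables (B : {linear H -> H}) (B_psd : psd B).

(** Polarization: that <Bz, z> is real at z = x + y and at z = x + iy yields the two real equations
    that make up the claim. *)
Lemma real_form_selfadjoint : is_adjoint dot B B.
Proof.
move=> x y; rewrite [RHS]dotC.
have Q0 z : complex.Im (dot (B z) z) = 0 by rewrite psdE.
have := Q0 (x + y); have := Q0 (x + 'i%C *: y).
rewrite !(linearD B) !(linearZ_LR B) !dotDl !dotDr !dotZl !dotZr !ImD.
have := Q0 x; have := Q0 y.
case: (dot (B x) x) => p1 p2; case: (dot (B y) y) => q1 q2.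
case: (dot (B x) y) => r1 r2; case: (dot (B y) x) => s1 s2 /=.
move=> -> -> h1 h2; apply/eqP; rewrite eq_complex /=.
by apply/andP; split; apply/eqP; lra.
Qed.

Lemma psd_formC x y : dot (B x) y = (dot (B y) x)^*%C.
Proof. by rewrite real_form_selfadjoint dotC. Qed.

Lemma qformD x y :
  qform B (x + y) = qform B x + qform B y + 2 * complex.Re (dot (B x) y).
Proof.
rewrite /qform (linearD B) !dotDl !dotDr !ReD (psd_formC y x) Re_conjc; ring.
Qed.

Lemma qformN x : qform B (- x) = qform B x.
Proof. by rewrite /qform (linearN B) dotNl dotNr opprK. Qed.

Lemma qformZ c x : qform B (c *: x) = sqnormc c * qform B x.
Proof.
by rewrite /qform (linearZ_LR B) dotZl dotZr mulrA mul_conjc psdE //= mul0r subr0.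
Qed.

Lemma qform0 : qform B 0 = 0.
Proof. by rewrite /qform (linear0 B) dot0l. Qed.

Lemma qformB x y :
  qform B (x - y) = qform B x + qform B y - 2 * complex.Re (dot (B x) y).
Proof. by rewrite qformD qformN dotNr ReN; ring. Qed.

Lemma cauchy_schwarz x y : sqnormc (dot (B x) y) <= qform B x * qform B y.
Proof.
apply: quadratic_discr; rewrite ?qform_ge0 ?sqnormc_ge0 // => t.
have := qform_ge0 (x + (- t%:C * dot (B x) y) *: y) B_psd.
rewrite qformD qformZ sqnormcM sqnormcN sqnormc_real dotZr.
rewrite rmorphM rmorphN /= oppr0.
set a := dot (B x) y => h; have := h.
suff -> : complex.Re (- t%:C * a^* * a) = - t * sqnormc a by lra.
by rewrite -mulrA (mulrC a^*%C) mul_conjc -rmorphN -rmorphM.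
Qed.

Lemma qform_null x y : qform B x = 0 -> dot (B x) y = 0.
Proof.
move=> Qx; apply/sqnormc_eq0/eqP; rewrite eq_le sqnormc_ge0 andbT.
by rewrite (le_trans (cauchy_schwarz x y)) // Qx mul0r.
Qed.

Lemma qform_null_ker x : qform B x = 0 -> B x = 0.
Proof. by move=> Qx; apply/dot_eq0; rewrite qform_null. Qed.

Lemma qformDnull x y : qform B y = 0 -> qform B (x + y) = qform B x.
Proof. by move=> Qy; rewrite qformD Qy psd_formC qform_null //=; ring. Qed.


End Forms.

End InnerProduct.

Arguments dotC {R H dot}.
Arguments dotDl {R H dot}.
Arguments dotDr {R H dot}.
Arguments dotZl {R H dot}.
Arguments dotZr {R H dot}.
Arguments dotNl {R H dot}.
Arguments dotNr {R H dot}.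
Arguments dotBl {R H dot}.
Arguments dotBr {R H dot}.
Arguments dot0l {R H dot}.
Arguments dot0r {R H dot}.
Arguments dot_suml {R H dot} [I r P F].
Arguments dot_sumr {R H dot} [I r P F].

(** * Gram-Schmidt for semidefinite forms *)

Section GramSchmidt.
Variables (R : realType) (H : completeNormedModType R[i]).
Variables (dot : {dot H for (@conjC R[i])}) (dot_norm : induces_norm dot).
Variables (B : {linear H -> H}) (B_psd : psd dot B).
Implicit Types (x y z : H) (c : R[i]) (f u : nat -> H).

Local Notation Q := (qform dot B).

Definition form_orthogonal f := forall i j : nat, i <> j -> dot (B (f i)) (f j) = 0.

(* Vanishing members are kept so that no reindexing is necessary. *)
Definition form_orthonormal f :=
  form_orthogonal f /\ forall i, f i = 0 \/ Q (f i) = 1.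

Lemma qform_sum_orth f (c : nat -> R[i]) n : form_orthogonal f ->
  Q (\sum_(i < n) c i *: f i) = \sum_(i < n) sqnormc (c i) * Q (f i).
Proof.
move=> f0; elim: n => [|n IH]; first by rewrite !big_ord0 (qform0 dot).
rewrite !big_ord_recr /= (qformD B_psd) IH (qformZ B_psd).
rewrite (linear_sum B) dot_suml [X in complex.Re X]big1 ?mulr0 ?addr0 // => i _.
rewrite (linearZ_LR B) dotZl dotZr f0 ?mulr0 // => iE.
by have := ltn_ord i; rewrite iE ltnn.
Qed.

(** The remainder of the generalized Fourier expansion with respect to the form; for an orthonormal
    [f] its form value is the defect in Bessel's inequality. *)
Definition residual f x n : H := x - \sum_(j < n) dot (B x) (f j) *: f j.

Lemma residual0 f x : residual f x 0%N = x.
Proof. by rewrite /residual big_ord0 subr0. Qed.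

Lemma residualS f x n :
  residual f x n.+1 = residual f x n - dot (B x) (f n) *: f n.
Proof. by rewrite /residual big_ord_recr /= opprD addrA. Qed.

Lemma residualD f x y n : residual f (x + y) n = residual f x n + residual f y n.
Proof.
rewrite /residual addrACA -opprD -big_split /=; congr (_ - _).
by apply: eq_bigr => i _; rewrite (linearD B) dotDl scalerDl.
Qed.

Lemma residual_coef_ge f x n m : form_orthogonal f -> (n <= m)%N ->
  dot (B (residual f x n)) (f m) = dot (B x) (f m).
Proof.
move=> f0 nm; rewrite /residual (linearB B) dotBl (linear_sum B) dot_suml big1 ?subr0 //.
move=> i _; rewrite (linearZ_LR B) dotZl f0 ?mulr0 // => iE.
by have := leq_trans (ltn_ord i) nm; rewrite iE ltnn.
Qed.

Lemma residual_coef_lt f x n m : form_orthonormal f -> (m < n)%N ->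
  dot (B (residual f x n)) (f m) = 0.
Proof.
move=> [f0 f1] mn; rewrite /residual (linearB B) dotBl (linear_sum B) dot_suml.
rewrite (bigD1 (Ordinal mn)) //= big1 ?addr0; last first.
  move=> l lm; rewrite (linearZ_LR B) dotZl f0 ?mulr0 // => lE.
  by move/eqP: lm; apply; exact: val_inj.
rewrite (linearZ_LR B) dotZl; case: (f1 m) => [->|fm].
  by rewrite dot0r mul0r subrr.
by rewrite (psdE _ B_psd) fm mulr1 subrr.
Qed.

Lemma qform_residualS f x n : form_orthonormal f ->
  Q (residual f x n.+1) = Q (residual f x n) - sqnormc (dot (B x) (f n)).
Proof.
move=> [f0 f1]; rewrite residualS (qformB B_psd) (qformZ B_psd) dotZr.
rewrite residual_coef_ge // [X in complex.Re X]mulrC mul_conjc /=.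
case: (f1 n) => [->|->]; last ring.
by rewrite dot0r sqnormc0; ring.
Qed.

Lemma qform_residual f x n : form_orthonormal f ->
  Q (residual f x n) = Q x - \sum_(j < n) sqnormc (dot (B x) (f j)).
Proof.
move=> f1; elim: n => [|n IH]; first by rewrite residual0 big_ord0 subr0.
by rewrite qform_residualS // IH big_ord_recr /=; ring.
Qed.

Lemma qform_residual_le f x n : form_orthonormal f -> Q (residual f x n) <= Q x.
Proof. by move=> f1; rewrite qform_residual // gerBl sumr_ge0 // => i _; exact: sqnormc_ge0. Qed.

Lemma qform_residual_mono f x n m : form_orthonormal f -> (n <= m)%N ->
  Q (residual f x m) <= Q (residual f x n).
Proof.
move=> f1; elim: m => [|m IH]; first by rewrite leqn0 => /eqP ->.
rewrite leq_eqVlt => /predU1P [->//|/IH]; apply: le_trans.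
by rewrite qform_residualS // gerBl sqnormc_ge0.
Qed.

(** The form is only semidefinite, so null vectors other than 0 may occur; they cannot be normalized
    and are all replaced by 0. *)
Definition normalized x : H := if Q x == 0 then 0 else ((Num.sqrt (Q x))^-1)%:C *: x.

Lemma qform_normalized x : normalized x = 0 \/ Q (normalized x) = 1.
Proof.
rewrite /normalized; case: eqP => [|/eqP Qx]; [by left|right].
rewrite (qformZ B_psd) sqnormc_real exprVn sqr_sqrtr ?qform_ge0 //.
by rewrite mulVf.
Qed.

Lemma normalized_residual x : Q (x - dot (B x) (normalized x) *: normalized x) = 0.
Proof.
rewrite /normalized; case: eqP => [Qx|/eqP Qx]; first by rewrite scaler0 subr0.
have Qp : 0 < Q x by rewrite lt_def Qx qform_ge0.
set s := (Num.sqrt (Q x))^-1.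
have sQ : s ^+ 2 * Q x = 1.
  by rewrite /s exprVn sqr_sqrtr ?qform_ge0 // mulVf.
rewrite dotZr (psdE _ B_psd) conjc_real scalerA -!rmorphM /=.
rewrite mulrAC -expr2 sQ scale1r subrr.
exact: qform0.
Qed.

Lemma form_orthogonal_normalized x y : dot (B x) y = 0 -> dot (B (normalized x)) y = 0.
Proof.
rewrite /normalized; case: eqP => _ xy; first by rewrite linear0 dot0l.
by rewrite (linearZ_LR B) dotZl xy mulr0.
Qed.

Section Process.
Variable u : nat -> H.

(** Each new vector depends on all the earlier ones, so the recursion carries the whole list; [gsE]
    recovers the usual formula. *)
Fixpoint gs_seq n : seq H :=
  if n is m.+1 then
    rcons (gs_seq m) (normalized (u m - \sum_(g <- gs_seq m) dot (B (u m)) g *: g))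
  else [::].

Definition gs n : H := normalized (u n - \sum_(g <- gs_seq n) dot (B (u n)) g *: g).

Lemma gs_seqE n : gs_seq n = mkseq gs n.
Proof.
elim: n => // n IH; change (rcons (gs_seq n) (gs n) = mkseq gs n.+1).
by rewrite IH /mkseq -[in RHS]addn1 iotaD map_cat cats1.
Qed.

Lemma gsE n : gs n = normalized (residual gs (u n) n).
Proof.
rewrite {1}/gs gs_seqE big_map -[in LHS](subn0 n) /residual.
by rewrite -(big_mkord xpredT (fun j => dot (B (u n)) (gs j) *: gs j)) /index_iota subn0.
Qed.

Lemma gs_scaled n : exists c, gs n = c *: residual gs (u n) n.
Proof.
rewrite gsE /normalized; case: eqP => _; last by eexists.
by exists 0; rewrite scale0r.
Qed.

Lemma gs_orthonormal : form_orthonormal gs.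
Proof.
split=> [|i]; last by rewrite gsE; exact: qform_normalized.
suff h n : forall i j : nat, (i < n)%N -> (j < n)%N -> i <> j -> dot (B (gs i)) (gs j) = 0.
  by move=> i j; apply: (h (maxn i j).+1); rewrite ltnS ?leq_maxl ?leq_maxr.
elim: n => // n IH i j; rewrite !ltnS.
have hn k : (k < n)%N -> dot (B (gs n)) (gs k) = 0.
  move=> kn; rewrite (gsE n); apply: form_orthogonal_normalized.
  rewrite /residual (linearB B) dotBl (linear_sum B) dot_suml.
  rewrite (bigD1 (Ordinal kn)) //= big1 ?addr0; last first.
    move=> l lk; rewrite (linearZ_LR B) dotZl IH ?mulr0 // => lE.
    by move/eqP: lk; apply; apply: val_inj.
  rewrite (linearZ_LR B) dotZl.
  have : gs k = 0 \/ Q (gs k) = 1 by rewrite gsE; exact: qform_normalized.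
  case=> [->|gk]; first by rewrite dot0r mul0r subrr.
  by rewrite (psdE _ B_psd) gk mulr1 subrr.
rewrite leq_eqVlt => /predU1P [->|ni]; rewrite leq_eqVlt => /predU1P [->|nj] // ij.
- exact: hn.
- by rewrite (psd_formC B_psd (gs i)) hn // conjc0.
exact: IH.
Qed.

(** Up to a null vector of the form, [u m] lies in the span of the vectors produced from [u 0], ...,
    [u m], and later residuals can only have a smaller form value. *)
Lemma gs_null n m : (m < n)%N -> Q (residual gs (u m) n) = 0.
Proof.
move=> mn; apply/eqP; rewrite eq_le qform_ge0 // andbT.
rewrite (le_trans (qform_residual_mono _ gs_orthonormal mn)) // residualS.
rewrite -(residual_coef_ge _ (proj1 gs_orthonormal) (leqnn m)) gsE.
by rewrite normalized_residual.
Qed.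

(** Taking residuals is additive and does not increase the form, so approximation in the seminorm of
    the form by vectors that finitely many members exhaust is enough for Parseval's identity. *)
Lemma gs_parseval x :
  (forall e : R, 0 < e -> exists z,
     Q (x - z) <= e /\ exists n, Q (residual gs z n) = 0) ->
  (\sum_(j < n) sqnormc (dot (B x) (gs j))) @[n --> \oo] --> Q x.
Proof.
move=> h; apply/cvgrPdist_le => e e0.
have e2 : 0 < e / 2 by rewrite divr_gt0.
have [z [xz [N zN]]] := h _ e2.
exists N => // n /= Nn; rewrite -qform_residual //; last exact: gs_orthonormal.
rewrite ger0_norm ?qform_ge0 //.
have -> : residual gs x n = residual gs (x - z) n + residual gs z n.
  by rewrite -residualD subrK.
rewrite (qformDnull B_psd).
  rewrite (le_trans (qform_residual_le _ _ gs_orthonormal)) // (le_trans xz) //.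
  by rewrite ler_pdivrMr // ler_peMr ?ler1n // ltW.
apply/eqP; rewrite eq_le qform_ge0 // andbT -zN.
exact: (qform_residual_mono _ gs_orthonormal).
Qed.

Lemma residual_null_sum (v : nat -> H) K :
  (forall k, (k < K)%N -> exists n, Q (residual gs (v k) n) = 0) ->
  exists n, Q (residual gs (\sum_(k < K) v k) n) = 0.
Proof.
elim: K => [|K IH] h.
  by exists 0%N; rewrite big_ord0 residual0 (qform0 dot).
have [|n hn] := IH; first by move=> k kK; apply: h; exact: ltnW.
have [m hm] := h K (ltnSn K).
exists (maxn n m); rewrite big_ord_recr /= residualD.
have mono z k : (k <= maxn n m)%N -> Q (residual gs z k) = 0 ->
    Q (residual gs z (maxn n m)) = 0.
  move=> kM zk; apply/eqP; rewrite eq_le qform_ge0 // andbT -zk.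
  exact: (qform_residual_mono _ gs_orthonormal).
rewrite (qformDnull B_psd); first exact: (mono _ _ (leq_maxl _ _) hn).
exact: (mono _ _ (leq_maxr _ _) hm).
Qed.

End Process.

End GramSchmidt.

(** * Bessel sequences *)

Section BesselSequences.
Variables (R : realType) (H : completeNormedModType R[i]).
Variables (dot : {dot H for (@conjC R[i])}) (dot_norm : induces_norm dot).
Implicit Types (x y z : H) (c : nat -> R[i]) (g h : nat -> H) (b : R).

Lemma dot_cauchy_schwarz x y :
  sqnormc (dot x y) <= rnorm x ^+ 2 * rnorm y ^+ 2.
Proof.
have := cauchy_schwarz (psd_id dot_norm) x y.
by rewrite /qform /= -!(rnorm_sqr dot_norm).
Qed.

Lemma linear_of_subproof (f : H -> H) : linear f -> exists T : {linear H -> H}, T =1 f.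
Proof.
move=> lf; pose T : {linear H -> H} := HB.pack f (GRing.isLinear.Build _ _ _ _ f lf).
by exists T.
Qed.

Lemma iter_linear (T : {linear H -> H}) n : linear (iter n T).
Proof. by elim: n => // n IH a x y; rewrite /= IH linearP. Qed.

Lemma limit_linear (F : nat -> H -> H) (T : H -> H) :
  (forall n, linear (F n)) -> (forall x, F n x @[n --> \oo] --> T x) -> linear T.
Proof.
move=> lF FT a x y; apply: (cvg_uniqueH (FT _)).
have -> : (fun n => F n (a *: x + y)) = (fun n => a *: F n x + F n y).
  by apply/funext => n; rewrite lF.
by apply: cvgD (FT y); apply: cvgZ (FT x); exact: cvg_cst.
Qed.

Lemma dot_cvg_eq (u v : nat -> H) (l m x y : H) :
  (forall n, dot (u n) y = dot x (v n)) ->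
  u n @[n --> \oo] --> l -> v n @[n --> \oo] --> m -> dot l y = dot x m.
Proof.
move=> uv /cvg_rnormP ul /cvg_rnormP vm.
apply/eqP; rewrite -subr_eq0; apply/eqP/sqnormc_eq0/eqP.
rewrite eq_le sqnormc_ge0 andbT; apply/ler_addgt0Pr => e e0; rewrite add0r.
(* [K] collects the two Cauchy-Schwarz bounds for the error, plus 1 to be positive; [d] is chosen so
   that [K * d ^+ 2 = e]. *)
pose K := 2 * (rnorm x ^+ 2 + rnorm y ^+ 2) + 1.
have K0 : 0 < K by rewrite ltr_wpDl // mulr_ge0 // addr_ge0 ?sqr_ge0.
pose d := Num.sqrt (e / K).
have d2 : d ^+ 2 = e / K by rewrite sqr_sqrtr // divr_ge0 ?ltW.
have d0 : 0 < d by rewrite sqrtr_gt0 divr_gt0.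
have [N hN] := ul _ d0; have [M hM] := vm _ d0.
pose n := maxn N M.
have -> : dot l y - dot x m = dot (l - u n) y + dot x (v n - m).
  by rewrite dotBl dotBr uv; ring.
have sqD (a1 a2 : R[i]) : sqnormc (a1 + a2) <= 2 * sqnormc a1 + 2 * sqnormc a2.
  case: a1 a2 => p p1 [r r1]; rewrite /sqnormc /=.
  by have := sqr_ge0 (p - r); have := sqr_ge0 (p1 - r1); lra.
apply: (le_trans (sqD _ _)).
have h1 : rnorm (l - u n) ^+ 2 <= d ^+ 2.
  by rewrite ler_sqr ?nnegrE ?rnorm_ge0 1?ltW // rnormB hN // leq_maxl.
have h2 : rnorm (v n - m) ^+ 2 <= d ^+ 2.
  by rewrite ler_sqr ?nnegrE ?rnorm_ge0 1?ltW // hM // leq_maxr.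
have c1 := le_trans (dot_cauchy_schwarz (l - u n) y) (ler_wpM2r (sqr_ge0 _) h1).
have c2 := le_trans (dot_cauchy_schwarz x (v n - m)) (ler_wpM2l (sqr_ge0 _) h2).
have : K * d ^+ 2 = e by rewrite d2 mulrC divfK // gt_eqF.
have := sqr_ge0 d; rewrite /K; move: c1 c2; lra.
Qed.

(** From |Sy|^2 = <TSy, y> <= b |Sy| |y|, after division by |Sy|. *)
Lemma adjoint_bounded (T S : H -> H) b :
  0 <= b -> bounded_by b T -> is_adjoint dot T S -> bounded_by b S.
Proof.
move=> b0 Tb TS y.
have [->|Sy] := eqVneq (rnorm (S y)) 0; first by rewrite mulr_ge0 ?rnorm_ge0.
have Sp : 0 < rnorm (S y) by rewrite lt_def Sy rnorm_ge0.
rewrite -(ler_pM2l Sp) -expr2.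
have E : rnorm (S y) ^+ 2 = complex.Re (dot (T (S y)) y).
  by rewrite TS -(rnorm_sqr dot_norm).
have : (rnorm (S y) ^+ 2) ^+ 2 <= (rnorm (T (S y)) * rnorm y) ^+ 2.
  by rewrite E exprMn (le_trans (sqr_Re_le _)) // dot_cauchy_schwarz.
rewrite ler_sqr ?nnegrE ?sqr_ge0 ?mulr_ge0 ?rnorm_ge0 // => /le_trans; apply.
by rewrite [leRHS]mulrA [_ * b]mulrC ler_wpM2r ?rnorm_ge0.
Qed.

Lemma adjointC (T S : H -> H) : is_adjoint dot T S -> is_adjoint dot S T.
Proof. by move=> TS x y; rewrite dotC -TS -dotC. Qed.

Lemma adjoint_iter (T S : H -> H) n :
  is_adjoint dot T S -> is_adjoint dot (iter n T) (iter n S).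
Proof. by move=> TS; elim: n => // n IH x y; rewrite iterS TS IH -iterSr. Qed.

(** The synthesis map from square summable coefficients to [H] has squared norm at most [b],
    expressed on finite sums. *)
Definition bessel_seq b g := forall n c,
  rnorm (\sum_(j < n) c j *: g j) ^+ 2 <= b * \sum_(j < n) sqnormc (c j).

(** The analysis map is adjoint to the synthesis map. Concretely, the sum S equals <x, y> for y the
    synthesis of the coefficients of [x], whence S^2 <= |x|^2 |y|^2 <= |x|^2 b S. *)
Lemma bessel_dual b g x n : 0 <= b -> bessel_seq b g ->
  \sum_(j < n) sqnormc (dot x (g j)) <= b * rnorm x ^+ 2.
Proof.
move=> b0 gb; set S := \sum_(j < n) _.
have S0 : 0 <= S by rewrite sumr_ge0 // => i _; exact: sqnormc_ge0.
pose y := \sum_(j < n) dot x (g j) *: g j.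
have yS : dot x y = S%:C.
  rewrite dot_sumr [RHS]rmorph_sum; apply: eq_bigr => j _.
  by rewrite dotZr mulrC mul_conjc.
have := dot_cauchy_schwarz x y; rewrite yS sqnormc_real => h.
have {}h := le_trans h (ler_wpM2l (sqr_ge0 _) (gb n (fun j => dot x (g j)))).
have [->|Sn] := eqVneq S 0; first by rewrite mulr_ge0 ?sqr_ge0.
have Sp : 0 < S by rewrite lt_def Sn.
rewrite -(ler_pM2l Sp) -expr2 (le_trans h) // -/S.
by rewrite mulrA mulrC (mulrC _ b).
Qed.

Lemma sum_tail (V : zmodType) (F : nat -> V) m n : (m <= n)%N ->
  \sum_(j < n) F j - \sum_(j < m) F j = \sum_(j < n) (if (j < m)%N then 0 else F j).
Proof.
move=> mn; rewrite (big_ord_widen n F mn) [in LHS](bigID (fun j : 'I_n => (j < m)%N)) /=.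
rewrite addrAC subrr add0r big_mkcond; apply: eq_bigr => j _.
by case: ltnP.
Qed.

Lemma bessel_series_cvg b g c M : 0 <= b -> bessel_seq b g ->
  (forall n, \sum_(j < n) sqnormc (c j) <= M) ->
  exists l : H, (\sum_(j < n) c j *: g j) @[n --> \oo] --> l.
Proof.
move=> b0 gb cM; pose s n := \sum_(j < n) sqnormc (c j).
have ns : nondecreasing_seq s.
  apply/nondecreasing_seqP => n; rewrite /s big_ord_recr /= lerDl; exact: sqnormc_ge0.
have cs : cvgn s.
  by apply: nondecreasing_is_cvgn => //; exists M => _ [n _ <-]; exact: cM.
have sL n : s n <= limn s by exact: nondecreasing_cvgn_le.
apply: cauchy_rnorm_cvg => e e0.
have e20 : 0 < e ^+ 2 / (b + 1) by rewrite divr_gt0 ?exprn_gt0 // ltr_wpDl.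
have /cvgrPdist_lt /(_ _ e20) [N _ hN] := cs.
exists N => m n Nm mn.
pose c' j := if (j < m)%N then 0 else c j.
have [sE dE] : s n - s m = \sum_(j < n) sqnormc (c' j) /\
    \sum_(j < n) c j *: g j - \sum_(j < m) c j *: g j = \sum_(j < n) c' j *: g j.
  split.
    rewrite /s (sum_tail (fun j => sqnormc (c j)) mn); apply: eq_bigr => j _.
    by rewrite /c'; case: ifP => //; rewrite sqnormc0.
  rewrite (sum_tail (fun j => c j *: g j) mn); apply: eq_bigr => j _.
  by rewrite /c'; case: ifP => //; rewrite scale0r.
rewrite dE -(@ltr_pXn2r _ 2) ?nnegrE ?rnorm_ge0 // ?ltW //.
rewrite (le_lt_trans (gb _ _)) // -sE.
have := hN m Nm; rewrite /= ger0_norm ?subr_ge0 // ltr_pdivlMr ?ltr_wpDl // => h.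
apply: le_lt_trans h.
have sm0 : 0 <= s n - s m by rewrite subr_ge0; exact: ns.
have := sL n; have := sL m; nra.
Qed.

(** Analysis along [h] followed by synthesis along [g]; exchanging the two sequences produces the
    adjoint. *)
Lemma bessel_operator b b' g h : 0 <= b -> 0 <= b' ->
  bessel_seq b g -> bessel_seq b' h ->
  exists T S : {linear H -> H},
    [/\ forall x, (\sum_(j < n) dot x (h j) *: g j) @[n --> \oo] --> T x,
        forall x, (\sum_(j < n) dot x (g j) *: h j) @[n --> \oo] --> S x &
        is_adjoint dot T S].
Proof.
have half bg bh (k1 k2 : nat -> H) : 0 <= bg -> 0 <= bh -> bessel_seq bg k1 ->
    bessel_seq bh k2 -> exists T : {linear H -> H},
    forall x, (\sum_(j < n) dot x (k2 j) *: k1 j) @[n --> \oo] --> T x.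
  move=> bg0 bh0 k1b k2b.
  have ex x : exists l : H, (\sum_(j < n) dot x (k2 j) *: k1 j) @[n --> \oo] --> l.
    have dual n := bessel_dual x n bh0 k2b.
    exact: (@bessel_series_cvg _ _ (fun j => dot x (k2 j)) _ bg0 k1b dual).
  have [f hf] := choice ex.
  have lf : linear f.
    pose F n x := \sum_(j < n) dot x (k2 j) *: k1 j.
    apply: (@limit_linear F f _ hf) => n a x y; rewrite /F scaler_sumr -big_split.
    by apply: eq_bigr => j _; rewrite dotDl dotZl scalerDl scalerA.
  by have [T TE] := linear_of_subproof lf; exists T => x; rewrite TE.
move=> b0 b'0 gb hb.
have [T hT] := half _ _ _ _ b0 b'0 gb hb; have [S hS] := half _ _ _ _ b'0 b0 hb gb.
exists T, S; split=> // x y; apply: dot_cvg_eq (hT x) (hS y) => n.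
rewrite dot_suml dot_sumr; apply: eq_bigr => j _.
by rewrite dotZl dotZr -dotC mulrC.
Qed.

End BesselSequences.

(** * Spectral measures *)

Section SpectralMeasure.
Variables (R : realType) (H : completeNormedModType R[i]).
Variables (dot : {dot H for (@conjC R[i])}) (dot_norm : induces_norm dot).
Variables (A : {linear H -> H}) (A_pos : positive_contraction dot A).
Variables (E : set R -> {linear H -> H}) (A_E : is_spectral_measure dot A E).
Implicit Types (x y z : H) (v w : set R).

Local Notation Q := (qform dot A).

Lemma A_psd : psd dot A.
Proof. by move=> x; have [_ /(_ x) /andP []] := A_pos. Qed.

Lemma Q_le x : Q x <= rnorm x ^+ 2.
Proof.
have [_ /(_ x) /andP [_]] := A_pos.
by rewrite (psdE _ A_psd) (dot_rnorm dot_norm) lecR.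
Qed.

Lemma A_selfadjoint : is_adjoint dot A A.
Proof. exact: real_form_selfadjoint A_psd. Qed.

Lemma E_selfadjoint w : measurable w -> is_adjoint dot (E w) (E w).
Proof. by move=> /(spectral_proj A_E) []. Qed.

Lemma E_idem w x : measurable w -> E w (E w x) = E w x.
Proof. by move=> /(spectral_proj A_E) [_ h]; exact: h. Qed.

Lemma E_range w x : measurable w -> range (E w) x -> E w x = x.
Proof. by move=> mw [y _ <-]; rewrite E_idem. Qed.

Lemma rnorm_E w x : measurable w -> rnorm (E w x) ^+ 2 = complex.Re (dot (E w x) x).
Proof. by move=> mw; rewrite (rnorm_sqr dot_norm) -E_selfadjoint // E_idem. Qed.

Lemma E0 x : E set0 x = 0.
Proof.
have [mu [muE _ _]] := spectral_integral A_E x.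
have := muE _ measurable0; rewrite measure0 => -[/esym].
rewrite -rnorm_E // => /eqP; rewrite sqrf_eq0 => /eqP; exact: rnorm_eq0.
Qed.

Lemma E_disjoint v w x : measurable v -> measurable w -> v `&` w = set0 ->
  E v (E w x) = 0.
Proof. by move=> mv mw vw; rewrite -(spectral_setI A_E) // vw E0. Qed.

Lemma E_orth v w x y : measurable v -> measurable w -> v `&` w = set0 ->
  dot (E v x) (E w y) = 0.
Proof. by move=> mv mw vw; rewrite E_selfadjoint // E_disjoint // dot0r. Qed.

Lemma E_comm v w x : measurable v -> measurable w -> E v (E w x) = E w (E v x).
Proof. by move=> mv mw; rewrite -!(spectral_setI A_E) // setIC. Qed.

Lemma E_sub v w x : measurable v -> measurable w -> v `<=` w -> E w (E v x) = E v x.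
Proof. by move=> mv mw vw; rewrite -(spectral_setI A_E) // setIidr. Qed.

Lemma E_setU v w x : measurable v -> measurable w -> v `&` w = set0 ->
  E (v `|` w) x = E v x + E w x.
Proof.
move=> mv mw vw.
have mF n : measurable (bigcup2 v w n) by case: n => [|[|n]] /=.
have tF : trivIset setT (bigcup2 v w) by rewrite -trivIset_bigcup2.
have := @spectral_sigma_additive _ _ _ _ _ A_E _ mF tF x; rewrite bigcup2E => h.
apply: (cvg_uniqueH h); apply/cvg_rnormP => e e0; exists 2%N => n n2.
rewrite (_ : \sum_(0 <= k < n) E (bigcup2 v w k) x = E v x + E w x).
  by rewrite subrr rnorm0.
rewrite -(subnKC n2) /index_iota subn0 iotaD big_cat /= !big_cons big_nil addr0 -[RHS]addr0.
congr (_ + _); rewrite big_seq big1 // => i; rewrite mem_iota add0n => /andP [i2 _].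
by case: i i2 => [|[|i]] //= _; rewrite E0.
Qed.

Lemma E_setC w x : measurable w -> E w x + E (~` w) x = x.
Proof.
move=> mw; rewrite -E_setU ?setICr //; last exact: measurableC.
by rewrite setUv (spectral_setT A_E).
Qed.

Lemma pythagoras x y : dot x y = 0 -> rnorm (x + y) ^+ 2 = rnorm x ^+ 2 + rnorm y ^+ 2.
Proof.
move=> xy; rewrite !(rnorm_sqr dot_norm) dotDl !dotDr !ReD xy (dotC y x) xy.
by rewrite conjc0 /= add0r addr0.
Qed.

Lemma rnorm_E_setC w x : measurable w ->
  rnorm x ^+ 2 = rnorm (E w x) ^+ 2 + rnorm (E (~` w) x) ^+ 2.
Proof.
move=> mw; rewrite -pythagoras ?E_setC // E_orth ?setICr //; exact: measurableC.
Qed.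

Lemma rnorm_E_le w x : measurable w -> rnorm (E w x) <= rnorm x.
Proof.
move=> mw; rewrite -(@ler_pXn2r _ 2) ?nnegrE ?rnorm_ge0 //.
by rewrite (rnorm_E_setC x mw) lerDl sqr_ge0.
Qed.

Lemma E_bounded w : measurable w -> bounded_by 1 (E w).
Proof. by move=> mw x; rewrite mul1r rnorm_E_le. Qed.

(* The spectral measures of [x' + y'] and [x' - y'] coincide for [x'] and [y']
   in complementary spectral subspaces, hence so do the values of the form. *)
Lemma A_E_orth w x y : measurable w -> dot (A (E w x)) (E (~` w) y) = 0.
Proof.
move=> mw; have mcw : measurable (~` w) by exact: measurableC.
have key x' y' : E w x' = x' -> E (~` w) y' = y' -> complex.Re (dot (A x') y') = 0.
  move=> x'E y'E.
  have orth v : measurable v -> dot (E v x') y' = 0.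
    by move=> mv; rewrite -x'E E_comm // -y'E E_orth // setICr.
  have Ep v : measurable v -> complex.Re (dot (E v (x' + y')) (x' + y')) =
                              complex.Re (dot (E v (x' - y')) (x' - y')).
    move=> mv; rewrite !(linearD (E v)) (linearN (E v)) !dotDl !dotDr !dotNl !dotNr !ReD !ReN.
    have -> : dot (E v y') x' = 0 by rewrite E_selfadjoint // dotC orth // conjc0.
    rewrite orth //=; ring.
  have [mu [muE imu mui]] := spectral_integral A_E (x' + y').
  have [nu [nuE inu nui]] := spectral_integral A_E (x' - y').
  have : Q (x' + y') = Q (x' - y').
    rewrite /qform mui nui /=; congr fine; apply: eq_measure_integral => v mv _.
    by rewrite muE // nuE // Ep.
  by rewrite (qformD A_psd) (qformB A_psd); lra.
set x' := E w x; set y' := E (~` w) y.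
have x'E : E w x' = x' by rewrite E_idem.
have y'E : E (~` w) y' = y' by rewrite E_idem.
have h1 := key _ _ x'E y'E.
(* Multiplying [y'] by i turns the vanishing of real parts into the vanishing of the imaginary
   part. *)
have := key x' ('i%C *: y') x'E _; rewrite (linearZ_LR (E (~` w))) /= y'E => /(_ erefl).
rewrite dotZr; move: h1; case: (dot (A x') y') => a b /= -> h2.
by apply/eqP; rewrite eq_complex /= eqxx /=; apply/eqP; lra.
Qed.

(** By [A_E_orth], [A] maps the range of [E w] into itself, and a selfadjoint operator preserving
    the range of an orthogonal projection commutes with it. *)
Lemma A_E_comm w x : measurable w -> A (E w x) = E w (A x).
Proof.
move=> mw; have stable z : E w (A (E w z)) = A (E w z).
  rewrite -[RHS](E_setC _ mw) -[LHS]addr0; congr (_ + _); apply/esym/dot_eq0.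
    exact: dot_norm.
  by rewrite E_selfadjoint ?A_E_orth ?E_idem //; exact: measurableC.
apply: (dot_ext dot_norm) => y.
rewrite -[in LHS]stable E_selfadjoint // A_selfadjoint E_selfadjoint // stable.
by rewrite [RHS]E_selfadjoint // A_selfadjoint.
Qed.

Lemma measure_cst_integrable (mu : {measure set R -> \bar R}) (D : set R) (a : R) :
  measurable D -> (mu D < +oo)%E -> mu.-integrable D (EFin \o cst a).
Proof.
move=> mD fD; apply/integrableP; split; first exact/measurable_realfun.measurable_EFinP.
rewrite (_ : (fun t => _) = cst `|a|%:E) // integral_cst //.
by rewrite lte_mul_pinfty // lee_fin.
Qed.

(** The scalar measure of a vector in the range of [E w] vanishes off [w]. Comparing the integrand
    with constants on [w] then bounds the form, as [Q_ge] and [Q_le_ub] do. *)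
Lemma spectral_mu_restrict w x : measurable w -> E w x = x ->
  exists mu : {measure set R -> \bar R},
   [/\ mu w = (rnorm x ^+ 2)%:E, mu.-integrable w (EFin : R -> \bar R) &
       Q x = (\int[mu]_(t in w) t)%R].
Proof.
move=> mw wx; have [mu [muE imu mui]] := spectral_integral A_E x.
exists mu; split; first by rewrite muE // -rnorm_E // wx.
  exact: (integrableS _ _ _ imu).
rewrite /qform mui /= /Rintegral (@negligible_integral _ _ _ mu setT (~` w)) //.
- by rewrite setTD setCK.
- exact: measurableC.
rewrite muE; last exact: measurableC.
rewrite -rnorm_E; last exact: measurableC.
by rewrite -wx E_disjoint ?setICl ?rnorm0 ?expr0n //; exact: measurableC.
Qed.

Lemma Q_ge w x (a : R) : measurable w -> E w x = x -> (forall t, w t -> a <= t) ->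
  a * rnorm x ^+ 2 <= Q x.
Proof.
move=> mw wx wa; have [mu [muw imu ->]] := spectral_mu_restrict mw wx.
have -> : a * rnorm x ^+ 2 = \int[mu]_(t in w) a by rewrite Rintegral_cst // muw.
by apply: le_Rintegral => //; apply: measure_cst_integrable => //; rewrite muw ltry.
Qed.

Lemma Q_le_ub w x (b : R) : measurable w -> E w x = x -> (forall t, w t -> t <= b) ->
  Q x <= b * rnorm x ^+ 2.
Proof.
move=> mw wx wb; have [mu [muw imu ->]] := spectral_mu_restrict mw wx.
have -> : b * rnorm x ^+ 2 = \int[mu]_(t in w) b by rewrite Rintegral_cst // muw.
by apply: le_Rintegral => //; apply: measure_cst_integrable => //; rewrite muw ltry.
Qed.

Lemma E_bigcup_null w (F : nat -> set R) x : measurable w ->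
  (forall n, measurable (F n)) -> w `<=` \bigcup_n F n ->
  (forall n, E (F n) x = 0) -> E w x = 0.
Proof.
move=> mw mF wF F0; have [mu [muE _ _]] := spectral_integral A_E x.
have := measure_sigma_subadditive mu mF mw wF.
rewrite eseries0; last first.
  by move=> n _ _; rewrite muE // -rnorm_E // F0 rnorm0 expr0n.
rewrite muE // lee_fin -rnorm_E // => h.
by apply/rnorm_eq0/eqP; rewrite -sqrf_eq0 eq_le h sqr_ge0.
Qed.

End SpectralMeasure.

(** * Spectral blocks *)

Section Levels.
Variable R : realType.

Definition level (k : nat) : R := k%:R / k.+1%:R.

Lemma levelE k : level k = 1 - k.+1%:R^-1.
Proof. by rewrite /level -[in k%:R](addrK 1 k%:R) natr1 mulrBl divff ?mul1r // pnatr_eq0. Qed.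

Lemma level0 : level 0 = 0.
Proof. by rewrite /level mul0r. Qed.

Lemma level_lt1 k : level k < 1.
Proof. by rewrite levelE gtrBl invr_gt0 ltr0n. Qed.

Lemma level_mono m n : (m <= n)%N -> level m <= level n.
Proof.
by move=> mn; rewrite !levelE lerB // lef_pV2 ?posrE ?ltr0n // ler_nat ltnS.
Qed.

Lemma level_gt0 k : 0 < level k.+1.
Proof. by rewrite /level divr_gt0 // ltr0n. Qed.

Lemma level_ge0 k : 0 <= level k.
Proof. by rewrite -level0 level_mono. Qed.

Lemma level_archi (d : R) : d < 1 -> exists k, d < level k.
Proof.
move=> d1; exists (Num.truncn (1 - d)^-1); rewrite levelE ltrBrDl -ltrBrDr.
rewrite -[ltRHS]invrK ltf_pV2 ?posrE ?ltr0n ?invr_gt0 ?subr_gt0 //.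
by rewrite truncnS_gt.
Qed.

Lemma level_cvg1 : (level n) @[n --> \oo] --> (1 : R).
Proof.
apply/cvgrPdist_lt => e e0; have [|N hN] := @level_archi (1 - e); first by rewrite gtrBl.
exists N => // n /= /level_mono Nn.
rewrite ger0_norm ?subr_ge0 ?ltW ?level_lt1 //; lra.
Qed.

(** Index 0 is reserved for the highest block {1}; from index 1 on, larger indices mean higher
    blocks. *)
Definition block (n : nat) : set R :=
  if n is k.+1 then `]level k, level k.+1]%classic else [set 1].

Lemma measurable_block n : measurable (block n).
Proof. by case: n => [|n] /=; [exact: measurable_set1|exact: measurable_itv]. Qed.

Lemma block_disj m n : m <> n -> block m `&` block n = set0.
Proof.
wlog mn : m n / (m < n)%N => [h|_].
  move=> /eqP; rewrite neq_ltn => /orP [mn|nm].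
    by apply: (h _ _ mn) => mnE; rewrite mnE ltnn in mn.
  by rewrite setIC; apply: (h _ _ nm) => nmE; rewrite nmE ltnn in nm.
case: n mn => // n; case: m => [_|m mn] /=; rewrite -subset0 => t [] /=.
  by move=> ->; rewrite in_itv /= => /andP [_]; rewrite leNgt level_lt1.
rewrite !in_itv /= => /andP [_ tm] /andP [nt _].
have := @level_mono m.+1 n mn; lra.
Qed.

Lemma block_bigcup : \bigcup_n block n = `]0, 1]%classic.
Proof.
rewrite predeqE => t; split=> [[[|n] _ /=]|].
- by move=> ->; rewrite in_itv /= ltr01 lexx.
- rewrite !in_itv /= => /andP [nt tn]; rewrite (le_lt_trans (level_ge0 n)) //=.
  by rewrite (le_trans tn) // ltW ?level_lt1.
rewrite /= in_itv /= => /andP [t0]; rewrite le_eqVlt => /predU1P [->|t1].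
  by exists 0%N.
have ex : exists k, t <= level k by have [k /ltW tk] := level_archi t1; exists k.
case: (ex_minnP ex) => [[|k]] tk kmin; first by rewrite level0 leNgt t0 in tk.
exists k.+1 => //=; rewrite in_itv /= tk andbT ltNge; apply/negP => /kmin.
by rewrite ltnn.
Qed.

End Levels.

Section SpectralBlocks.
Variables (R : realType) (H : completeNormedModType R[i]).
Variables (dot : {dot H for (@conjC R[i])}) (dot_norm : induces_norm dot).
Variables (A : {linear H -> H}) (A_pos : positive_contraction dot A).
Variables (E : set R -> {linear H -> H}) (A_E : is_spectral_measure dot A E).
Implicit Types (x y z : H) (v w : set R).

Local Notation Q := (qform dot A).
Let Apsd := A_psd A_pos.

(** Cauchy-Schwarz for the form at [x] and [A x] reads |Ax|^4 <= Q(x) Q(Ax) <= Q(x) b |Ax|^2. *)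
Lemma rnorm_A_sqr_le x (b : R) : 0 <= b -> Q (A x) <= b * rnorm (A x) ^+ 2 ->
  rnorm (A x) ^+ 2 <= b * Q x.
Proof.
move=> b0 h; have := cauchy_schwarz Apsd x (A x).
rewrite (dot_rnorm dot_norm) sqnormc_real.
set n := rnorm (A x) ^+ 2; have n0 : 0 <= n by exact: sqr_ge0.
move=> cs; have [->|n1] := eqVneq n 0; first by rewrite mulr_ge0 // qform_ge0.
have np : 0 < n by rewrite lt_def n1.
rewrite -(ler_pM2l np) -expr2 (le_trans cs) // mulrC mulrCA mulrA.
by rewrite (mulrC b) ler_wpM2r ?qform_ge0 // mulrC.
Qed.

Lemma rnorm_A_le x : rnorm (A x) <= rnorm x.
Proof.
rewrite -(@ler_pXn2r _ 2) ?nnegrE ?rnorm_ge0 //.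
have := @rnorm_A_sqr_le x 1 ler01; rewrite !mul1r => /(_ (Q_le dot_norm A_pos _)).
by move/le_trans; apply; exact: Q_le.
Qed.

(** Expanding, |Ax - x|^2 = |Ax|^2 - 2 Q(x) + |x|^2 <= 2 (|x|^2 - Q(x)) <= 0. *)
Lemma Q_fixed x : rnorm x ^+ 2 <= Q x -> A x = x.
Proof.
move=> h; apply/eqP; rewrite -subr_eq0; apply/eqP/rnorm_eq0/eqP.
rewrite -sqrf_eq0 eq_le sqr_ge0 andbT.
rewrite (rnorm_sqr dot_norm) dotBl !dotBr !ReD !ReN ReD ReN -!(rnorm_sqr dot_norm).
rewrite [dot x (A x)]dotC Re_conjc -/(qform dot A x).
have : rnorm (A x) ^+ 2 <= rnorm x ^+ 2.
  by rewrite ler_sqr ?nnegrE ?rnorm_ge0 // rnorm_A_le.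
lra.
Qed.

(** The form never exceeds |y|^2, yet it is at least 1 + 1/(n + 1) times |y|^2 on the range of E([1
    + 1/(n + 1), oo[); so these ranges are zero, and they exhaust ]1, oo[. *)
Lemma E_itv_gt1 x : E `]1, +oo[%classic x = 0.
Proof.
pose F n := `[1 + n.+1%:R^-1, +oo[%classic : set R.
apply: (E_bigcup_null dot_norm A_E (F := F)) => //; first by move=> n; exact: measurable_itv.
  move=> t /=; rewrite in_itv /= andbT => t1.
  exists (Num.truncn (t - 1)^-1) => //; rewrite /F /= in_itv /= andbT -lerBrDl.
  rewrite -[leRHS]invrK lef_pV2 ?posrE ?ltr0n ?invr_gt0 ?subr_gt0 //.
  by rewrite ltW // truncnS_gt.
move=> n; set y := E (F n) x; have mF : measurable (F n) by exact: measurable_itv.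
have yE : E (F n) y = y by rewrite /y (E_idem A_E).
have := Q_ge dot_norm A_E (a := 1 + n.+1%:R^-1) mF yE.
have tF t : F n t -> 1 + n.+1%:R^-1 <= t by rewrite /F /= in_itv /= andbT.
move=> /(_ tF) h; have := Q_le dot_norm A_pos y.
have n0 : 0 < n.+1%:R^-1 :> R by rewrite invr_gt0 ltr0n.
move=> h2; have h3 : n.+1%:R^-1 * rnorm y ^+ 2 <= 0.
  by rewrite -(lerD2l (rnorm y ^+ 2)) addr0 -{1}[rnorm y ^+ 2]mul1r -mulrDl (le_trans h).
apply/rnorm_eq0/eqP; rewrite -sqrf_eq0 eq_le sqr_ge0 andbT.
by rewrite -(ler_pM2l n0) mulr0.
Qed.

Lemma E_itv_le0_ker x : A (E `]-oo, 0]%classic x) = 0.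
Proof.
apply: (qform_null_ker dot_norm Apsd); apply/eqP; rewrite eq_le qform_ge0 // andbT.
have := @Q_le_ub _ _ _ dot_norm _ _ A_E `]-oo, 0]%classic (E `]-oo, 0]%classic x) 0.
rewrite mul0r; apply => [//||t]; first by rewrite (E_idem A_E).
by rewrite /= in_itv.
Qed.

Lemma ker_E_itv x w : measurable w -> w `<=` `]0, +oo[%classic -> A x = 0 -> E w x = 0.
Proof.
move=> mw w0 Ax; pose F n := `[n.+1%:R^-1, +oo[%classic : set R.
apply: (E_bigcup_null dot_norm A_E (F := F)) => //; first by move=> n; exact: measurable_itv.
  move=> t /w0 /=; rewrite in_itv /= andbT => t0.
  exists (Num.truncn t^-1) => //; rewrite /F /= in_itv /= andbT.
  rewrite -[leRHS]invrK lef_pV2 ?posrE ?ltr0n ?invr_gt0 //.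
  by rewrite ltW // truncnS_gt.
move=> n; set y := E (F n) x; have mF : measurable (F n) by exact: measurable_itv.
have yE : E (F n) y = y by rewrite /y (E_idem A_E).
have Ay : A y = 0 by rewrite /y (A_E_comm dot_norm A_pos A_E) // Ax linear0.
have := Q_ge dot_norm A_E (a := n.+1%:R^-1) mF yE.
have tF t : F n t -> n.+1%:R^-1 <= t by rewrite /F /= in_itv /= andbT.
move=> /(_ tF); rewrite /qform Ay dot0l /=.
have n0 : 0 < n.+1%:R^-1 :> R by rewrite invr_gt0 ltr0n.
rewrite -(mulr0 n.+1%:R^-1) ler_pM2l // => h.
by apply/rnorm_eq0/eqP; rewrite -sqrf_eq0 eq_le sqr_ge0 h.
Qed.

Lemma E_blocks_cvg x :
  (E `]-oo, 0]%classic x + \sum_(k < n) E (block k) x) @[n --> \oo] --> x.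
Proof.
(* The complement of ]0, 1] takes index 0, which makes [F] a partition of the line; the part of that
   complement above 1 is spectrally null and drops out at the end. *)
pose F n : set R := if n is k.+1 then block k else ~` `]0, 1]%classic.
have mF n : measurable (F n).
  case: n => [|n]; last exact: (@measurable_block R).
  by apply: measurableC; exact: measurable_itv.
have tF : trivIset setT F.
  have h0 n : F 0%N `&` block n = set0.
    by rewrite /F -block_bigcup -subset0 => t [nt bt]; apply: nt; exists n.
  apply/trivIsetP => -[|i] [|j] _ _ // ij; rewrite ?h0 //.
    by rewrite setIC h0.
  by apply: block_disj => ijE; rewrite ijE eqxx in ij.
have FT : \bigcup_n F n = setT.
  rewrite -subTset => t _; have [|nt] := pselect (`]0, 1]%classic t); last by exists 0%N.
  by rewrite -block_bigcup => -[n _ nt]; exists n.+1.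
have := @spectral_sigma_additive _ _ _ _ _ A_E _ mF tF x.
rewrite FT (spectral_setT A_E) => /cvg_rnormP h; apply/cvg_rnormP => e /h [N hN].
exists N => n Nn; have := hN n.+1 (leqW Nn).
rewrite big_nat_recl // big_mkord /=; congr (rnorm (_ + _ - _) < e).
have -> : ~` `]0, 1]%classic = `]-oo, 0]%classic `|` `]1, +oo[%classic :> set R.
  by rewrite setCitv.
rewrite (E_setU dot_norm A_E) //; first by rewrite E_itv_gt1 addr0.
by rewrite -subset0 => t []; rewrite /= !in_itv /= andbT; lra.
Qed.

Lemma E_blocks_eq0 x : E `]-oo, 0]%classic x = 0 -> (forall k, E (block k) x = 0) -> x = 0.
Proof.
move=> x0 xk; apply/rnorm_eq0/eqP; rewrite eq_le rnorm_ge0 andbT leNgt.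
apply/negP => xp; have /cvg_rnormP /(_ _ xp) [N /(_ N (leqnn N))] := @E_blocks_cvg x.
by rewrite x0 big1 ?addr0 ?sub0r ?rnormN ?ltxx // => i _; exact: xk.
Qed.

Lemma E_block0_fixed x : A (E [set 1] x) = E [set 1] x.
Proof.
apply: Q_fixed; rewrite -[leLHS]mul1r.
apply: (Q_ge dot_norm A_E (w := [set 1])) => // [|t -> //].
by rewrite (E_idem A_E).
Qed.

(** A fixed vector has no component [y] in a block that ends at [level k.+1 < 1]: there |y|^2 = <Ay,
    y> would be at most [level k.+1] times |y|^2. Its component in ]-oo, 0] vanishes because [A] is
    zero there. *)
Lemma fixed_E_block0 x : A x = x -> E [set 1] x = x.
Proof.
move=> Ax; apply/eqP; rewrite -subr_eq0; apply/eqP/E_blocks_eq0 => [|k].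
  rewrite linearB /= (E_disjoint dot_norm A_E) //; last first.
    by rewrite -subset0 => t [/=]; rewrite in_itv /= => t0 t1; move: t0; rewrite t1 ler10.
  by rewrite -Ax -(A_E_comm dot_norm A_pos A_E) // E_itv_le0_ker subr0.
have mb := @measurable_block R k.
case: k mb => [|k] mb; first by rewrite linearB /= (E_idem A_E) // subrr.
have h0 := E_disjoint dot_norm A_E x mb (@measurable_block R 0) (@block_disj R k.+1 0%N _).
rewrite linearB h0 // sub0r; apply/eqP; rewrite oppr_eq0; apply/eqP; set y := E _ x.
have Ay : A y = y by rewrite /y (A_E_comm dot_norm A_pos A_E) // Ax.
have := @Q_le_ub _ _ _ dot_norm _ _ A_E _ y (level R k.+1) mb.
have tb t : block k.+1 t -> t <= level R k.+1 by rewrite /= in_itv /= => /andP [].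
move=> /(_ _ tb); rewrite (E_idem A_E) // => /(_ erefl).
rewrite /qform Ay -(rnorm_sqr dot_norm) => h.
apply/rnorm_eq0/eqP; rewrite -sqrf_eq0 eq_le sqr_ge0 andbT.
have l1 : 0 < 1 - level R k.+1 by rewrite subr_gt0 level_lt1.
by rewrite -(ler_pM2l l1) mulr0 mulrBl mul1r subr_le0.
Qed.

End SpectralBlocks.

(** * Finite dimension and orthonormal bases *)

(** Strict monotonicity makes the selection injective; [j < s j] serves to show that the adjoint of
    the shift is nilpotent on each basis vector. *)
Lemma increasing_selection (P : nat -> nat -> Prop) :
  (forall j N, exists m, (N <= m)%N /\ P j m) ->
  exists s : nat -> nat,
    [/\ forall j, P j (s j), forall j, (j < s j)%N &
        forall i j, (i < j)%N -> (s i < s j)%N].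
Proof.
move=> h; have /choice [F hF] (p : nat * nat) : exists m, (p.2 <= m)%N /\ P p.1 m.
  exact: h.
pose fix s j := if j is i.+1 then F (j, maxn (s i).+1 j.+1) else F (0%N, 1%N).
exists s; split.
- by case=> [|j]; [have [] := hF (0, 1)%N|have [] := hF (j.+1, maxn (s j).+1 j.+2)].
- case=> [|j]; first by have [] := hF (0, 1)%N.
  by have [/= + _] := hF (j.+1, maxn (s j).+1 j.+2); rewrite geq_max => /andP [].
have mono j : (s j < s j.+1)%N.
  by have [/= + _] := hF (j.+1, maxn (s j).+1 j.+2); rewrite geq_max => /andP [].
move=> i; elim=> // j IH; rewrite ltnS leq_eqVlt => /predU1P [->//|/IH].
by move=> /ltn_trans; apply.
Qed.

Section FiniteDimension.
Variables (R : realType) (H : completeNormedModType R[i]).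
Variables (dot : {dot H for (@conjC R[i])}) (dot_norm : induces_norm dot).
Implicit Types (x y z : H) (M : set H) (g f : nat -> H).

Let idpsd := psd_id dot_norm.
Local Notation id_linear := (idfun : {linear H -> H}).

Definition orthonormal_upto (m : nat) g := forall i j : nat, (i < m)%N -> (j < m)%N ->
  dot (g i) (g j) = (i == j)%:R.

Lemma orthonormal_coef m g (c : nat -> R[i]) i : orthonormal_upto m g -> (i < m)%N ->
  dot (\sum_(j < m) c j *: g j) (g i) = c i.
Proof.
move=> og im; rewrite dot_suml (bigD1 (Ordinal im)) //= big1 ?addr0.
  by rewrite dotZl og // eqxx mulr1.
move=> j ji; rewrite dotZl og ?ltn_ord // -val_eqE in ji *.
by rewrite (negbTE ji) mulr0.
Qed.

(** The matrix of the coefficients has independent rows, since a vanishing combination of its rows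
    gives a vanishing combination of the orthonormal vectors; its rank [m] is thus at most [n]. *)
Lemma orthonormal_le_dim n (e : 'I_n -> H) m g : orthonormal_upto m g ->
  (forall i, (i < m)%N -> exists c : 'I_n -> R[i], g i = \sum_(j < n) c j *: e j) ->
  (m <= n)%N.
Proof.
move=> og span.
have /choice [c hc] (i : 'I_m) : exists c : 'I_n -> R[i], g i = \sum_(j < n) c j *: e j.
  exact: span.
pose C : 'M[R[i]]_(m, n) := \matrix_(i, j) c i j.
suff /eqP rC : row_free C by rewrite -rC rank_leq_col.
apply: inj_row_free => v vC; apply/rowP => i; rewrite mxE.
pose w (k : nat) := if insub k is Some k' then v ord0 k' else 0.
have wE (k : 'I_m) : w k = v ord0 k by rewrite /w valK.
rewrite -wE -(orthonormal_coef w og (ltn_ord i)).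
suff -> : \sum_(j < m) w j *: g j = 0 by rewrite dot0l.
under eq_bigr => k _ do rewrite wE hc scaler_sumr.
rewrite exchange_big big1 // => j _.
under eq_bigr => k _ do rewrite scalerA.
rewrite -scaler_suml; have := congr1 (fun M : 'rV_n => M ord0 j) vC.
rewrite !mxE => vj; rewrite (_ : \sum_(i < m) _ = 0) ?scale0r // -[RHS]vj.
by apply: eq_bigr => k _; rewrite mxE.
Qed.

Lemma finite_dim_bound M : finite_dim M ->
  exists n, forall m g, orthonormal_upto m g -> (forall i, (i < m)%N -> M (g i)) -> (m <= n)%N.
Proof.
move=> [n [e he]]; exists n => m g og gM.
by apply: (orthonormal_le_dim (e := e) og) => i im; apply: he; exact: gM.
Qed.

Lemma finite_dimS M M' : M `<=` M' -> finite_dim M' -> finite_dim M.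
Proof. by move=> MM' [n [e he]]; exists n, e => x /MM'; exact: he. Qed.

Lemma finite_dim_span M n g :
  (forall x, M x -> exists c : nat -> R[i], x = \sum_(j < n) c j *: g j) -> finite_dim M.
Proof.
move=> h; exists n, (fun j : 'I_n => g j) => x /h [c ->].
by exists (fun j : 'I_n => c j).
Qed.

Lemma orthonormal_upto_extend m g x : orthonormal_upto m g -> dot x x = 1 ->
  (forall i, (i < m)%N -> dot x (g i) = 0) ->
  orthonormal_upto m.+1 (fun i => if (i < m)%N then g i else x).
Proof.
move=> og x1 xg i j im jm.
have [im'|im'] := ltnP i m; have [jm'|jm'] := ltnP j m.
- exact: og.
- by rewrite dotC xg // conjc0 (ltn_eqF (leq_trans im' jm')).
- by rewrite xg // eq_sym (ltn_eqF (leq_trans jm' im')).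
have iE : i = m by apply/eqP; rewrite eqn_leq im' andbT -ltnS.
have jE : j = m by apply/eqP; rewrite eqn_leq jm' andbT -ltnS.
by rewrite x1 iE jE eqxx.
Qed.

Definition unit_of x : H := normalized dot idfun x.

Lemma unit_of_dot x : x != 0 -> dot (unit_of x) (unit_of x) = 1.
Proof.
move=> x0; have [|] := qform_normalized (B := id_linear) idpsd x.
  rewrite /normalized; case: eqP => [|_] /eqP.
    by move=> + _; rewrite /qform /= -(rnorm_sqr dot_norm) sqrf_eq0 => /eqP/rnorm_eq0 x00;
       rewrite x00 eqxx in x0.
  move=> /eqP xE; move/eqP: xE; rewrite scaler_eq0 (negbTE x0) orbF => /eqP sx.
  exfalso; have /rnorm_eq0 x00 : rnorm x = 0; last by rewrite x00 eqxx in x0.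
  move: sx => -[/eqP]; rewrite invr_eq0 /qform /= -(rnorm_sqr dot_norm).
  by rewrite sqrtr_sqr normr_eq0 => /eqP.
by rewrite /qform /= (dot_rnorm dot_norm) /unit_of => /= ->.
Qed.

Lemma unit_of_scaled x : exists c : R[i], unit_of x = c *: x.
Proof.
rewrite /unit_of /normalized; case: eqP => _; last by eexists.
by exists 0; rewrite scale0r.
Qed.

Hypothesis H_separable : separable_space H.

Lemma dense_sequence : exists d : nat -> H,
  forall x (e : R), 0 < e -> exists n, rnorm (x - d n) < e.
Proof.
have [D /countable_injP [f finj] Dd] := H_separable.
(* [f] injects the countable dense set into the naturals; [d n] is the point numbered [n], and 0 if
   there is none. *)
pose P n x := D x /\ f x = n.
pose d n := xget 0 (P n).
exists d => x e e0.
have e0' : 0 < e%:C by rewrite ltcR.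
have [||y [/interior_subset By Dy]] := Dd (ball x e%:C)^°.
- by exists x; exact: nbhsx_ballx.
- exact: open_interior.
exists (f y); have -> : d (f y) = y.
  rewrite /d; case: xgetP => [z _ [Dz fz]|/(_ y)]; last by case.
  by apply: finj; rewrite ?inE.
by move: By; rewrite -ball_normE /ball_ /= normE ltcR.
Qed.

(** Gram-Schmidt, for the inner product itself, on the projections of a dense sequence. A vector of
    the range orthogonal to all of [f] is orthogonal to the dense sequence. *)
Lemma projection_onb (P : {linear H -> H}) : orthogonal_projection dot P ->
  exists f, [/\ form_orthonormal dot id_linear f, forall n, P (f n) = f n &
    forall x, P x = x -> (forall n, dot x (f n) = 0) -> x = 0].
Proof.
move=> [Padj Pid]; have [d hd] := dense_sequence.
pose u n := P (d n); pose f := gs dot id_linear u.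
have of_ : form_orthonormal dot id_linear f by exact: gs_orthonormal.
exists f; split=> // [n|x Px xf].
  have [m] := ubnP n; elim: m n => // m IH n nm.
  have [c fc] := gs_scaled dot id_linear u n.
  rewrite /f fc linearZ; congr (_ *: _).
  rewrite /residual linearB linear_sum /u Pid; congr (_ - _).
  apply: eq_bigr => i _; rewrite linearZ; congr (_ *: _); apply: IH.
  exact: leq_trans (ltn_ord i) nm.
have xd n : dot x (d n) = 0.
  rewrite -Px Padj -/(u n).
  have := gs_null idpsd u (ltnSn n).
  rewrite /qform -(rnorm_sqr dot_norm) => /eqP; rewrite sqrf_eq0 => /eqP/rnorm_eq0/eqP.
  rewrite subr_eq0 => /eqP ->; rewrite dot_sumr big1 // => i _.
  by rewrite dotZr xf mulr0.
(* By orthogonality |x - d n| >= |x| for every [n], which contradicts density unless [x] is 0. *)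
apply/rnorm_eq0/eqP; rewrite eq_le rnorm_ge0 andbT leNgt; apply/negP => xp.
have [n] := hd x _ xp; rewrite ltNge => /negP; apply.
rewrite -(@ler_pXn2r _ 2) ?nnegrE ?rnorm_ge0 // [leRHS](rnorm_sqr dot_norm).
rewrite dotBl !dotBr xd (dotC (d n)) xd conjc0 subr0 sub0r opprK ReD.
by rewrite -!(rnorm_sqr dot_norm) lerDl sqr_ge0.
Qed.

Lemma residual_span f n x : form_orthonormal dot id_linear f ->
  (forall m, (n <= m)%N -> f m = 0) ->
  forall m, dot (residual dot id_linear f x n) (f m) = 0.
Proof.
move=> of_ fn m; have [nm|mn] := leqP n m; first by rewrite fn // dot0r.
exact: (residual_coef_lt idpsd x of_ mn).
Qed.

Lemma onb_unbounded (P : {linear H -> H}) f : orthogonal_projection dot P ->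
  form_orthonormal dot id_linear f -> (forall n, P (f n) = f n) ->
  (forall x, P x = x -> (forall n, dot x (f n) = 0) -> x = 0) ->
  ~ finite_dim (range P) -> forall N, exists n, (N <= n)%N /\ f n != 0.
Proof.
move=> [Padj Pid] of_ Pf ftot; apply: contra_notP => /existsNP [N hN].
have fN m : (N <= m)%N -> f m = 0.
  by move=> Nm; apply/eqP/negP => fm; apply: hN; exists m; split => //; apply/negP.
apply: (@finite_dim_span _ N f) => x [y _ <-].
exists (fun j => dot (P y) (f j)); apply/eqP; rewrite -subr_eq0; apply/eqP.
apply: ftot; last exact: residual_span of_ fN.
rewrite (linearB P) (linear_sum P); congr (_ - _); first exact: Pid.
by apply: eq_bigr => j _; rewrite (linearZ_LR P) Pf.
Qed.

Lemma form_orthonormal_onb (P : {linear H -> H}) f : orthogonal_projection dot P ->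
  form_orthonormal dot id_linear f -> (forall n, P (f n) = f n) ->
  (forall x, P x = x -> (forall n, dot x (f n) = 0) -> x = 0) ->
  orthonormal_basis dot (range P) [set f n | n in [set n | f n != 0]].
Proof.
move=> [Padj Pid] [f0 f1] Pf ftot; split.
- by move=> _ [n _ <-]; exists (f n).
- move=> _ [n /= fn <-]; case: (f1 n) => [fE|fE]; first by rewrite fE eqxx in fn.
  by rewrite (psdE (B := id_linear) _ idpsd) fE.
- move=> _ _ [n _ <-] [m _ <-] nm; apply: f0 => nmE; apply: nm; by rewrite nmE.
move=> x [y _ <-] h; apply: ftot => [|n]; first exact: Pid.
have [->|fn] := eqVneq (f n) 0; first by rewrite dot0r.
by apply: h; exists n.
Qed.

Lemma projection_hdim_nat (P : {linear H -> H}) : orthogonal_projection dot P ->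
  ~ finite_dim (range P) -> hdim_is dot (range P) [set: nat].
Proof.
move=> Pp Pinf; have [f [of_ Pf ftot]] := projection_onb Pp.
exists [set f n | n in [set n | f n != 0]]; first exact: form_orthonormal_onb.
apply: eq_card_nat.
  by apply: sub_countable (card_image_le _ _) _; exact: countableP.
have unb := onb_unbounded Pp of_ Pf ftot Pinf.
have finj m n : f m != 0 -> f m = f n -> m = n.
  move=> fm fmn; apply/eqP/negP => /negP mn.
  have [f0 f1] := of_; have := f0 m n (elimN eqP mn); rewrite /= -fmn.
  case: (f1 m) => [fE|fE]; first by rewrite fE eqxx in fm.
  rewrite (psdE (B := id_linear) _ idpsd) fE => /eqP.
  by rewrite oner_eq0.
have [|s [hs _ smono]] := @increasing_selection (fun _ n => f n != 0).
  by move=> _ N; exact: unb.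
have inj_fs : {in [set: nat] &, injective (f \o s)}.
  move=> m n _ _ /= /(finj _ _ (hs m)) smn; apply/eqP; rewrite eqn_leq; apply/andP.
  by split; rewrite leqNgt; apply/negP => /smono; rewrite smn ltnn.
apply/infiniteP; have /card_eqPle [_ /card_le_trans] := inj_card_eq inj_fs; apply.
by apply: subset_card_le => _ [n _ <-]; exists (s n) => //; exact: hs.
Qed.

End FiniteDimension.

(** * Weighted shifts on the spectral blocks *)

Section AdaptedBasis.
Variables (R : realType) (H : completeNormedModType R[i]).
Variables (dot : {dot H for (@conjC R[i])}) (dot_norm : induces_norm dot).
Hypothesis H_separable : separable_space H.
Variables (A : {linear H -> H}) (A_pos : positive_contraction dot A).
Variables (E : set R -> {linear H -> H}) (A_E : is_spectral_measure dot A E).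
Implicit Types (x y z : H) (v w : set R) (c : nat -> R[i]).

Local Notation Q := (qform dot A).
Let Apsd := A_psd A_pos.
Let mblock k := @measurable_block R k.

Record adapted_basis (f : nat -> H) (lev : nat -> nat) : Prop := {
  adapted_orthonormal : form_orthonormal dot A f ;
  adapted_block : forall j, E (block (lev j)) (f j) = f j ;
  adapted_parseval : forall x,
    (\sum_(j < n) sqnormc (dot (A x) (f j))) @[n --> \oo] --> Q x }.

Lemma rnorm_sum_E_le y K : rnorm (\sum_(k < K) E (block k) y) <= K%:R * rnorm y.
Proof.
elim: K => [|K IH]; first by rewrite big_ord0 rnorm0 mul0r.
rewrite big_ord_recr /= (le_trans (ler_rnormD _ _)) // -natr1 mulrDl mul1r lerD //.
exact: (rnorm_E_le dot_norm A_E _ (mblock K)).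
Qed.

Lemma adapted_basis_exists : exists f lev, adapted_basis f lev.
Proof.
have [d hd] := dense_sequence H_separable.
(* A natural number encodes a pair of a block and a member of the dense sequence; one that encodes
   no pair is read as (0, 0). *)
pose dec m : nat * nat := odflt (0, 0)%N (choice.unpickle m).
have decK k n : dec (choice.pickle (k, n)) = (k, n) by rewrite /dec choice.pickleK.
pose lev m := (dec m).1; pose u m := E (block (lev m)) (d (dec m).2).
exists (gs dot A u), lev; split; first exact: gs_orthonormal.
  move=> j; have [m] := ubnP j; elim: m j => // m IH j jm.
  have [c fc] := gs_scaled dot A u j.
  have uE : E (block (lev j)) (u j) = u j by rewrite /u (E_idem A_E).
  rewrite fc linearZ; congr (_ *: _).
  rewrite /residual (linearB (E _)) (linear_sum (E _)) uE; congr (_ - _).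
  apply: eq_bigr => i _; rewrite (linearZ_LR (E _)).
  have Ei := IH i (leq_trans (ltn_ord i) jm).
  (* [A] preserves the blocks, so the coefficient between distinct blocks is 0 and Gram-Schmidt
     never mixes them. *)
  have [ij|ij] := eqVneq (lev i) (lev j); first by rewrite -ij Ei.
  rewrite -uE (A_E_comm dot_norm A_pos A_E) // -Ei (E_orth dot_norm A_E) ?scale0r //.
  by apply: block_disj => h; rewrite h eqxx in ij.
move=> x; apply: gs_parseval => // e e0.
pose del := Num.sqrt e / 2.
have del0 : 0 < del by rewrite divr_gt0 ?sqrtr_gt0.
have /cvg_rnormP /(_ _ del0) [K hK] := @E_blocks_cvg _ _ _ dot_norm _ A_pos _ A_E x.
have [|n hn] := hd x (del / K.+1%:R); first by rewrite divr_gt0 ?ltr0n.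
(* The component in ]-oo, 0] is kept as it is, since it is null for the form and does not affect
   residuals; in each of the first [K] blocks [x] is replaced by [d n]. *)
exists (E `]-oo, 0]%classic x + \sum_(k < K) E (block k) (d n)); split.
  apply: (le_trans (Q_le dot_norm A_pos _)).
  rewrite -[leRHS](sqr_sqrtr (ltW e0)) ler_sqr ?nnegrE ?rnorm_ge0 ?sqrtr_ge0 //.
  have -> : Num.sqrt e = del + del by rewrite /del -splitr.
  set P0 := E `]-oo, 0]%classic x.
  have -> : x - (P0 + \sum_(k < K) E (block k) (d n)) =
      (x - (P0 + \sum_(k < K) E (block k) x)) + \sum_(k < K) E (block k) (x - d n).
    rewrite [X in _ = _ + X](eq_bigr
      (fun k : 'I_K => E (block k) x - E (block k) (d n))); last first.
      by move=> k _; rewrite linearB.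
    by rewrite sumrB !opprD !addrA subrK.
  rewrite (le_trans (ler_rnormD _ _)) // lerD //.
    by rewrite rnormB ltW // hK.
  rewrite (le_trans (rnorm_sum_E_le _ _)) //.
  have Kp : 0 < K.+1%:R :> R by rewrite ltr0n.
  have := hn; rewrite ltr_pdivlMr // mulrC => /ltW; apply: le_trans.
  by rewrite ler_wpM2r ?rnorm_ge0 // ler_nat.
have [N hN] : exists N, qform dot A (residual dot A (gs dot A u)
    (\sum_(k < K) E (block k) (d n)) N) = 0.
  apply: (@residual_null_sum _ _ _ _ Apsd u (fun k => E (block k) (d n))) => k _.
  have -> : E (block k) (d n) = u (choice.pickle (k, n)) by rewrite /u /lev decK.
  by exists (choice.pickle (k, n)).+1; apply: gs_null.
exists N; rewrite residualD (qformDnull Apsd) //.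
apply/eqP; rewrite eq_le qform_ge0 // andbT.
rewrite (le_trans (qform_residual_le Apsd _ _ (gs_orthonormal Apsd u))) //.
by rewrite /qform (E_itv_le0_ker dot_norm A_pos A_E) dot0l.
Qed.

(** [block_inf 1] is 0, while [block_sup] never falls below 1/2. This is why the weights below are
    formed with [block_sup] of the source block and not with [block_inf] of the target block. *)
Definition block_inf (n : nat) : R := if n is k.+1 then level R k else 1.
Definition block_sup (n : nat) : R := if n is k.+1 then level R k.+1 else 1.

Lemma block_sup_ge n : 2^-1 <= block_sup n.
Proof.
case: n => [|n] /=; first by rewrite invf_le1 ?ler1n.
rewrite (le_trans _ (@level_mono R 1 n.+1 _)) //.
by rewrite /level mul1r.
Qed.

Lemma block_sup_gt0 n : 0 < block_sup n.
Proof. by rewrite (lt_le_trans _ (block_sup_ge n)). Qed.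

Lemma block_sup_le1 n : block_sup n <= 1.
Proof. by case: n => [|n] //=; rewrite ltW ?level_lt1. Qed.

Lemma block_inf_Q n x : E (block n) x = x -> block_inf n * rnorm x ^+ 2 <= Q x.
Proof.
move=> nx; apply: (Q_ge dot_norm A_E (mblock n) nx).
by case: n {nx} => [|n] t /=; [move=> ->|rewrite in_itv /= => /andP [/ltW]].
Qed.

Lemma block_sup_Q n x : E (block n) x = x -> Q x <= block_sup n * rnorm x ^+ 2.
Proof.
move=> nx; apply: (Q_le_ub dot_norm A_E (mblock n) nx).
by case: n {nx} => [|n] t /=; [move=> ->|rewrite in_itv /= => /andP []].
Qed.

Lemma rnorm_sum_blocks_sqr (y : nat -> H) K : (forall k, E (block k) (y k) = y k) ->
  rnorm (\sum_(k < K) y k) ^+ 2 = \sum_(k < K) rnorm (y k) ^+ 2.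
Proof.
move=> yE; elim: K => [|K IH]; first by rewrite !big_ord0 rnorm0 expr0n.
rewrite !big_ord_recr /= (pythagoras dot_norm) ?IH // dot_suml big1 // => k _.
rewrite -(yE k) -(yE K) (E_orth dot_norm A_E) //.
by apply: block_disj => kK; have := ltn_ord k; rewrite kK ltnn.
Qed.

(** Vectors of distinct blocks are orthogonal in [H], so a weighted Bessel inequality can be checked
    on coefficients supported in one block. *)
Lemma blockwise_bound (v : nat -> H) (l : nat -> nat) (w : nat -> R) c n :
  (forall j, E (block (l j)) (v j) = v j) ->
  (forall k c, (forall j, l j <> k -> c j = 0) ->
    rnorm (\sum_(j < n) c j *: v j) ^+ 2 <= \sum_(j < n) sqnormc (c j) * w j) ->
  rnorm (\sum_(j < n) c j *: v j) ^+ 2 <= \sum_(j < n) sqnormc (c j) * w j.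
Proof.
move=> vE h; pose ck k j := if l j == k then c j else 0.
pose K := (\max_(j < n) l j).+1.
have lK (j : 'I_n) : (l j < K)%N by rewrite ltnS (leq_bigmax j).
have -> : \sum_(j < n) c j *: v j = \sum_(k < K) \sum_(j < n) ck k j *: v j.
  rewrite exchange_big; apply: eq_bigr => j _ /=.
  rewrite (bigD1 (Ordinal (lK j))) //= big1 ?addr0 /ck ?eqxx // => k.
  by rewrite -val_eqE /= eq_sym => /negbTE ->; rewrite scale0r.
rewrite (@rnorm_sum_blocks_sqr (fun k => \sum_(j < n) ck k j *: v j)); last first.
  move=> k; rewrite (linear_sum (E _)); apply: eq_bigr => j _.
  rewrite (linearZ_LR (E _)) /ck; case: eqP => [<-|_]; last by rewrite !scale0r.
  by congr (_ *: _); exact: vE.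
have -> : \sum_(j < n) sqnormc (c j) * w j =
          \sum_(k < K) \sum_(j < n) sqnormc (ck k j) * w j.
  rewrite exchange_big; apply: eq_bigr => j _ /=.
  rewrite (bigD1 (Ordinal (lK j))) //= big1 ?addr0 /ck ?eqxx // => k.
  by rewrite -val_eqE /= eq_sym => /negbTE ->; rewrite sqnormc0 mul0r.
apply: ler_sum => k _; apply: (h k) => j jk; rewrite /ck.
by case: eqP.
Qed.

(** |Q y - Q x| = |Re <A(y - x), y + x>| <= |y - x| (|y - x| + 2 |x|). *)
Lemma Q_cvg (u : nat -> H) x : u n @[n --> \oo] --> x -> Q (u n) @[n --> \oo] --> Q x.
Proof.
move=> /cvg_rnorm0 ux.
have h0 : rnorm (u n - x) * (rnorm (u n - x) + 2 * rnorm x) @[n --> \oo] --> (0 : R).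
  rewrite -[X in _ --> X](mul0r (0 + 2 * rnorm x)).
  by apply: cvgM => //; apply: cvgD => //; exact: cvg_cst.
apply/cvgrPdist_le => e e0; have /cvgrPdist_le /(_ _ e0) [N _ hN] := h0.
exists N => // n /= /hN; rewrite /= sub0r normrN ger0_norm; last first.
  by rewrite mulr_ge0 ?addr_ge0 ?mulr_ge0 ?rnorm_ge0.
apply: le_trans; rewrite distrC.
set y := u n; have -> : Q y - Q x = complex.Re (dot (A (y - x)) (y + x)).
  rewrite (linearB A) dotBl !dotDr !(ReD, ReN) /qform.
  by rewrite (psd_formC Apsd x y) Re_conjc; ring.
rewrite -(@ler_pXn2r _ 2) ?nnegrE ?normr_ge0 //; last first.
  by rewrite mulr_ge0 ?addr_ge0 ?mulr_ge0 ?rnorm_ge0.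
rewrite real_normK ?num_real // (le_trans (sqr_Re_le _)) //.
rewrite (le_trans (dot_cauchy_schwarz dot_norm _ _)) // exprMn.
apply: ler_pM; rewrite ?sqr_ge0 // ler_sqr ?nnegrE ?addr_ge0 ?mulr_ge0 ?rnorm_ge0 //.
  exact: (rnorm_A_le dot_norm A_pos).
have -> : y + x = (y - x) + (x + x) by rewrite addrA subrK.
rewrite (le_trans (ler_rnormD _ _)) // lerD2l mulrDl mul1r ler_rnormD //.
Qed.

(** The numerical range of a positive operator controls its norm: Cauchy-Schwarz for the form of [B]
    at [x] and [B x] gives |Bx|^4 <= b^2 |x|^2 |Bx|^2. *)
Lemma psd_bounded (B : {linear H -> H}) (b : R) : psd dot B -> 0 <= b ->
  (forall x, qform dot B x <= b * rnorm x ^+ 2) -> bounded_by b B.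
Proof.
move=> Bpsd b0 hb x.
have := cauchy_schwarz Bpsd x (B x); rewrite (dot_rnorm dot_norm) sqnormc_real => cs.
have [->|Bx] := eqVneq (rnorm (B x)) 0; first by rewrite mulr_ge0 ?rnorm_ge0.
have Bp : 0 < rnorm (B x) by rewrite lt_def Bx rnorm_ge0.
rewrite -(@ler_pXn2r _ 2) ?nnegrE ?mulr_ge0 ?rnorm_ge0 //.
have n2 : 0 < rnorm (B x) ^+ 2 by rewrite exprn_gt0.
rewrite -(ler_pM2r n2) -expr2 (le_trans cs) //.
rewrite (le_trans (ler_pM _ _ (hb _) (hb _))) ?qform_ge0 // exprMn.
by rewrite le_eqVlt; apply/orP; left; apply/eqP; ring.
Qed.

End AdaptedBasis.

(** * The shift attached to an injection of the indices *)

Section WeightedShift.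
Variables (R : realType) (H : completeNormedModType R[i]).
Variables (dot : {dot H for (@conjC R[i])}) (dot_norm : induces_norm dot).
Variables (A : {linear H -> H}) (A_pos : positive_contraction dot A).
Variables (E : set R -> {linear H -> H}) (A_E : is_spectral_measure dot A E).
Variables (f : nat -> H) (lev : nat -> nat) (f_adapted : adapted_basis dot A E f lev).
Variable s : nat -> nat.
Hypothesis s_inj : injective s.
Hypothesis s_up : forall j, f j != 0 ->
  f (s j) != 0 /\ block_sup R (lev j) <= block_inf R (lev (s j)).
Implicit Types (x y z : H) (c : nat -> R[i]).

Local Notation Q := (qform dot A).
Let Apsd := A_psd A_pos.
Let mblock k := @measurable_block R k.
Let f_orth := proj1 (adapted_orthonormal f_adapted).
Let f_block := adapted_block f_adapted.

(** For a vanishing [f j], [s_up] says nothing about [f (s j)]; the default 0 keeps such an index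
    from spoiling the bounds. *)
Let g j : H := if f j == 0 then 0 else f (s j).
Let h j : H := A (f j).

Lemma adapted_Q1 j : f j != 0 -> Q (f j) = 1.
Proof.
by case: ((proj2 (adapted_orthonormal f_adapted)) j) => [->|//]; rewrite eqxx.
Qed.

Lemma shift_block j : E (block (lev (s j))) (g j) = g j.
Proof. by rewrite /g; case: eqP => _; rewrite ?linear0 ?f_block. Qed.

Lemma shift_orth : form_orthogonal dot A g.
Proof.
move=> i j ij; rewrite /g; case: eqP => _; first by rewrite linear0 dot0l.
by case: eqP => _; [rewrite dot0r|apply: f_orth => /s_inj].
Qed.

Lemma shift_Q j : Q (g j) = if f j == 0 then 0 else 1.
Proof.
rewrite /g; case: eqP => [_|/eqP fj]; first exact: (qform0 dot A).
by rewrite adapted_Q1 //; have [] := s_up fj.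
Qed.

Lemma image_block j : E (block (lev j)) (h j) = h j.
Proof. by rewrite /h -(A_E_comm dot_norm A_pos A_E) // f_block. Qed.

(** In block [k] the form is at least [block_inf k] times the squared norm, the [g j] are
    orthonormal or zero for the form, and [s_up] bounds [block_inf k] from below by [block_sup] of
    the source. *)
Lemma shift_weighted c n :
  rnorm (\sum_(j < n) c j *: g j) ^+ 2 <=
  \sum_(j < n) sqnormc (c j) * (block_sup R (lev j))^-1.
Proof.
apply: (blockwise_bound dot_norm A_E (v := g) (l := lev \o s)
  (w := fun j => (block_sup R (lev j))^-1)).
  exact: shift_block.
move=> k {}c ck; set y := \sum_(j < n) _.
have yE : E (block k) y = y.
  rewrite (linear_sum (E _)); apply: eq_bigr => j _; rewrite (linearZ_LR (E _)) /=.
  have [jk|jk] := eqVneq (lev (s j)) k; first by rewrite -jk shift_block.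
  by rewrite ck ?scale0r // => /= jkE; rewrite jkE eqxx in jk.
have S0 : 0 <= \sum_(j < n) sqnormc (c j) * (block_sup R (lev j))^-1.
  rewrite sumr_ge0 // => j _; rewrite mulr_ge0 ?sqnormc_ge0 // invr_ge0.
  by rewrite ltW // block_sup_gt0.
have := block_inf_Q dot_norm A_E yE; rewrite (qform_sum_orth Apsd c n shift_orth).
(* A block whose lower end is 0 receives no nonzero [f j]: [s_up] would place a positive [block_sup]
   below 0. *)
have [k0|k0] := leP (block_inf R k) 0.
  move=> _; suff -> : y = 0 by rewrite rnorm0 expr0n.
  rewrite /y big1 // => j _; have [jk|jk] := eqVneq (lev (s j)) k; last first.
    by rewrite ck ?scale0r // => /= jkE; rewrite jkE eqxx in jk.
  have [gj0|fj] := eqVneq (f j) 0; first by rewrite /g gj0 eqxx scaler0.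
  have [_] := s_up fj; rewrite jk => /le_trans /(_ k0).
  by rewrite leNgt block_sup_gt0.
rewrite mulrC -ler_pdivlMr // => /le_trans; apply; rewrite mulr_suml.
apply: ler_sum => j _; rewrite -mulrA.
have [jk|jk] := eqVneq (lev (s j)) k; last first.
  by rewrite ck ?sqnormc0 ?mul0r // => /= jkE; rewrite jkE eqxx in jk.
rewrite ler_wpM2l ?sqnormc_ge0 // shift_Q; case: eqP => [_|/eqP fj].
  by rewrite mul0r invr_ge0 ltW ?block_sup_gt0.
have [_] := s_up fj; rewrite jk mul1r => le_k.
by rewrite lef_pV2 ?posrE ?block_sup_gt0.
Qed.

(** In block [k], |Az|^2 is at most [block_sup k] times Q(z), and Q(z) is at most the sum of the
    |c_j|^2 because the [f j] are orthonormal or zero for the form. *)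
Lemma image_weighted c n :
  rnorm (\sum_(j < n) c j *: h j) ^+ 2 <= \sum_(j < n) sqnormc (c j) * block_sup R (lev j).
Proof.
apply: (blockwise_bound dot_norm A_E (v := h) (l := lev) (w := fun j => block_sup R (lev j))).
  exact: image_block.
move=> k {}c ck; pose z := \sum_(j < n) c j *: f j.
have -> : \sum_(j < n) c j *: h j = A z.
  by rewrite (linear_sum A); apply: eq_bigr => j _; rewrite (linearZ_LR A).
have zE : E (block k) z = z.
  rewrite (linear_sum (E _)); apply: eq_bigr => j _; rewrite (linearZ_LR (E _)) /=.
  have [jk|jk] := eqVneq (lev j) k; first by rewrite -jk f_block.
  by rewrite ck ?scale0r // => /= jkE; rewrite jkE eqxx in jk.
have AzE : E (block k) (A z) = A z by rewrite -(A_E_comm dot_norm A_pos A_E) // zE.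
have := rnorm_A_sqr_le dot_norm A_pos (ltW (block_sup_gt0 R k))
  (block_sup_Q dot_norm A_E AzE).
move/le_trans; apply; rewrite (qform_sum_orth Apsd c n f_orth) mulr_sumr.
apply: ler_sum => j _; have [jk|jk] := eqVneq (lev j) k; last first.
  by rewrite ck ?sqnormc0 ?mul0r ?mulr0 // => /= jkE; rewrite jkE eqxx in jk.
rewrite mulrC jk ler_wpM2r //; first exact/ltW/block_sup_gt0.
rewrite ler_piMr ?sqnormc_ge0 //.
case: ((proj2 (adapted_orthonormal f_adapted)) j) => [->|->] //.
by rewrite (qform0 dot A) ler01.
Qed.

Lemma shift_bessel : bessel_seq 2 g.
Proof.
move=> n c; rewrite (le_trans (shift_weighted c n)) // mulr_sumr.
apply: ler_sum => j _; rewrite mulrC ler_wpM2r ?sqnormc_ge0 //.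
by rewrite -[leRHS]invrK lef_pV2 ?posrE ?invr_gt0 ?block_sup_gt0 ?block_sup_ge.
Qed.

Lemma image_bessel : bessel_seq 1 h.
Proof.
move=> n c; rewrite (le_trans (image_weighted c n)) // mul1r.
by apply: ler_sum => j _; rewrite ler_piMr ?sqnormc_ge0 ?block_sup_le1.
Qed.

(** This is [bessel_dual] for the vectors [h j] divided by the square root of [block_sup], a Bessel
    sequence of constant 1 by [image_weighted]. *)
Lemma image_dual_weighted x n :
  \sum_(j < n) sqnormc (dot x (h j)) * (block_sup R (lev j))^-1 <= rnorm x ^+ 2.
Proof.
pose r j : R := (Num.sqrt (block_sup R (lev j)))^-1.
have r2 j : r j ^+ 2 = (block_sup R (lev j))^-1.
  by rewrite /r exprVn sqr_sqrtr // ltW ?block_sup_gt0.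
have b1 : bessel_seq 1 (fun j => (r j)%:C *: h j).
  move=> m c; under eq_bigr => j _ do rewrite scalerA.
  rewrite (le_trans (image_weighted (fun j => c j * (r j)%:C) m)) // mul1r.
  apply: ler_sum => j _; rewrite sqnormcM sqnormc_real r2 -mulrA mulVf ?mulr1 //.
  by rewrite gt_eqF ?block_sup_gt0.
have := bessel_dual dot_norm x n ler01 b1; rewrite mul1r; apply: le_trans.
apply: ler_sum => j _; rewrite dotZr sqnormcM conjc_real sqnormc_real r2.
by rewrite mulrC.
Qed.

Lemma image_coefE x j : dot x (h j) = dot (A x) (f j).
Proof. by rewrite /h (A_selfadjoint A_pos). Qed.

Section Operator.
Variables T S : {linear H -> H}.
Hypothesis T_series : forall x, (\sum_(j < n) dot x (h j) *: g j) @[n --> \oo] --> T x.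

(** The same weights bound the synthesis along [g] from above and the analysis along [h] by |x|^2;
    with the plain Bessel constants only a bound larger than 1 would come out. *)
Lemma shift_contraction : bounded_by 1 T.
Proof.
move=> x; rewrite mul1r; apply: (cvg_rnorm_le (T_series (x := x))) => n.
rewrite -(@ler_pXn2r _ 2) ?nnegrE ?rnorm_ge0 //.
rewrite (le_trans (shift_weighted (fun j => dot x (h j)) n)) //.
exact: image_dual_weighted.
Qed.

Lemma shift_Q_invariant x : Q (T x) = Q x.
Proof.
have h1 := Q_cvg dot_norm A_pos (T_series (x := x)).
have h2 := @adapted_parseval _ _ _ _ _ _ _ f_adapted x.
apply: (cvg_unique _ h1); last first.
  rewrite (_ : (fun n => _) = (fun n => \sum_(j < n) sqnormc (dot (A x) (f j)))) //.
  apply/funext => n; rewrite (qform_sum_orth Apsd (fun j => dot x (h j)) n shift_orth).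
  apply: eq_bigr => j _; rewrite shift_Q image_coefE.
  by case: eqP => [->|]; rewrite ?dot0r ?sqnormc0 ?mul0r ?mulr1.
exact: Rhausdorff.
Qed.

Lemma shift_Q_iter n x : Q (iter n T x) = Q x.
Proof. by elim: n => // n IH; rewrite iterS shift_Q_invariant. Qed.

Lemma block_sub n (b : R) : b < 1 -> b <= block_inf R n -> block n `<=` `]b, 1]%classic.
Proof.
case: n => [|n] b1 /= bn t /=; rewrite ?in_itv /=; first by move=> ->; rewrite b1 lexx.
move=> /andP [nt tn]; rewrite (le_lt_trans bn nt) (le_trans tn) //.
by rewrite ltW ?level_lt1.
Qed.

(** A term whose source block ends at or above [level n.+1] lands above that level. A source block
    ending below it ends at [level n] at the latest, where [x] has no component. For [n = 0] no
    block ends below [level 1], so nothing is asked of [x]. *)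
Lemma shift_level n x : (n = 0%N \/ E `]level R n, 1]%classic x = x) ->
  E `]level R n.+1, 1]%classic (T x) = T x.
Proof.
move=> xn; have mI b : measurable (`]b, 1]%classic : set R) by exact: measurable_itv.
apply: (fixed_cvg (E_bounded dot_norm A_E (mI _)) _ (T_series (x := x))) => m.
rewrite (linear_sum (E _)); apply: eq_bigr => j _.
rewrite (linearZ_LR (E _)) /= image_coefE.
have [fj|fj] := eqVneq (f j) 0; first by rewrite fj dot0r !scale0r.
have [_ jup] := s_up fj.
have [lt_jn|le_nj] := ltP (block_sup R (lev j)) (level R n.+1); last first.
  congr (_ *: _); rewrite -shift_block (E_sub A_E) //.
  by apply: block_sub; rewrite ?level_lt1 // (le_trans le_nj).
suff -> : dot (A x) (f j) = 0 by rewrite !scale0r.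
case: xn => [n0|xE].
  exfalso; move: lt_jn; rewrite n0 ltNge => /negP; apply.
  by case: (lev j) => [|k] /=; [rewrite ltW ?level_lt1|exact: level_mono].
rewrite -(f_block j) -xE (A_E_comm dot_norm A_pos A_E) // (E_orth dot_norm A_E) //.
case: (lev j) lt_jn => [|k] /= lt_kn; first by have := level_lt1 R n.+1; rewrite ltNge ltW.
rewrite -subset0 => t [] /=; rewrite !in_itv /= => /andP [nt _] /andP [_ tk].
have kn : (k.+1 <= n)%N.
  rewrite leqNgt; apply/negP => nk; have := level_mono R nk.
  by rewrite leNgt lt_kn.
have := level_mono R kn; rewrite leNgt (lt_le_trans nt) //.
Qed.

Lemma shift_iter_level n x : E `]level R n.+1, 1]%classic (iter n.+1 T x) = iter n.+1 T x.
Proof.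
by elim: n => [|n IH]; rewrite iterS; apply: shift_level; [left|right].
Qed.

Lemma shift_iter_rnorm n x :
  level R n.+1 * rnorm (iter n.+1 T x) ^+ 2 <= Q x <= rnorm (iter n.+1 T x) ^+ 2.
Proof.
rewrite -{1 2}(shift_Q_iter n.+1 x) (Q_le dot_norm A_pos) andbT.
have mI : measurable (`]level R n.+1, 1]%classic : set R) by exact: measurable_itv.
apply: (Q_ge dot_norm A_E mI); first exact: shift_iter_level.
by move=> t /=; rewrite in_itv /= => /andP [/ltW].
Qed.

End Operator.

End WeightedShift.

(** * Asymptotic limits *)

Section Asymptotics.
Variables (R : realType) (H : completeNormedModType R[i]).
Variables (dot : {dot H for (@conjC R[i])}) (dot_norm : induces_norm dot).
Variables (A : {linear H -> H}) (A_pos : positive_contraction dot A).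
Implicit Types (x y z : H) (T S : H -> H).

Local Notation Q := (qform dot A).
Let Apsd := A_psd A_pos.

Lemma iter_bounded T n : bounded_by 1 T -> bounded_by 1 (iter n T).
Proof.
move=> Tb; elim: n => [|n IH] x; first by rewrite mul1r.
by rewrite iterS mul1r; have := Tb (iter n T x); have := IH x; rewrite !mul1r; lra.
Qed.

Lemma defect_linear (T S : {linear H -> H}) n :
  linear (fun x => iter n S (iter n T x) - A x).
Proof.
move=> a x y; rewrite !iter_linear linearP scalerBr opprD !addrA; congr (_ + _).
by rewrite addrAC.
Qed.

Lemma defect_bounded (T S : {linear H -> H}) n : bounded_by 1 T -> is_adjoint dot T S ->
  bounded_by 2 (fun x => iter n S (iter n T x) - A x).
Proof.
move=> Tb TS x; have Sb := adjoint_bounded dot_norm ler01 Tb TS.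
have := ler_rnormD (iter n S (iter n T x)) (- A x); rewrite rnormN.
have := iter_bounded n Sb (iter n T x); have := iter_bounded n Tb x.
have := rnorm_A_le dot_norm A_pos x; rewrite !mul1r; lra.
Qed.

Lemma adjoint_linear (T : {linear H -> H}) S : is_adjoint dot T S -> linear S.
Proof.
move=> TS a x y; apply: (dot_ext dot_norm) => z.
rewrite dotC -TS dotDl dotZl dotDr dotZr !TS rmorphD rmorphM /=.
by rewrite [a^*%C^*%C]conjcK -!dotC.
Qed.

Lemma uniform_asymptotic (T : {linear H -> H}) : bounded_by 1 T ->
  arises_uniformly dot A T -> arises_asymptotically dot A T.
Proof.
move=> Tb [S' TS' h]; have [S SE] := linear_of_subproof (adjoint_linear TS').
have SES : S = S' :> (H -> H) by apply/funext.
exists S' => //; rewrite -SES in TS' h *.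
move=> x; apply/cvg_rnorm0.
have h0 : opnorm (fun x => iter n S (iter n T x) - A x) * rnorm x @[n --> \oo] --> (0 : R).
  by rewrite -[X in _ --> X](mul0r (rnorm x)); apply: cvgM h _; exact: cvg_cst.
apply/cvgrPdist_le => e e0; have /cvgrPdist_le /(_ _ e0) [N _ hN] := h0.
exists N => // n /= /hN; rewrite !sub0r !normrN.
rewrite (ger0_norm (rnorm_ge0 _)); apply: le_trans.
apply: le_trans (ler_norm _).
have [X XE] := linear_of_subproof (defect_linear T S n).
have XE' : X = (fun x => iter n S (iter n T x) - A x) :> (H -> H) by apply/funext.
have := opnorm_bound (T := X); rewrite XE'; apply.
rewrite -XE'; apply: (@bounded_continuous _ _ _ 2); rewrite XE'.
exact: defect_bounded.
Qed.

(** The defect X after n + 1 steps has <Xx, x> = |T^(n+1) x|^2 - Q(x), which lies between 0 and (1 /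
    level - 1) Q(x); [psd_bounded] turns this into a bound on the norm. *)
Lemma uniform_of_levels (T S : {linear H -> H}) : bounded_by 1 T -> is_adjoint dot T S ->
  (forall n x, level R n.+1 * rnorm (iter n.+1 T x) ^+ 2 <= Q x <=
     rnorm (iter n.+1 T x) ^+ 2) ->
  arises_uniformly dot A T.
Proof.
move=> Tb TS hl; exists S => //.
(* [level 0] is 0 and its inverse is 0 by convention, so [b] is a meaningful bound from index 1 on
   only. *)
pose b n : R := (level R n)^-1 - 1.
have bn n : 0 <= b n.+1.
  by rewrite subr_ge0 invf_ge1 ?level_gt0 // ltW ?level_lt1.
have hb n : opnorm (fun x => iter n.+1 S (iter n.+1 T x) - A x) <= b n.+1.
  have [X XE] := linear_of_subproof (defect_linear T S n.+1).
  have XE' : X = (fun x => iter n.+1 S (iter n.+1 T x) - A x) :> (H -> H) by apply/funext.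
  have XQ x : dot (X x) x = (rnorm (iter n.+1 T x) ^+ 2 - Q x)%:C.
    rewrite XE' dotBl (psdE _ Apsd) rmorphB /=; congr (_ - _).
    by rewrite -/(iter n.+1 S) (adjointC (adjoint_iter n.+1 TS)) (dot_rnorm dot_norm).
  have Xpsd : psd dot X.
    by move=> x; rewrite XQ ler0c subr_ge0; case/andP: (hl n x).
  rewrite -XE'; apply: opnorm_le => // x x1.
  have := psd_bounded dot_norm Xpsd (bn n) _ x.
  have Xb y : qform dot X y <= b n.+1 * rnorm y ^+ 2.
    rewrite /qform XQ /= /b; have /andP [h1 h2] := hl n y.
    have l0 := level_gt0 R n; have Qy := Q_le dot_norm A_pos y.
    have : rnorm (iter n.+1 T y) ^+ 2 <= (level R n.+1)^-1 * Q y.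
      by rewrite mulrC ler_pdivlMr // mulrC.
    have : ((level R n.+1)^-1 - 1) * Q y <= ((level R n.+1)^-1 - 1) * rnorm y ^+ 2.
      by rewrite ler_wpM2l // bn.
    lra.
  move=> /(_ Xb) /le_trans; apply; rewrite ler_piMr //.
have b0 : b n @[n --> \oo] --> (0 : R).
  rewrite -[X in _ --> X](subrr (1 : R)) -{1}[1]invr1; apply: cvgB; last exact: cvg_cst.
  by apply: cvgV; [exact: oner_neq0|exact: level_cvg1].
apply/cvgrPdist_le => e e0; have /cvgrPdist_le /(_ _ e0) [N _ hN] := b0.
exists N.+1 => // -[//|n] /= Nn; rewrite sub0r normrN.
have Xb := @defect_bounded T S n.+1 Tb TS.
rewrite ger0_norm; last exact: (opnorm_ge0 Xb (ler0n _ 2)).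
rewrite (le_trans (hb n)) //.
by have := hN n.+1 (ltnW Nn); rewrite /= sub0r normrN ger0_norm.
Qed.

Lemma bounded_dense_null (S : nat -> {linear H -> H}) (P : H -> Prop) x :
  (forall n, bounded_by 1 (S n)) ->
  (forall y, P y -> exists N, forall n, (N <= n)%N -> S n y = 0) ->
  (forall e : R, 0 < e -> exists y, P y /\ rnorm (x - y) < e) ->
  S n x @[n --> \oo] --> (0 : H).
Proof.
move=> Sb Sn Px; apply/cvg_rnormP => e /Px [y [Py xy]].
have [N hN] := Sn y Py; exists N => n Nn; rewrite subr0.
have := Sb n (x - y); rewrite linearB (hN n Nn) subr0 mul1r.
by move/le_lt_trans; apply.
Qed.

End Asymptotics.

(** * The adjoint of the shift and the class of C_.0-contractions *)

Section PureShift.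
Variables (R : realType) (H : completeNormedModType R[i]).
Variables (dot : {dot H for (@conjC R[i])}) (dot_norm : induces_norm dot).
Variables (A : {linear H -> H}) (A_pos : positive_contraction dot A).
Variables (E : set R -> {linear H -> H}) (A_E : is_spectral_measure dot A E).
Variables (f : nat -> H) (lev : nat -> nat) (f_adapted : adapted_basis dot A E f lev).
Variable s : nat -> nat.
Hypothesis s_inj : injective s.
Hypothesis s_up : forall j, f j != 0 ->
  f (s j) != 0 /\ block_sup R (lev j) <= block_inf R (lev (s j)).
Hypothesis s_gt : forall j, f j != 0 -> (j < s j)%N.
Implicit Types (x y z : H).

Let Apsd := A_psd A_pos.
Let idpsd := psd_id dot_norm.
Let f_orth := proj1 (adapted_orthonormal f_adapted).

Variable S : {linear H -> H}.
Hypothesis S_bounded : bounded_by 1 S.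
Hypothesis S_series : forall x,
  (\sum_(j < n) dot x (if f j == 0 then 0 else f (s j)) *: A (f j)) @[n --> \oo] --> S x.

(** The adjoint runs backwards along [s]: [A (f i)] goes to a multiple of [A (f j)] if [i = s j]
    with [f j] nonzero, and to 0 otherwise. As [j < i], some iterate kills [A (f i)]. *)
Lemma adjoint_shift i : S (A (f i)) = 0 \/
  exists2 j, (j < i)%N & exists c, S (A (f i)) = c *: A (f j).
Proof.
have coef j : s j <> i -> dot (A (f i)) (if f j == 0 then 0 else f (s j)) = 0.
  by move=> ji; case: eqP => _; [rewrite dot0r|apply: f_orth => ij; apply: ji].
have [[j [fj sji]]|nj] := pselect (exists j, f j != 0 /\ s j = i); [right|left].
  exists j; first by rewrite -sji s_gt.
  exists (dot (A (f i)) (f i)); apply: (cvg_uniqueH (S_series (x := A (f i)))).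
  apply/cvg_rnormP => e e0; exists j.+1 => n jn.
  rewrite (bigD1 (Ordinal jn)) //= big1 ?addr0; last first.
    move=> k; rewrite -val_eqE /= => kj; rewrite coef ?scale0r // => ski.
    by rewrite (s_inj (etrans ski (esym sji))) eqxx in kj.
  by rewrite (negbTE fj) sji subrr rnorm0.
apply: (cvg_uniqueH (S_series (x := A (f i)))).
apply/cvg_rnormP => e e0; exists 0%N => n _; rewrite subr0 big1 ?rnorm0 // => j _.
have [fj|fj] := eqVneq (f j) 0; first by rewrite dot0r scale0r.
have := @coef j; rewrite (negbTE fj) => -> //; first by rewrite scale0r.
by move=> sji; apply: nj; exists j.
Qed.

Lemma adjoint_shift_nilpotent i n : (i < n)%N -> iter n S (A (f i)) = 0.
Proof.
have i0 m : iter m S 0 = 0 by elim: m => // m IH; rewrite iterS IH linear0.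
elim: n i => // n IH i; rewrite ltnS iterSr => ni.
have [->|[j ji [c ->]]] := adjoint_shift i; first exact: i0.
have := iter_linear S n c (A (f j)) 0; rewrite !addr0 i0 addr0 => ->.
by rewrite IH ?scaler0 // (leq_trans ji).
Qed.

(** Each [f (s j)] lies in a spectral subspace of a part of ]0, 1], and these are orthogonal to ker
    A. *)
Lemma adjoint_shift_ker x : A x = 0 -> S x = 0.
Proof.
move=> Ax; apply: (cvg_uniqueH (S_series (x := x))).
apply/cvg_rnormP => e e0; exists 0%N => n _; rewrite subr0 big1 ?rnorm0 // => j _.
have [fj|fj] := eqVneq (f j) 0; first by rewrite dot0r scale0r.
have -> : f (s j) = E (block (lev (s j))) (f (s j)) by rewrite (adapted_block f_adapted).
have mb := @measurable_block R (lev (s j)).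
rewrite -(E_selfadjoint A_E) // (ker_E_itv dot_norm A_pos A_E) ?dot0l ?scale0r //.
apply: (@subset_trans _ `]0, 1]%classic).
  by rewrite -block_bigcup => t tb; exists (lev (s j)).
by move=> t; rewrite /= !in_itv /= => /andP [->].
Qed.

(** The vectors [A (f i)] and ker A together span a dense subspace. With [e] obtained from the
    [A (f i)] by Gram-Schmidt, the limit x - l of the residuals is orthogonal to every [A (f i)], so
    Parseval's identity puts it in ker A. The iterates of [S] eventually kill x - l plus any partial
    sum of the expansion, and they are contractions. *)
Lemma adjoint_shift_strong x : iter n S x @[n --> \oo] --> (0 : H).
Proof.
pose e := gs dot (idfun : {linear H -> H}) (fun i => A (f i)).
have e1 : form_orthonormal dot (idfun : {linear H -> H}) e by exact: gs_orthonormal.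
have e_nil i : forall n, (i < n)%N -> iter n S (e i) = 0.
  have [m] := ubnP i; elim: m i => // m IH i im n ni.
  have [c ec] := gs_scaled dot (idfun : {linear H -> H}) (fun i => A (f i)) i.
  rewrite /e ec.
  have [Sn SnE] := linear_of_subproof (iter_linear S n).
  rewrite -SnE (linearZ_LR Sn) /residual linearB linear_sum big1 => [|k _].
    by rewrite SnE adjoint_shift_nilpotent // subr0 scaler0.
  rewrite (linearZ_LR Sn) SnE IH ?scaler0 //.
    exact: leq_trans (ltn_ord k) im.
  exact: ltn_trans (ltn_ord k) ni.
have eb : bessel_seq 1 e.
  move=> n c; rewrite (rnorm_sqr dot_norm) mul1r.
  have := qform_sum_orth idpsd c n (proj1 e1); rewrite {1}/qform /= => ->.
  apply: ler_sum => j _; rewrite ler_piMr ?sqnormc_ge0 //.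
  by case: (proj2 e1 j) => [->|->] //; rewrite (qform0 dot (idfun : {linear H -> H})) ler01.
have dual n := bessel_dual dot_norm x n ler01 eb.
have [l xl] := @bessel_series_cvg _ _ _ _ (fun j => dot x (e j)) _ ler01 eb dual.
pose res n := residual dot (idfun : {linear H -> H}) e x n.
have res_cvg : res n @[n --> \oo] --> x - l by apply: cvgB xl; exact: cvg_cst.
have r_e j : dot (x - l) (e j) = 0.
  rewrite -[RHS](@dot0l R H dot 0); apply: (dot_cvg_eq dot_norm (u := fun n => res (n + j.+1)%N)
    (v := fun=> 0)) _ _ (cvg_cst _).
    move=> n; rewrite !dot0l; apply: (residual_coef_lt idpsd x e1).
    by rewrite addnS ltnS leq_addl.
  apply/cvg_rnormP => d d0; have /cvg_rnormP /(_ _ d0) [N hN] := res_cvg.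
  by exists N => n Nn; apply: hN; exact: leq_trans Nn (leq_addr _ _).
have r_Af i : dot (A (x - l)) (f i) = 0.
  rewrite (A_selfadjoint A_pos).
  have := gs_null idpsd (fun i => A (f i)) (ltnSn i).
  rewrite /qform -(rnorm_sqr dot_norm) => /eqP; rewrite sqrf_eq0 => /eqP/rnorm_eq0/eqP.
  rewrite subr_eq0 => /eqP ->; rewrite dot_sumr big1 // => k _.
  by rewrite dotZr r_e mulr0.
have Ar : A (x - l) = 0.
  apply: (qform_null_ker dot_norm Apsd).
  have := @adapted_parseval _ _ _ _ _ _ _ f_adapted (x - l).
  rewrite (_ : (fun n => _) = fun=> 0); last first.
    by apply/funext => n; rewrite big1 // => j _; rewrite r_Af sqnormc0.
  by move=> /(cvg_unique (@Rhausdorff R) (cvg_cst 0)).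
pose P y := exists m, y = (x - l) + \sum_(j < m) dot x (e j) *: e j.
have SnL n : exists Sn : {linear H -> H}, Sn =1 iter n S.
  exact: linear_of_subproof (iter_linear S n).
have /choice [Sn SnE] := SnL.
rewrite (_ : (fun n => iter n S x) = (fun n => Sn n x)); last by apply/funext => n; rewrite SnE.
apply: (bounded_dense_null (P := P)) => [n y|y [m ->]|d d0].
- by rewrite SnE; exact: iter_bounded.
- exists m.+1 => n mn; rewrite linearD linear_sum SnE.
  case: n mn => // n mn; rewrite iterSr adjoint_shift_ker //.
  have -> : iter n S 0 = 0 by elim: (n) => // k IH; rewrite iterS IH linear0.
  rewrite add0r big1 // => j _; rewrite (linearZ_LR (Sn _)) SnE e_nil ?scaler0 //.
  exact: leq_trans (ltn_ord j) (ltnW mn).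
have /cvg_rnormP /(_ _ d0) [N hN] := xl.
exists (x - l + \sum_(j < N) dot x (e j) *: e j); split; first by exists N.
rewrite opprD opprB addrA [x + (l - x)]addrC subrK rnormB; exact: hN.
Qed.

End PureShift.

(** * The infinite case *)

Section InfiniteCase.
Variables (R : realType) (H : completeNormedModType R[i]).
Variables (dot : {dot H for (@conjC R[i])}) (dot_norm : induces_norm dot).
Hypothesis H_separable : separable_space H.
Variables (A : {linear H -> H}) (A_pos : positive_contraction dot A).
Variables (E : set R -> {linear H -> H}) (A_E : is_spectral_measure dot A E).
Implicit Types (x y z : H) (v w : set R).

Let Apsd := A_psd A_pos.
Let mblock k := @measurable_block R k.

Definition infinite_near_one : Prop := forall d : R, 0 <= d < 1 ->
  ~ finite_dim (range (E `]d, 1]%classic)).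

Lemma finite_dim_E_setU v w : measurable v -> measurable w -> v `&` w = set0 ->
  finite_dim (range (E v)) -> finite_dim (range (E w)) -> finite_dim (range (E (v `|` w))).
Proof.
move=> mv mw vw [n [e he]] [m [e' he']].
exists (n + m)%N, (fun i => match fintype.split i with inl j => e j | inr j => e' j end).
move=> _ [x _ <-]; rewrite (E_setU dot_norm A_E) //.
have [|c ->] := he (E v x); first by exists x.
have [|c' ->] := he' (E w x); first by exists x.
exists (fun i => match fintype.split i with inl j => c j | inr j => c' j end).
rewrite big_split_ord /=; congr (_ + _); apply: eq_bigr => i _.
  by rewrite (unsplitK (inl i)).
by rewrite (unsplitK (inr i)).
Qed.

Lemma finite_dim_E_sub v w : measurable v -> measurable w -> v `<=` w ->
  finite_dim (range (E w)) -> finite_dim (range (E v)).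
Proof.
move=> mv mw vw; apply: finite_dimS => _ [x _ <-].
by exists (E v x); rewrite // (E_sub A_E).
Qed.

Variables (f : nat -> H) (lev : nat -> nat) (f_adapted : adapted_basis dot A E f lev).

(** If only finitely many nonzero [f m] had their block in [w], each vector of the range of [E w]
    would differ from a combination of them by a vector null for the form, hence in ker A; but ker A
    meets this range only in 0. *)
Lemma adapted_support_unbounded w : measurable w -> w `<=` `]0, +oo[%classic ->
  (forall k, block k `<=` w \/ block k `&` w = set0) ->
  ~ finite_dim (range (E w)) ->
  forall N, exists m, (N <= m)%N /\ (f m != 0 /\ block (lev m) `<=` w).
Proof.
move=> mw w0 bw; apply: contra_notP => /existsNP [N hN].
have fN m : (N <= m)%N -> block (lev m) `<=` w -> f m = 0.
  by move=> Nm bm; apply/eqP/negP => /negP fm; apply: hN; exists m.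
apply: (@finite_dim_span _ _ _ N f) => _ [x' _ <-]; set x := E w x'.
have xE : E w x = x by rewrite /x (E_idem A_E).
(* Only the members whose block lies in [w] are used, so that the difference stays in the range of
   [E w]. *)
pose c j : R[i] := if `[< block (lev j) `<=` w >] then dot (A x) (f j) else 0.
exists c; apply/eqP; rewrite -subr_eq0; apply/eqP; set y := _ - _.
have yE : E w y = y.
  rewrite /y (linearB (E w)) xE (linear_sum (E w)); congr (_ - _).
  apply: eq_bigr => j _; rewrite (linearZ_LR (E w)) /c; case: asboolP => [bj|_].
    congr (_ *: _).
    by rewrite -{1}(adapted_block f_adapted j) (E_sub A_E) // (adapted_block f_adapted).
  by rewrite !scale0r.
suff Ay : A y = 0 by rewrite -yE (ker_E_itv dot_norm A_pos A_E).
apply: (qform_null_ker dot_norm Apsd).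
have yf i : dot (A y) (f i) = 0.
  have [bi|bi] := bw (lev i); last first.
    rewrite -yE -(adapted_block f_adapted i) (A_E_comm dot_norm A_pos A_E) //.
    by rewrite (E_orth dot_norm A_E) // setIC.
  have [Ni|iN] := leqP N i; first by rewrite fN // dot0r.
  have [f0 f1] := adapted_orthonormal f_adapted.
  rewrite /y (linearB A) dotBl (linear_sum A) dot_suml (bigD1 (Ordinal iN)) //=.
  rewrite big1 ?addr0; last first.
    move=> j; rewrite -val_eqE /= => ji; rewrite (linearZ_LR A) dotZl f0 ?mulr0 // => jiE.
    by rewrite jiE eqxx in ji.
  rewrite (linearZ_LR A) dotZl /c asboolT //; case: (f1 i) => [->|fi].
    by rewrite dot0r mul0r subrr.
  by rewrite (psdE _ Apsd) fi mulr1 subrr.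
have := @adapted_parseval _ _ _ _ _ _ _ f_adapted y.
rewrite (_ : (fun n => _) = fun=> 0); last first.
  by apply/funext => n; rewrite big1 // => j _; rewrite yf sqnormc0.
by move=> /(cvg_unique (@Rhausdorff R) (cvg_cst 0)).
Qed.

Lemma adapted_support_zero j : (forall x, E [set 1] x = 0) -> f j != 0 -> lev j != 0%N.
Proof.
move=> E1; apply: contra_neq => j0.
by rewrite -(adapted_block f_adapted j) j0 /= E1.
Qed.

(** If E({1}) has infinite rank, every index is sent into the block {1}. If its rank is finite,
    ]level k, 1[ still has infinite rank for every [k], so each index below the block {1} can be
    raised strictly while those in it stay fixed. Fixed indices are what prevents [j < s j], and
    there are none when E({1}) = 0. *)
Lemma shift_map_exists : infinite_near_one ->
  exists s : nat -> nat,
    [/\ injective s,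
        forall j, f j != 0 ->
          f (s j) != 0 /\ block_sup R (lev j) <= block_inf R (lev (s j)) &
        (forall x, E [set 1] x = 0) \/ ~ finite_dim (range (E [set 1])) ->
          forall j, f j != 0 -> (j < s j)%N].
Proof.
move=> Dinf; have [fin1|inf1] := pselect (finite_dim (range (E [set 1]))).
- have unb k N : exists m, (N <= m)%N /\ (f m != 0 /\ (k < lev m)%N).
    have mI : measurable (`]level R k, 1[%classic : set R) by exact: measurable_itv.
    have [|l|fdim|m [Nm [fm bm]]] := adapted_support_unbounded mI _ _ _ N.
    - move=> t /=; rewrite !in_itv /= andbT => /andP [kt _].
      exact: le_lt_trans (level_ge0 R k) kt.
    - case: l => [|l].
        right; rewrite -subset0 => t [/= ->]; rewrite in_itv /= ltxx andbF.
        by [].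
      have [kl|lk] := leqP k l; [left|right].
        move=> t /=; rewrite !in_itv /= => /andP [lt tl].
        rewrite (le_lt_trans _ lt) ?level_mono //=.
        by rewrite (le_lt_trans tl) ?level_lt1.
      rewrite -subset0 => t [/=]; rewrite !in_itv /= => /andP [_ tl] /andP [kt _].
      have := level_mono R lk; rewrite leNgt (lt_le_trans kt) //.
    - apply: (Dinf (level R k)); first by rewrite level_ge0 level_lt1.
      have -> : `]level R k, 1]%classic = `]level R k, 1[%classic `|` [set 1].
        by rewrite setUitv1 // bnd_simp level_lt1.
      apply: finite_dim_E_setU => //.
      by rewrite -subset0 => t [/=]; rewrite in_itv /= => /andP [_ t1] tE; rewrite tE ltxx in t1.
    exists m; split=> //; split=> //.
    rewrite ltnNge; apply/negP => lm; move: bm.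
    case El : (lev m) lm => [|l] lm /=.
      by move=> /(_ 1 erefl); rewrite /= in_itv /= ltxx andbF.
    move=> /(_ (level R l.+1)) /=; rewrite !in_itv /= lexx andbT.
    have ll : level R l < level R l.+1.
      by rewrite !levelE ltrD2l ltrN2 ltf_pV2 ?posrE ?ltr0n // ltr_nat.
    move=> /(_ ll) /andP [+ _]; rewrite ltNge => /negP; apply.
    exact: level_mono.
  have [|s [hs s_gt s_mono]] :=
    @increasing_selection (fun j m => f m != 0 /\ (lev j < lev m)%N).
    by move=> j N; exact: unb.
  have s_inj : injective s.
    move=> i j sij; apply/eqP; rewrite eqn_leq; apply/andP.
    by split; rewrite leqNgt; apply/negP => /s_mono; rewrite sij ltnn.
  exists (fun j => if lev j == 0%N then j else s j); split.
  (* Fixed indices have [lev] equal to 0 and all values of [s] have positive [lev], so the two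
     branches cannot collide. *)
  + move=> i j; have [_ li] := hs i; have [_ lj] := hs j.
    case: eqP => [i0|_]; case: eqP => [j0|_] //; last exact: s_inj.
      by move=> ijE; move: lj; rewrite -ijE i0 ltn0.
    by move=> ijE; move: li; rewrite ijE j0 ltn0.
  + move=> j fj /=; have [j0|j0] := eqVneq (lev j) 0%N; first by rewrite j0 fj lexx.
    have [fs ls] := hs j; split=> //.
    case: (lev j) j0 ls => // k _; case: (lev (s j)) => // l; rewrite ltnS => kl /=.
    exact: level_mono.
  case=> [E1|//] j fj; rewrite (negbTE (adapted_support_zero E1 fj)).
  exact: s_gt.
have unb N : exists m, (N <= m)%N /\ (f m != 0 /\ block (lev m) `<=` [set (1 : R)]).
  apply: adapted_support_unbounded => // [t -> /=|k]; first by rewrite in_itv /= ltr01.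
  case: k => [|k]; [by left|right]; exact: (@block_disj R k.+1 0%N).
have [|s [hs s_gt s_mono]] :=
  @increasing_selection (fun _ m => f m != 0 /\ block (lev m) `<=` [set (1 : R)]).
  by move=> _ N; exact: unb.
exists s; split=> [i j sij|j fj|_ j _]; last exact: s_gt.
  apply/eqP; rewrite eqn_leq; apply/andP.
  by split; rewrite leqNgt; apply/negP => /s_mono; rewrite sij ltnn.
have [fs bs] := hs j; split=> //.
case: (lev (s j)) bs => [|l] bs /=; first exact: block_sup_le1.
have : block l.+1 (level R l.+1).
  by rewrite /= in_itv /= lexx andbT !levelE ltrD2l ltrN2 ltf_pV2 ?posrE ?ltr0n // ltr_nat.
by move=> /bs /= l1; have := level_lt1 R l.+1; rewrite l1 ltxx.
Qed.

End InfiniteCase.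

Section ShiftTheorem.
Variables (R : realType) (H : completeNormedModType R[i]).
Variables (dot : {dot H for (@conjC R[i])}) (dot_norm : induces_norm dot).
Hypothesis H_separable : separable_space H.
Variables (A : {linear H -> H}) (A_pos : positive_contraction dot A).
Variables (E : set R -> {linear H -> H}) (A_E : is_spectral_measure dot A E).

Lemma shift_exists : infinite_near_one E ->
  exists T : {linear H -> H},
    [/\ bounded_by 1 T, arises_uniformly dot A T &
        (forall x, E [set 1] x = 0) \/ ~ finite_dim (range (E [set 1])) -> C_dot0 dot T].
Proof.
move=> Dinf.
have [f [lev fa]] := adapted_basis_exists dot_norm H_separable A_pos A_E.
have [s [s_inj s_up s_gt]] := shift_map_exists dot_norm A_pos A_E fa Dinf.
have b1 := shift_bessel dot_norm A_pos A_E fa s_inj s_up.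
have b2 := image_bessel dot_norm A_pos A_E fa.
have [T [S [T_series S_series TS]]] := bessel_operator dot_norm (ler0n _ 2) ler01 b1 b2.
have Tb := shift_contraction dot_norm A_pos A_E fa s_inj s_up T_series.
exists T; split=> //.
  apply: (uniform_of_levels dot_norm A_pos Tb TS).
  exact: (shift_iter_rnorm dot_norm A_pos A_E fa s_inj s_up T_series).
move=> /s_gt {}s_gt; exists S => // x.
apply: (adjoint_shift_strong dot_norm A_pos A_E fa s_inj s_gt _ S_series).
exact: (adjoint_bounded dot_norm ler01 Tb TS).
Qed.

End ShiftTheorem.

(** * The finite case *)

Section Dichotomy.
Variables (R : realType) (H : completeNormedModType R[i]).
Variables (dot : {dot H for (@conjC R[i])}) (dot_norm : induces_norm dot).
Variables (A : {linear H -> H}) (A_pos : positive_contraction dot A).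
Variables (E : set R -> {linear H -> H}) (A_E : is_spectral_measure dot A E).
Implicit Types (x y z : H) (v w : set R).

Local Notation Q := (qform dot A).
Let Apsd := A_psd A_pos.
Let mblock k := @measurable_block R k.

Lemma not_infinite_near_one : ~ infinite_near_one E ->
  exists d : R, 0 <= d < 1 /\ finite_dim (range (E `]d, 1]%classic)).
Proof. by move=> /existsNP [d /not_implyP [d01 /contrapT fd]]; exists d. Qed.

Lemma E_sub0 v w x : measurable v -> measurable w -> v `<=` w -> E w x = 0 -> E v x = 0.
Proof. by move=> mv mw vw wx; rewrite -(setIidl vw) (spectral_setI A_E) // wx linear0. Qed.

Lemma finite_rank_of_eq : (forall x, A x = E [set 1] x) -> finite_dim (range (E [set 1])) ->
  finite_rank_projection dot A.
Proof.
move=> AE fd; split; first split.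
- by move=> x y; rewrite !AE (E_selfadjoint A_E).
- by move=> x; rewrite !AE (E_idem A_E).
by apply: finite_dimS fd => _ [x _ <-]; exists x; rewrite // AE.
Qed.

Lemma A_eq_E1 : (forall k x, E (block k.+1) x = 0) -> forall x, A x = E [set 1] x.
Proof.
move=> bk x; suff xE : x - E [set 1] x - E `]-oo, 0]%classic x = 0.
  have -> : A x = A (E [set 1] x) + A (E `]-oo, 0]%classic x).
    rewrite -(linearD A) -[in LHS](subr0 x) -xE; congr (A _).
    by rewrite -addrA -opprD subKr.
  by rewrite (E_itv_le0_ker dot_norm A_pos A_E) addr0 (E_block0_fixed dot_norm A_pos A_E).
have disj : `]-oo, 0]%classic `&` [set (1 : R)] = set0.
  by rewrite -subset0 => t [/=]; rewrite in_itv /= => t0 t1; move: t0; rewrite t1 ler10.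
apply: (E_blocks_eq0 dot_norm A_pos A_E) => [|[|k]]; last exact: bk.
  rewrite !(linearB (E _)) (E_idem A_E) // (E_disjoint dot_norm A_E x _ _ disj) //.
  by rewrite subr0 subrr.
rewrite !(linearB (E _)) /= (E_idem A_E) // (E_disjoint dot_norm A_E) //; last by rewrite setIC.
by rewrite subrr subr0.
Qed.

(** Nonzero blocks arbitrarily close to 1 would supply, by one unit vector in each, arbitrarily long
    orthonormal families in the range of E(]d, 1]). *)
Lemma finite_dim_gap (d : R) : 0 <= d < 1 -> finite_dim (range (E `]d, 1]%classic)) ->
  exists K, forall x, E `]level R K, 1[%classic x = 0.
Proof.
move=> /andP [d0 d1] /(finite_dim_bound dot) [n hn]; apply: contrapT => /forallNP noK.
have [K0 dK0] := level_archi d1.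
have mI K : measurable (`]level R K, 1[%classic : set R) by exact: measurable_itv.
have big N : exists k, (N <= k)%N /\ ((K0 <= k)%N /\ exists x, E (block k.+1) x != 0).
  apply: contrapT => /forallNP hk; apply: (noK (maxn N K0)) => x.
  pose F k : set R := if (maxn N K0 <= k)%N then block k.+1 else set0.
  apply: (E_bigcup_null dot_norm A_E (F := F)) => [|k|t|k].
  - exact: mI.
  - by rewrite /F; case: ifP => _; [exact: mblock|exact: measurable0].
  - rewrite /= in_itv /= => /andP [Kt t1].
    have : (\bigcup_n block n) t.
      by rewrite block_bigcup /= in_itv /= (ltW t1) (le_lt_trans (level_ge0 R _) Kt).
    move=> [[|k] _ /= bt]; first by rewrite bt ltxx in t1.
    exists k => //; rewrite /F; case: ifP => // /negbT; rewrite -ltnNge => kK.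
    move: bt; rewrite in_itv /= => /andP [_]; have := level_mono R kK.
    by move=> le1 /le_trans /(_ le1); rewrite leNgt Kt.
  rewrite /F; case: ifP => Kk; last by rewrite (E0 dot_norm A_E).
  apply: contrapT => /eqP bx; apply: (hk k); split; first by rewrite (leq_trans (leq_maxl _ _) Kk).
  by split; [rewrite (leq_trans (leq_maxr _ _) Kk)|exists x].
have [|s [hs _ s_mono]] := @increasing_selection
    (fun _ k => (K0 <= k)%N /\ exists x, E (block k.+1) x != 0).
  by move=> _; exact: big.
have /choice [x hx] j : exists x, E (block (s j).+1) x != 0 by have [] := hs j.
pose g j := unit_of dot (E (block (s j).+1) (x j)).
have gE j : E (block (s j).+1) (g j) = g j.
  rewrite /g; have [c ->] := unit_of_scaled dot (E (block (s j).+1) (x j)).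
  by rewrite (linearZ_LR (E _)) (E_idem A_E).
suff : (n.+1 <= n)%N by rewrite ltnn.
apply: (hn _ g) => [i j _ _|i _].
  have [->|ij] := eqVneq i j; first by rewrite (unit_of_dot dot_norm (hx j)).
  rewrite -(gE i) -(gE j) (E_orth dot_norm A_E) //.
  apply: block_disj => -[sij]; move: ij; rewrite neq_ltn => /orP [] /s_mono;
    by rewrite sij ltnn.
exists (g i) => //; rewrite -{2}(gE i) -[X in E _ X](gE i) (E_sub A_E) // ?gE //.
have [Ki _] := hs i; move=> t /=; rewrite !in_itv /= => /andP [st ts].
rewrite (le_lt_trans _ st) /=; first by rewrite (le_trans ts) // ltW ?level_lt1.
by rewrite (le_trans (ltW dK0)) // level_mono.
Qed.

Section Asymptotic.
Variables (T : {linear H -> H}) (Ts : H -> H).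
Hypothesis T_bounded : bounded_by 1 T.
Hypothesis T_adj : is_adjoint dot T Ts.
Hypothesis T_lim : forall x, iter n Ts (iter n T x) @[n --> \oo] --> A x.

(** Inserting one more [T] on both sides only shifts the index of the sequence that converges to
    [A]. *)
Lemma asymptotic_invariant x y : dot (A (T x)) (T y) = dot (A x) y.
Proof.
rewrite [RHS](A_selfadjoint A_pos).
apply: (dot_cvg_eq dot_norm (u := fun n => iter n Ts (iter n T (T x)))
   (v := fun n => iter n.+1 Ts (iter n.+1 T y))); [|exact: T_lim|].
  move=> n; rewrite (adjointC (adjoint_iter n T_adj)) -!iterSr.
  by rewrite (adjoint_iter n.+1 T_adj).
apply/cvg_rnormP => e e0; have /cvg_rnormP /(_ _ e0) [N hN] := @T_lim y.
by exists N => n Nn; apply: hN; exact: leqW.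
Qed.

Lemma asymptotic_Q_iter n x : Q (iter n T x) = Q x.
Proof. by elim: n => // n IH; rewrite iterS -IH /qform asymptotic_invariant. Qed.

Lemma asymptotic_rnorm x : rnorm (iter n T x) ^+ 2 @[n --> \oo] --> Q x.
Proof.
have ux := @T_lim x.
have h0 : rnorm (iter n Ts (iter n T x) - A x) * rnorm x @[n --> \oo] --> (0 : R).
  rewrite -[X in _ --> X](mul0r (rnorm x)); apply: cvgM; last exact: cvg_cst.
  by apply/cvg_rnorm0.
apply/cvgrPdist_le => e e0; have /cvgrPdist_le /(_ _ e0) [N _ hN] := h0.
exists N => // n /= /hN; rewrite sub0r normrN ger0_norm ?mulr_ge0 ?rnorm_ge0 //.
apply: le_trans; rewrite distrC.
have -> : rnorm (iter n T x) ^+ 2 - Q x =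
    complex.Re (dot (iter n Ts (iter n T x) - A x) x).
  rewrite dotBl ReD ReN (adjointC (adjoint_iter n T_adj)).
  by rewrite -(rnorm_sqr dot_norm).
rewrite -(@ler_pXn2r _ 2) ?nnegrE ?normr_ge0 ?mulr_ge0 ?rnorm_ge0 //.
rewrite real_normK ?num_real // (le_trans (sqr_Re_le _)) // exprMn.
exact: dot_cauchy_schwarz.
Qed.

(** Invariance of the form gives <ATx, Tx> = |x|^2 >= |Tx|^2, the equality case of [A <= I]. *)
Lemma asymptotic_fixed x : A x = x -> A (T x) = T x.
Proof.
move=> Ax; apply: (Q_fixed dot_norm A_pos).
have -> : Q (T x) = rnorm x ^+ 2 by rewrite /qform asymptotic_invariant Ax (rnorm_sqr dot_norm).
have := T_bounded x; rewrite mul1r.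
by rewrite ler_sqr ?nnegrE ?rnorm_ge0.
Qed.

(* On the finite-dimensional eigenspace the isometry [T] is onto, so its
   orthogonal complement is invariant. *)
Lemma asymptotic_complement : finite_dim (range (E [set 1])) ->
  forall x, E [set 1] x = 0 -> E [set 1] (T x) = 0.
Proof.
move=> /(finite_dim_bound dot) [n hn].
pose P m := `[< exists b, orthonormal_upto dot m b /\
  forall i, (i < m)%N -> E [set 1] (b i) = b i >].
have P0 : exists m, P m by exists 0%N; apply/asboolP; exists (fun=> 0); split.
have Pn m : P m -> (m <= n)%N.
  move=> /asboolP [b [ob bE]]; apply: (hn _ b) => // i im.
  by exists (b i); rewrite ?bE.
(* An orthonormal family of maximal size serves as a basis: [T] maps it to another one of the same
   size, and a nonzero component of [T x] in the eigenspace would be orthogonal to the image and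
   enlarge it. *)
case: (ex_maxnP P0 Pn) => m /asboolP [b [ob bE]] mmax.
have Ab i : (i < m)%N -> A (b i) = b i.
  by move=> im; rewrite -(bE i im) (E_block0_fixed dot_norm A_pos A_E).
have ATb i : (i < m)%N -> A (T (b i)) = T (b i) by move=> im; exact/asymptotic_fixed/Ab.
have TbE i : (i < m)%N -> E [set 1] (T (b i)) = T (b i).
  by move=> im; apply: (fixed_E_block0 dot_norm A_pos A_E); exact: ATb.
have oTb : orthonormal_upto dot m (fun i => T (b i)).
  by move=> i j im jm; rewrite -(ATb i im) asymptotic_invariant Ab // ob.
move=> x x1; set y := E [set 1] (T x).
have yE : E [set 1] y = y by rewrite /y (E_idem A_E).
have Txb i : (i < m)%N -> dot (T x) (T (b i)) = 0.
  move=> im; rewrite dotC -(ATb i im) asymptotic_invariant Ab // -(bE i im).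
  by rewrite (E_selfadjoint A_E) // x1 dot0r conjc0.
have yb i : (i < m)%N -> dot y (T (b i)) = 0.
  by move=> im; rewrite (E_selfadjoint A_E) // TbE // Txb.
apply/eqP; apply: contrapT => /negP y0.
suff /mmax : P m.+1 by rewrite ltnn.
have [c uE] := unit_of_scaled dot y.
apply/asboolP; exists (fun i => if (i < m)%N then T (b i) else unit_of dot y); split.
  apply: (orthonormal_upto_extend oTb); first exact: unit_of_dot.
  by move=> i im; rewrite uE dotZl yb ?mulr0.
move=> i _; case: ifP => im; first exact: TbE.
by rewrite uE (linearZ_LR (E _)) yE.
Qed.

Lemma asymptotic_finite_rank : ~ infinite_near_one E -> finite_rank_projection dot A.
Proof.
move=> /not_infinite_near_one [d [d01 fd]].
have fd1 : finite_dim (range (E [set 1])).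
  apply: (finite_dim_E_sub A_E _ _ _ fd) => // t -> /=.
  by rewrite in_itv /= lexx andbT; case/andP: d01.
have [K hK] := finite_dim_gap d01 fd.
apply: finite_rank_of_eq => // x.
set x' := x - E [set 1] x.
have xE : x = E [set 1] x + x' by rewrite /x' addrC subrK.
have x'1 : E [set 1] x' = 0 by rewrite (linearB (E _)) (E_idem A_E) // subrr.
suff Ax' : A x' = 0.
  by rewrite {1}xE (linearD A) Ax' addr0 (E_block0_fixed dot_norm A_pos A_E).
apply: (qform_null_ker dot_norm Apsd); set y := fun n => iter n T x'.
have y1 n : E [set 1] (y n) = 0.
  by elim: n => // n IH; rewrite /y iterS (asymptotic_complement fd1).
have mIle : measurable (`]-oo, level R K]%classic : set R) by exact: measurable_itv.
have mIgt : measurable (`]level R K, +oo[%classic : set R) by exact: measurable_itv.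
have yle n : E `]-oo, level R K]%classic (y n) = y n.
  rewrite -[RHS](E_setC dot_norm A_E _ mIle) setCitvl.
  suff -> : E `]level R K, +oo[%classic (y n) = 0 by rewrite addr0.
  (* Above [level K] there are the gap, the point 1 and what exceeds 1; [y n] has no component in
     any of the three. *)
  pose F k : set R := match k with
    0 => `]level R K, 1[%classic | 1 => [set 1] | _ => `]1, +oo[%classic end.
  apply: (E_bigcup_null dot_norm A_E (F := F)) => // [k|t|k].
  - by case: k => [|[|k]] /=; [exact: measurable_itv|exact: measurable_set1|exact: measurable_itv].
  - rewrite /= in_itv /= andbT => Kt; have [t1|t1|->] := ltgtP t 1.
    + by exists 0%N => //=; rewrite in_itv /= Kt.
    + by exists 2%N => //=; rewrite in_itv /= andbT.
    + by exists 1%N.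
  by case: k => [|[|k]] /=; rewrite ?y1 ?hK ?(E_itv_gt1 dot_norm A_pos A_E).
have Qy n : Q x' <= level R K * rnorm (y n) ^+ 2.
  rewrite -(asymptotic_Q_iter n x'); apply: (Q_le_ub dot_norm A_E mIle (yle n)).
  by move=> t /=; rewrite in_itv.
have lim : level R K * rnorm (y n) ^+ 2 @[n --> \oo] --> level R K * Q x'.
  by apply: cvgM; [exact: cvg_cst|exact: asymptotic_rnorm].
have : Q x' <= level R K * Q x'.
  rewrite leNgt; apply/negP => lt_Q.
  have /cvgrPdist_lt /(_ (Q x' - level R K * Q x')) := lim.
  rewrite subr_gt0 => /(_ lt_Q) [N _ /(_ N (leqnn N))] /=.
  rewrite distrC => /(le_lt_trans (ler_norm _)).
  have := Qy N; lra.
have l1 := level_lt1 R K; have Q0 := qform_ge0 x' Apsd => h.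
by apply/eqP; rewrite eq_le Q0 andbT -(ler_pM2l (x := 1 - level R K)) ?subr_gt0 //; lra.
Qed.

End Asymptotic.

End Dichotomy.

(** * The essential spectrum *)

Section Compactness.
Variables (R : realType) (H : completeNormedModType R[i]).
Implicit Types (x y z : H).

Lemma scale_real_continuous x : continuous (fun t : R => t%:C *: x).
Proof.
move=> t; apply/cvgrPdist_le => e e0; have [eE _] := ger0_Re (ltW e0).
move: e0; rewrite eE ltcR => e0.
have d0 : 0 < complex.Re e / (rnorm x + 1) by rewrite divr_gt0 // ltr_wpDl ?rnorm_ge0.
near=> u; rewrite -scalerBl -rmorphB /= normE lecR rnormZ normc_sqnormc sqnormc_real.
rewrite /= sqrtr_sqr.
have h : `|t - u| <= complex.Re e / (rnorm x + 1).
  by near: u; apply: cvgr_dist_le.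
rewrite (le_trans (ler_wpM2r (rnorm_ge0 x) h)) // mulrAC ler_pdivrMr ?ltr_wpDl ?rnorm_ge0 //.
by apply: ler_wpM2l; rewrite ?lerDl // ltW.
Unshelve. all: by end_near. Qed.

Definition segment x : set H := [set t%:C *: x | t in `[(-1 : R), 1]%classic].

Lemma segment_compactH x : compact (segment x).
Proof.
apply: continuous_compact; last exact: segment_compact.
exact/continuous_subspaceT/scale_real_continuous.
Qed.

Lemma compact_add (C D : set H) : compact C -> compact D ->
  compact [set p.1 + p.2 | p in C `*` D].
Proof.
move=> cC cD; apply: continuous_compact; last exact: compact_setX.
by apply: continuous_subspaceT => p; exact: add_continuous.
Qed.

(** A compact set containing every combination with coefficients of modulus at most 1; splitting
    each coefficient into real and imaginary parts reduces compactness to that of real segments. *)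
Fixpoint box (f : nat -> H) n : set H :=
  if n is m.+1 then
    [set p.1 + p.2 | p in box f m `*` [set p.1 + p.2 | p in
       segment (f m) `*` segment ('i%C *: f m)]]
  else [set 0].

Lemma box_compact f n : compact (box f n).
Proof.
elim: n => [|n IH] /=; first exact: compact_set1.
by apply: compact_add => //; apply: compact_add; exact: segment_compactH.
Qed.

Lemma box_sum (f : nat -> H) (c : nat -> R[i]) n : (forall j, sqnormc (c j) <= 1) ->
  box f n (\sum_(j < n) c j *: f j).
Proof.
move=> c1; elim: n => [|n IH] /=; first by rewrite big_ord0.
rewrite big_ord_recr /=; exists (\sum_(j < n) c j *: f j, c n *: f n) => //=; split=> //=.
have sq (a : R) : a ^+ 2 <= 1 -> `[(-1 : R), 1]%classic a.
  move=> a1; rewrite /= in_itv /= -ler_norml -(@ler_pXn2r _ 2) ?nnegrE ?normr_ge0 //.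
  by rewrite real_normK ?num_real // expr1n.
exists ((complex.Re (c n))%:C *: f n, (complex.Im (c n))%:C *: ('i%C *: f n)) => /=.
  split=> /=; [exists (complex.Re (c n)) => //|exists (complex.Im (c n)) => //]; apply: sq.
    exact: le_trans (sqr_Re_le _) (c1 n).
  by rewrite (le_trans _ (c1 n)) // lerDr sqr_ge0.
by rewrite scalerA -scalerDl [in RHS](complexE (c n)) mulrC.
Qed.

(** A cluster point of the sequence would be within [e / 2] of two distinct terms. *)
Lemma separated_not_precompact (C : set H) (y : nat -> H) (e : R) : 0 < e ->
  (forall n, C (y n)) -> (forall m n, (m < n)%N -> e <= rnorm (y m - y n)) ->
  ~ precompact C.
Proof.
move=> e0 Cy sep; rewrite precompactE => cC.
have FC : (y n @[n --> \oo]) (closure C).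
  by exists 0%N => // n _; apply: subset_closure; exact: Cy.
have [p [_ clp]] := cC _ _ FC.
have e2 : 0 < (e / 2)%:C :> R[i] by rewrite ltcR divr_gt0.
have near_p N : exists n, (N <= n)%N /\ rnorm (p - y n) < e / 2.
  have tailN : (y n @[n --> \oo]) [set y n | n in [set n | (N <= n)%N]].
    by exists N => // n /= Nn; exists n.
  have [_ [[n /= Nn <-] By]] := clp _ _ tailN (nbhsx_ballx p _ e2).
  by exists n; split=> //; move: By; rewrite -ball_normE /ball_ /= normE ltcR.
have [m [_ pm]] := near_p 0%N; have [n [mn pn]] := near_p m.+1.
have := sep m n mn; have := ler_rnormB (y m) p (y n); rewrite (rnormB (y m) p).
lra.
Qed.

(** Each increment C r^n equals C / (1 - r) times r^n - r^(n+1), so the bounds telescope; from index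
    0 this also estimates the limit. *)
Lemma geometric_cvg (u : nat -> H) (C r : R) : 0 <= C -> 0 <= r < 1 ->
  (forall n, rnorm (u n.+1 - u n) <= C * r ^+ n) ->
  exists l : H, (u n @[n --> \oo] --> l) /\ rnorm (l - u 0%N) <= C / (1 - r).
Proof.
move=> C0 /andP [r0 r1] hu; have r1' : 0 < 1 - r by rewrite subr_gt0.
have Cr0 : 0 <= C / (1 - r) by rewrite divr_ge0 // ltW.
have step m k : rnorm (u (m + k)%N - u m) <= C / (1 - r) * (r ^+ m - r ^+ (m + k)).
  elim: k => [|k IH]; first by rewrite addn0 !subrr rnorm0 mulr0.
  rewrite addnS (le_trans (ler_rnormB _ (u (m + k)%N) _)) //.
  rewrite (le_trans (lerD (hu _) IH)) //.
  have -> : C * r ^+ (m + k) = C / (1 - r) * (r ^+ (m + k) - r ^+ (m + k).+1).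
    by rewrite exprS -{2}[r ^+ (m + k)]mul1r -mulrBl mulrA divfK // gt_eqF.
  by rewrite -mulrDr ler_wpM2l //; lra.
have [l ul] : exists l : H, u n @[n --> \oo] --> l.
  apply: cauchy_rnorm_cvg => e e0.
  have rc : (fun n => C / (1 - r) * r ^+ n) n @[n --> \oo] --> (0 : R).
    rewrite -[X in _ --> X](mulr0 (C / (1 - r))); apply: cvgM; first exact: cvg_cst.
    by apply: cvg_expr; rewrite ger0_norm.
  have /cvgrPdist_lt /(_ _ e0) [N _ hN] := rc.
  exists N => m n Nm mn; rewrite -(subnKC mn) (le_lt_trans (step _ _)) //.
  have := hN m Nm; rewrite /= sub0r normrN ger0_norm; last first.
    by rewrite mulr_ge0 // exprn_ge0.
  by apply: le_lt_trans; rewrite ler_wpM2l // gerBl exprn_ge0.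
exists l; split=> //.
have ul0 : u n - u 0%N @[n --> \oo] --> l - u 0%N by apply: cvgB; [|exact: cvg_cst].
apply: (cvg_rnorm_le ul0) => n.
have := step 0%N n; rewrite add0n => /le_trans; apply.
by rewrite ler_piMr // expr0 gerBl exprn_ge0.
Qed.

End Compactness.

(** * Invertibility modulo compact operators *)

Section Calkin.
Variables (R : realType) (H : completeNormedModType R[i]).
Variables (dot : {dot H for (@conjC R[i])}) (dot_norm : induces_norm dot).
Hypothesis H_separable : separable_space H.
Variables (A : {linear H -> H}) (A_pos : positive_contraction dot A).
Variables (E : set R -> {linear H -> H}) (A_E : is_spectral_measure dot A E).
Implicit Types (x y z : H) (v w : set R).

Local Notation Q := (qform dot A).
Let Apsd := A_psd A_pos.
Let idpsd := psd_id dot_norm.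
Local Notation id_linear := (idfun : {linear H -> H}).

Lemma E_projection w : measurable w -> orthogonal_projection dot (E w).
Proof. exact: (spectral_proj A_E). Qed.

Lemma finite_dim_onb_bounded (P : {linear H -> H}) f : finite_dim (range P) ->
  form_orthonormal dot id_linear f -> (forall n, P (f n) = f n) ->
  exists N, forall n, (N <= n)%N -> f n = 0.
Proof.
move=> /(finite_dim_bound dot) [n hn] [f0 f1] Pf; apply: contrapT => /forallNP unb.
have [|s [hs _ s_mono]] := @increasing_selection (fun _ k => f k != 0).
  move=> _ N; have /existsNP [k /not_implyP [Nk /eqP fk]] := unb N.
  by exists k.
suff : (n.+1 <= n)%N by rewrite ltnn.
apply: (hn _ (f \o s)) => [i j _ _ /=|i _]; last by exists (f (s i)); rewrite /= ?Pf.
have [->|ij] := eqVneq i j.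
  case: (f1 (s j)) => [fE|fE]; first by have := hs j; rewrite fE eqxx.
  by rewrite (psdE (B := id_linear) _ idpsd) fE.
apply: f0 => sij; move: ij; rewrite neq_ltn => /orP [] /s_mono; by rewrite sij ltnn.
Qed.

(** The image of the unit ball lies in the box of finitely many orthonormal vectors. The sign is
    that of the remainder left by the parametrix of [A - l] built below. *)
Lemma finite_projection_compact (P : {linear H -> H}) : orthogonal_projection dot P ->
  finite_dim (range P) -> compact_op (fun x => - P x).
Proof.
move=> Pp fd; have [f [of_ Pf ftot]] := projection_onb dot_norm H_separable Pp.
have [N fN] := finite_dim_onb_bounded fd of_ Pf.
have PE x : P x = \sum_(j < N) dot (P x) (f j) *: f j.
  apply/eqP; rewrite -subr_eq0; apply/eqP; apply: ftot.
    rewrite (linearB P) (linear_sum P) (proj2 Pp); congr (_ - _).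
    by apply: eq_bigr => j _; rewrite (linearZ_LR P) Pf.
  exact: (@residual_span _ _ _ dot_norm f N (P x) of_ fN).
apply: (precompact_subset (B := box f N)); last first.
  by apply: (compact_precompact (norm_hausdorff (V := H))); exact: box_compact.
move=> _ [x /= /rnorm1_ball x1 <-]; rewrite -linearN PE.
apply: (@box_sum _ _ f (fun j => dot (P (- x)) (f j))) => j.
rewrite (proj1 Pp) Pf (le_trans (dot_cauchy_schwarz dot_norm _ _)) //.
have f1 : rnorm (f j) ^+ 2 <= 1.
  rewrite (rnorm_sqr dot_norm); case: (proj2 of_ j) => [->|]; first by rewrite dot0l ler01.
  by rewrite /qform /= => ->.
rewrite -[leRHS]mulr1 ler_pM ?sqr_ge0 // rnormN.
by rewrite expr_le1 ?rnorm_ge0.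
Qed.

Lemma E_split (d : R) x : d <= 1 -> E `]-oo, d]%classic x + E `]d, 1]%classic x = x.
Proof.
move=> d1; have mI (i : interval R) : measurable ([set` i] : set R) by exact: measurable_itv.
have -> : E `]d, 1]%classic x = E (~` `]-oo, d]%classic) x.
  have -> : ~` `]-oo, d]%classic = `]d, 1]%classic `|` `]1, +oo[%classic :> set R.
    by rewrite setCitvl -itv_bndbnd_setU // bnd_simp.
  rewrite (E_setU dot_norm A_E) //; first by rewrite (E_itv_gt1 dot_norm A_pos A_E) addr0.
  by rewrite -subset0 => t [/=]; rewrite !in_itv /= andbT => /andP [_]; rewrite leNgt => /negP.
by rewrite (E_setC dot_norm A_E).
Qed.

Lemma A_itv_bound (d : R) x : 0 <= d ->
  rnorm (A (E `]-oo, d]%classic x)) <= d * rnorm (E `]-oo, d]%classic x).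
Proof.
move=> d0; have mI : measurable (`]-oo, d]%classic : set R) by exact: measurable_itv.
set z := E _ x; have zE : E `]-oo, d]%classic z = z by rewrite /z (E_idem A_E).
have td t : `]-oo, d]%classic t -> t <= d by rewrite /= in_itv.
have AzE : E `]-oo, d]%classic (A z) = A z by rewrite -(A_E_comm dot_norm A_pos A_E) // zE.
have := rnorm_A_sqr_le dot_norm A_pos d0 (Q_le_ub dot_norm A_E mI AzE td).
have := Q_le_ub dot_norm A_E mI zE td.
move=> h1 h2; rewrite -(@ler_pXn2r _ 2) ?nnegrE ?mulr_ge0 ?rnorm_ge0 // exprMn.
by rewrite (le_trans h2) // expr2 -mulrA ler_wpM2l.
Qed.

Lemma A_itv_iter_bound (d : R) n x : 0 <= d ->
  rnorm (iter n A (E `]-oo, d]%classic x)) <= d ^+ n * rnorm x.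
Proof.
move=> d0; have mI : measurable (`]-oo, d]%classic : set R) by exact: measurable_itv.
have iterE k : iter k A (E `]-oo, d]%classic x) = E `]-oo, d]%classic (iter k A x).
  by elim: k => // k IH; rewrite !iterS IH (A_E_comm dot_norm A_pos A_E).
elim: n => [|n IH]; first by rewrite mul1r (rnorm_E_le dot_norm A_E).
rewrite iterS iterE (le_trans (A_itv_bound _ d0)) // -iterE exprS -mulrA.
by rewrite ler_wpM2l.
Qed.

(* The inverse modulo compact operators is the Neumann series on the spectral
   subspace where [A] is bounded by [d]. *)
Lemma calkin_invertible_outside (d : R) (l : R[i]) : 0 <= d <= 1 ->
  finite_dim (range (E `]d, 1]%classic)) -> d < complex.Re `|l| ->
  calkin_invertible (fun x => A x - l *: x).
Proof.
move=> /andP [d0 d1] fd; set L := complex.Re `|l| => dL.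
have L0 : 0 < L by exact: le_lt_trans dL.
have ln0 : l != 0 by apply/eqP => l0; move: L0; rewrite /L l0 normr0 ltxx.
have mI : measurable (`]-oo, d]%classic : set R) by exact: measurable_itv.
pose P := E `]-oo, d]%classic.
(* Partial sums of the expansion of the inverse of A - l as minus the sum of A^k / l^(k+1), cut down
   to the subspace where A is bounded by [d]. *)
pose F n x : H := \sum_(k < n) - (l^-1 ^+ k.+1) *: iter k A (P x).
have linF n : linear (F n).
  move=> a x y; rewrite /F scaler_sumr -big_split; apply: eq_bigr => k _ /=.
  by rewrite linearP iter_linear scalerDr !scalerA mulrC.
have linv : complex.Re `|l^-1| = L^-1.
  by rewrite /L normfV normc_sqnormc -fmorphV.
have r01 : 0 <= d / L < 1.
  apply/andP; split; first by rewrite divr_ge0 // ltW.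
  by rewrite ltr_pdivrMr // mul1r.
have stepF x n : rnorm (F n.+1 x - F n x) <= L^-1 * rnorm x * (d / L) ^+ n.
  rewrite /F big_ord_recr /= addrAC subrr add0r scaleNr rnormN rnormZ normrX.
  have -> : complex.Re (`|l^-1| ^+ n.+1) = L^-1 ^+ n.+1.
    by rewrite -linv [in LHS]normc_sqnormc -rmorphXn normc_sqnormc.
  have Ln : 0 <= L^-1 ^+ n.+1 by rewrite exprn_ge0 // invr_ge0 ltW.
  rewrite (le_trans (ler_wpM2l Ln (A_itv_iter_bound n x d0))) //.
  by rewrite le_eqVlt; apply/orP; left; apply/eqP; rewrite expr_div_n exprS exprVn; ring.
have /choice [S hS] x : exists s : H, (F n x @[n --> \oo] --> s) /\
    rnorm (s - F 0%N x) <= L^-1 * rnorm x / (1 - d / L).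
  by apply: geometric_cvg => //; rewrite mulr_ge0 ?invr_ge0 ?rnorm_ge0 ?ltW.
have FS x : F n x @[n --> \oo] --> S x by have [] := hS x.
have [S' S'E] := linear_of_subproof (limit_linear linF FS).
have AF n x : A (F n x) - l *: F n x = P x - l^-1 ^+ n *: iter n A (P x).
  elim: n => [|n IH].
    by rewrite /F big_ord0 linear0 scaler0 expr0 scale1r !subrr.
  have -> : F n.+1 x = F n x - l^-1 ^+ n.+1 *: iter n A (P x).
    by rewrite /F big_ord_recr /= scaleNr.
  have lc y : l *: (l^-1 ^+ n.+1 *: y) = l^-1 ^+ n *: y.
    by rewrite scalerA exprS mulrA divff // mul1r.
  have swap (p q r t : H) : p - q - (r - t) = p - r + t - q.
    by rewrite opprB [t - r]addrC addrACA -[RHS]addrA [- q + t]addrC.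
  by rewrite (linearB A) (linearZ_LR A) scalerBr lc swap IH subrK.
have FA n x : F n (A x - l *: x) = A (F n x) - l *: F n x.
  have iterA k z : A (iter k A z) = iter k A (A z) by rewrite -iterS iterSr.
  have -> : A (F n x) = F n (A x).
    rewrite /F (linear_sum A); apply: eq_bigr => k _.
    by rewrite (linearZ_LR A) /= iterA (A_E_comm dot_norm A_pos A_E).
  by rewrite addrC -scaleNr linF scaleNr addrC.
have tail x : P x - l^-1 ^+ n *: iter n A (P x) @[n --> \oo] --> P x.
  rewrite -[X in _ --> X]subr0; apply: cvgB; first exact: cvg_cst.
  apply/cvg_rnorm0.
  have rc : (fun n => (d / L) ^+ n * rnorm x) n @[n --> \oo] --> (0 : R).
    rewrite -[X in _ --> X](mul0r (rnorm x)); apply: cvgM; last exact: cvg_cst.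
    by apply: cvg_expr; case/andP: r01 => r0 r1; rewrite ger0_norm.
  apply: (squeeze_cvgr _ (cvg_cst 0) rc); apply: nearW => n.
  rewrite rnorm_ge0 subr0 rnormZ normrX.
  have -> : complex.Re (`|l^-1| ^+ n) = L^-1 ^+ n.
    by rewrite -linv [in LHS]normc_sqnormc -rmorphXn normc_sqnormc.
  have Ln : 0 <= L^-1 ^+ n by rewrite exprn_ge0 // invr_ge0 ltW.
  rewrite (le_trans (ler_wpM2l Ln (A_itv_iter_bound n x d0))) //.
  by rewrite expr_div_n exprVn mulrA [_^-1 * _]mulrC.
have left_inv x : S' (A x - l *: x) - x = - E `]d, 1]%classic x.
  have -> : S' (A x - l *: x) = P x.
    rewrite S'E; have e : (fun n => P x - l^-1 ^+ n *: iter n A (P x)) =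
        (fun n => F n (A x - l *: x)) by apply/funext => n; rewrite FA AF.
    have := tail x; rewrite e; exact: cvg_uniqueH (FS _).
  by rewrite -{2}(E_split x d1) opprD addrA subrr add0r.
have right_inv x : A (S' x) - l *: S' x - x = - E `]d, 1]%classic x.
  have -> : A (S' x) - l *: S' x = P x.
    apply: (@cvg_uniqueH _ _ (fun n => A (F n x) - l *: F n x)).
      rewrite !S'E; apply: cvgB.
        by apply: (@bounded_cvg _ _ A 1) => // z; rewrite mul1r (rnorm_A_le dot_norm A_pos).
      by apply: cvgZ => //; exact: cvg_cst.
    have -> // : (fun n => A (F n x) - l *: F n x) =
      (fun n => P x - l^-1 ^+ n *: iter n A (P x)) by apply/funext => n; rewrite AF.
  by rewrite -{2}(E_split x d1) opprD addrA subrr add0r.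
have mJ : measurable (`]d, 1]%classic : set R) by exact: measurable_itv.
have cP := finite_projection_compact (E_projection mJ) fd.
exists S'; split.
- apply: (@bounded_continuous _ _ _ (L^-1 / (1 - d / L))) => x; rewrite S'E.
  have [_] := hS x; rewrite /F big_ord0 subr0 => /le_trans; apply.
  by rewrite -!mulrA [rnorm x * _]mulrC.
- have -> // : (fun x => S' (A x - l *: x) - x) = (fun x => - E `]d, 1]%classic x).
  by apply/funext => x; exact: left_inv.
- have -> // : (fun x => A (S' x) - l *: S' x - x) = (fun x => - E `]d, 1]%classic x).
  by apply/funext => x; exact: right_inv.
Qed.

(** If S(A - I) - I were compact, take [d] so close to 1 that S(A - I) has norm at most 1/2 on the
    range of E(]d, 1]). An orthonormal sequence in that range would then be sent to a sequence
    separated by 1/2. *)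
Lemma one_in_ess_spectrum : infinite_near_one E -> ess_spectrum A 1.
Proof.
move=> Dinf [S [Sc K1 _]]; have [b b0 Sb] := continuous_bounded Sc.
(* Chosen so that [b * (1 - d) <= 1 / 2], where [b] bounds [S]; the maximum keeps [d]
   nonnegative. *)
pose d := Num.max 0 (1 - (2 * b)^-1).
have b2 : 0 < (2 * b)^-1 by rewrite invr_gt0 mulr_gt0.
have d01 : 0 <= d < 1.
  by rewrite /d le_max lexx gt_max ltr01 gtrBl b2.
have bd : b * (1 - d) <= 2^-1.
  have : 1 - d <= (2 * b)^-1 by rewrite lerBlDr -lerBlDl /d le_max lexx orbT.
  move=> /(ler_wpM2l (ltW b0)) /le_trans; apply.
  by rewrite invfM mulrCA mulfV ?mulr1 // gt_eqF.
have mJ : measurable (`]d, 1]%classic : set R) by exact: measurable_itv.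
set w := `]d, 1]%classic in mJ.
have lB : linear (fun x => E w x - A (E w x)).
  move=> a x y; rewrite !(linearP (E w)) (linearP A) scalerBr opprD !addrA; congr (_ + _).
  by rewrite addrAC.
have [B BE] := linear_of_subproof lB.
have BQ x : dot (B x) x = (rnorm (E w x) ^+ 2 - Q (E w x))%:C.
  have e1 : dot (E w x) x = dot (E w x) (E w x).
    by rewrite -{1}(E_idem A_E x mJ) (E_selfadjoint A_E).
  have e2 : dot (A (E w x)) x = dot (A (E w x)) (E w x).
    by rewrite -{1}(E_idem A_E x mJ) (A_E_comm dot_norm A_pos A_E) // (E_selfadjoint A_E).
  by rewrite BE dotBl e1 e2 (psdE _ Apsd) (dot_rnorm dot_norm) rmorphB.
have Bpsd : psd dot B by move=> x; rewrite BQ ler0c subr_ge0 (Q_le dot_norm A_pos).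
have [d0 d1] := andP d01.
have Bb : bounded_by (1 - d) B.
  apply: (psd_bounded dot_norm Bpsd) => [|x]; first by rewrite subr_ge0 ltW.
  rewrite /qform BQ /=.
  have wd t : w t -> d <= t by rewrite /w /= in_itv /= => /andP [/ltW].
  have := Q_ge dot_norm A_E mJ (E_idem A_E x mJ) wd.
  have : rnorm (E w x) ^+ 2 <= rnorm x ^+ 2.
    by rewrite ler_sqr ?nnegrE ?rnorm_ge0 // (rnorm_E_le dot_norm A_E).
  have := sqr_ge0 (rnorm (E w x)).
  move: (rnorm (E w x) ^+ 2) (rnorm x ^+ 2) (Q _) => p q r; nra.
have Pp := E_projection mJ.
have [f [of_ Pf ftot]] := projection_onb dot_norm H_separable Pp.
have unb := onb_unbounded dot_norm Pp of_ Pf ftot (Dinf d d01).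
have [|s [hs _ s_mono]] := @increasing_selection (fun _ n => f n != 0).
  by move=> _ N; exact: unb.
pose e n := f (s n).
have e1 n : dot (e n) (e n) = 1.
  rewrite /e; case: (proj2 of_ (s n)) => [fE|fE]; first by have := hs n; rewrite fE eqxx.
  by rewrite (psdE (B := id_linear) _ idpsd) fE.
have ne n : rnorm (e n) ^+ 2 = 1 by rewrite (rnorm_sqr dot_norm) e1.
move: K1; apply: (separated_not_precompact (y := fun n => S (A (e n) - 1 *: e n) - e n)
  (e := 2^-1)) => [|n|m n mn]; first by rewrite invr_gt0.
  exists (e n) => //=; rewrite normE lecR -(@expr_le1 _ 2) ?rnorm_ge0 //.
  by rewrite ne.
pose u := e m - e n.
have -> : S (A (e m) - 1 *: e m) - e m - (S (A (e n) - 1 *: e n) - e n) = - S (B u) - u.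
  have -> : B u = - ((A (e m) - 1 *: e m) - (A (e n) - 1 *: e n)).
    have swap (p q r t : H) : q - t - (p - r) = - ((p - q) - (r - t)).
      by rewrite !opprB addrACA [RHS]addrACA [q + r]addrC.
    by rewrite BE /u !scale1r (linearB (E w)) /e !Pf (linearB A) swap.
  have swap (p q r t : H) : p - q - (r - t) = (p - r) - (q - t).
    by rewrite !opprB addrACA [RHS]addrACA [- q - r]addrC.
  by rewrite (linearN S) opprK [in RHS](linearB S) swap.
(* As |S (B u)| <= |u| / 2, the norm of - S (B u) - u is at least |u| / 2; the exact value of |u|^2
   gives |u| >= 1, hence the separation 1/2. *)
have u2 : rnorm u ^+ 2 = 2.
  have mn0 : dot (e m) (e n) = 0.
    by apply: (proj1 of_) => smn; have := s_mono _ _ mn; rewrite smn ltnn.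
  rewrite (rnorm_sqr dot_norm) /u dotBl !dotBr (dotC (e n) (e m)) mn0 !e1 conjc0.
  by rewrite subr0 sub0r opprK.
have u1 : 1 <= rnorm u.
  by rewrite -(@ler_pXn2r _ 2) ?nnegrE ?rnorm_ge0 // u2 expr1n ler1n.
have := ler_rnormD (- S (B u) - u) (S (B u)).
rewrite addrAC addNr sub0r rnormN.
have Bu : rnorm (B u) <= (1 - d) * rnorm u by exact: Bb.
have := Sb (B u); have := ler_wpM2l (ltW b0) Bu; rewrite mulrA.
have := ler_wpM2r (rnorm_ge0 u) bd; lra.
Qed.

Lemma ess_spectrum_le (d : R) (l : R[i]) : 0 <= d <= 1 ->
  finite_dim (range (E `]d, 1]%classic)) -> ess_spectrum A l -> complex.Re `|l| <= d.
Proof.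
move=> d01 fd l_ess; rewrite leNgt; apply/negP => dl; apply: l_ess.
exact: calkin_invertible_outside d01 fd dl.
Qed.

Lemma ess_spectral_radius1 : infinite_near_one E -> ess_spectral_radius A = 1.
Proof.
move=> Dinf; have ub l : ess_spectrum A l -> complex.Re `|l| <= 1.
  apply: ess_spectrum_le; first by rewrite ler01 lexx.
  (* With d = 1 the interval ]d, 1] is empty and its spectral subspace is zero. *)
  exists 0%N, (fun=> 0) => _ [x _ <-]; exists (fun=> 0).
  by rewrite set_itv_ge ?bnd_simp ?ltxx // (E0 dot_norm A_E) big_ord0.
have one := one_in_ess_spectrum Dinf.
apply/eqP; rewrite eq_le; apply/andP; split.
  by apply: ge_sup => [|_ [l /ub l1 <-]] //; exists (complex.Re `|1 : R[i]|); exists 1.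
apply: ub_le_sup; first by exists 1 => _ [l /ub l1 <-].
by exists 1 => //; rewrite normr1.
Qed.

Lemma ess_spectral_radius_lt1 (d : R) : 0 <= d < 1 ->
  finite_dim (range (E `]d, 1]%classic)) -> ess_spectral_radius A < 1.
Proof.
move=> /andP [d0 d1] fd; apply: (le_lt_trans _ d1).
have ub l : ess_spectrum A l -> complex.Re `|l| <= d.
  by apply: ess_spectrum_le => //; rewrite d0 ltW.
(* Over an empty set the supremum is 0 by convention, which is still at most [d]. *)
have [[l l_ess]|no] := pselect (exists l, ess_spectrum A l).
  by apply: ge_sup => [|_ [l' /ub l1 <-]] //; exists (complex.Re `|l|); exists l.
rewrite /ess_spectral_radius (_ : [set _ | _ in _] = set0) ?sup0 //.
by rewrite -subset0 => t [l l_ess _]; apply: no; exists l.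
Qed.

End Calkin.

(** * Dimensions *)

Section Dimension.
Variables (R : realType) (H : completeNormedModType R[i]).
Variables (dot : {dot H for (@conjC R[i])}) (dot_norm : induces_norm dot).
Implicit Types (x y z : H) (M B : set H).

Lemma orthonormal_set_finite M B : finite_dim M -> orthonormal_basis dot M B -> finite_set B.
Proof.
move=> /(finite_dim_bound dot) [n hn] [BM B1 B0 _]; apply: contrapT.
move=> /infiniteP/pcard_leP [g]; suff : (n.+1 <= n)%N by rewrite ltnn.
have gB i : B (g i) by apply: 'funS_g.
apply: (hn _ g) => [i j _ _|i _]; last exact: BM.
have [->|ij] := eqVneq i j; first by rewrite B1.
apply: B0 => // gij; move/eqP: ij; apply; apply: 'inj_g => //; exact: in_setT.
Qed.

Lemma orthonormal_enum M B n : orthonormal_basis dot M B -> (B #= `I_n)%card ->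
  exists e : nat -> H, [/\ orthonormal_upto dot n e, forall i, (i < n)%N -> B (e i) &
    forall x, (forall i, (i < n)%N -> dot x (e i) = 0) -> forall b, B b -> dot x b = 0].
Proof.
move=> [BM B1 B0 _]; rewrite card_eq_sym => /pcard_eqP [g].
have gB i : (i < n)%N -> B (g i) by move=> im; apply: 'funS_g.
exists g; split=> // [i j im jm|x xg b Bb].
  have [->|ij] := eqVneq i j; first by rewrite B1 //; exact: gB.
  apply: B0; [exact: gB|exact: gB|] => gij; move/eqP: ij; apply.
  by apply: 'inj_g => //; rewrite inE.
by have [i im <-] := 'surj_g Bb; exact: xg.
Qed.

Lemma hdim_infinite M M' : finite_dim M' -> hdim_is dot M [set: nat] -> ~ M `<=` M'.
Proof.
move=> fM' [B oB /card_esym /card_eqPle [/infiniteP infB _]] MM'.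
by apply: infB; apply: orthonormal_set_finite oB; apply: finite_dimS fM'.
Qed.

Lemma hdim_zero M x : hdim_is dot M (set0 : set nat) -> M x -> x = 0.
Proof.
move=> [B [_ _ _ tot]]; rewrite card_eq0 => /eqP B0 Mx.
by apply: tot => // b; rewrite B0.
Qed.

End Dimension.

(** * Dimensions of the spectral subspaces and the equivalences *)

Section Conclusion.
Variables (R : realType) (H : completeNormedModType R[i]).
Variables (dot : {dot H for (@conjC R[i])}) (dot_norm : induces_norm dot).
Hypothesis H_separable : separable_space H.
Variables (A : {linear H -> H}) (A_pos : positive_contraction dot A).
Variables (E : set R -> {linear H -> H}) (A_E : is_spectral_measure dot A E).
Implicit Types (x y z : H).

Let mitv (i : interval R) : measurable ([set` i] : set R).
Proof. exact: measurable_itv. Qed.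

Definition equal_dimensions : Prop := forall delta : R, 0 <= delta < 1 ->
  hdim_eq dot (range (E `]0, 1]%classic)) (range (E `]delta, 1]%classic)).

(** Both ranges have the same finite dimension n. A nonzero vector of the range of E(]0, d]),
    normalized, would extend a basis of the range of E(]d, 1]) to n + 1 orthonormal vectors in the
    range of E(]0, 1]), which n vectors span. *)
Lemma equal_dimensions_null (d : R) : 0 <= d < 1 -> finite_dim (range (E `]d, 1]%classic)) ->
  hdim_eq dot (range (E `]0, 1]%classic)) (range (E `]d, 1]%classic)) ->
  forall x, E `]0, d]%classic x = 0.
Proof.
move=> /andP [d0 d1] fd [B oB [B' oB' BB']] x; set y := E _ x.
have [n Bn] := orthonormal_set_finite fd oB'.
have {}BB' := card_eq_trans (card_esym BB') Bn.
have [e [oe eB etot]] := orthonormal_enum oB BB'.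
have [e' [oe' eB' _]] := orthonormal_enum oB' Bn.
have [BM _ _ Btot] := oB; have [BM' _ _ _] := oB'.
have span z : E `]0, 1]%classic z = z -> exists c : 'I_n -> R[i], z = \sum_(j < n) c j *: e j.
  move=> zE; exists (fun j => dot z (e j)); apply/eqP; rewrite -subr_eq0; apply/eqP.
  have eE i : (i < n)%N -> E `]0, 1]%classic (e i) = e i.
    by move=> im; apply: (E_range A_E) => //; apply: BM; exact: eB.
  apply: Btot.
    exists (z - \sum_(j < n) dot z (e j) *: e j) => //.
    rewrite (linearB (E _)) (linear_sum (E _)) zE; congr (_ - _).
    by apply: eq_bigr => j _; rewrite (linearZ_LR (E _)) eE.
  apply: etot => i im; rewrite dotBl.
  by rewrite (orthonormal_coef (fun j => dot z (e j)) oe im) subrr.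
have [//|/eqP y0] := pselect (y = 0).
have [c uE] := unit_of_scaled dot y.
suff : (n.+1 <= n)%N by rewrite ltnn.
have ye' i : (i < n)%N -> dot (unit_of dot y) (e' i) = 0.
  move=> im; rewrite uE dotZl -(E_range A_E (mitv _) (BM' _ (eB' _ im))).
  rewrite (E_orth dot_norm A_E) ?mulr0 // -subset0 => t [/=]; rewrite !in_itv /=.
  by move=> /andP [_ td] /andP []; rewrite ltNge td.
apply: (orthonormal_le_dim (e := fun j : 'I_n => e j)
  (orthonormal_upto_extend oe' (unit_of_dot dot_norm y0) ye')) => i _.
apply: span; case: ifP => im.
  rewrite -(E_range A_E (mitv _) (BM' _ (eB' _ im))) (E_sub A_E) // => t /=.
  by rewrite !in_itv /= => /andP [dt ->]; rewrite (le_lt_trans d0 dt).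
rewrite uE (linearZ_LR (E _)) (E_sub A_E) // => t /=.
by rewrite !in_itv /= => /andP [-> td]; rewrite (le_trans td) // ltW.
Qed.

Lemma equal_dimensions_finite_rank : equal_dimensions -> ~ infinite_near_one E ->
  finite_rank_projection dot A.
Proof.
move=> hdim /not_infinite_near_one [d [d01 fd]]; have /andP [d0 d1] := d01.
have fd1 : finite_dim (range (E [set 1])).
  by apply: (finite_dim_E_sub A_E _ _ _ fd) => // t -> /=; rewrite in_itv /= lexx d1.
apply: (finite_rank_of_eq A_E _ fd1); apply: (A_eq_E1 dot_norm A_pos A_E) => k x.
(* This [m] is large enough for ]0, m] to contain the block and for ]m, 1] to have finite rank, and
   it is still below 1. *)
pose m := Num.max d (level R k.+1).
have m01 : 0 <= m < 1 by rewrite le_max d0 gt_max d1 level_lt1.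
have fm : finite_dim (range (E `]m, 1]%classic)).
  apply: (finite_dim_E_sub A_E _ _ _ fd) => // t /=; rewrite !in_itv /= gt_max.
  by move=> /andP [/andP [-> _] ->].
have := equal_dimensions_null m01 fm (hdim m m01) x.
apply: (E_sub0 A_E (@measurable_block R k.+1) (mitv _)) => t /=.
rewrite !in_itv /= => /andP [kt tk].
by rewrite (le_lt_trans (level_ge0 R k)) //= le_max tk orbT.
Qed.

Lemma infinite_equal_dimensions : infinite_near_one E -> equal_dimensions.
Proof.
move=> Dinf d d01.
have inf0 := projection_hdim_nat dot_norm H_separable (E_projection A_E (mitv _)).
have [|B oB Bn] := inf0 `]0, 1].
  by apply: Dinf; rewrite lexx ltr01.
have [B' oB' Bn'] := inf0 `]d, 1] (Dinf d d01).
by exists B => //; exists B' => //; exact: card_eq_trans Bn' (card_esym Bn).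
Qed.

Section FiniteRank.
Hypothesis A_proj : finite_rank_projection dot A.

Let AA x : A (A x) = A x.
Proof. by have [[_ h] _] := A_proj; exact: h. Qed.

(** A projection has no spectrum in ]0, d]: for [y] in that spectral subspace |Ay|^2 = Q(Ay) <= d
    |Ay|^2, so Ay = 0 and [y] is 0. Both ranges are therefore equal. *)
Lemma finite_rank_equal_dimensions : equal_dimensions.
Proof.
move=> d /andP [d0 d1].
have Ed x : E `]0, d]%classic x = 0.
  set y := E _ x; have yE : E `]0, d]%classic y = y by rewrite /y (E_idem A_E).
  have w0 : `]0, d]%classic `<=` `]0, +oo[%classic.
    by move=> t /=; rewrite !in_itv /= => /andP [->].
  rewrite -yE; apply: (ker_E_itv dot_norm A_pos A_E) => //.
  have AyE : E `]0, d]%classic (A y) = A y by rewrite -(A_E_comm dot_norm A_pos A_E) // yE.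
  have := Q_le_ub dot_norm A_E (b := d) (mitv _) AyE.
  have td t : `]0, d]%classic t -> t <= d by rewrite /= in_itv /= => /andP [].
  move=> /(_ td); rewrite /qform AA -(rnorm_sqr dot_norm) => h.
  apply/rnorm_eq0/eqP; rewrite -sqrf_eq0 eq_le sqr_ge0 andbT.
  have d1' : 0 < 1 - d by rewrite subr_gt0.
  by rewrite -(ler_pM2l d1') mulr0 mulrBl mul1r subr_le0.
have EE x : E `]0, 1]%classic x = E `]d, 1]%classic x.
  have -> : `]0, 1]%classic = `]0, d]%classic `|` `]d, 1]%classic :> set R.
    by rewrite -itv_bndbnd_setU // bnd_simp // ltW.
  rewrite (E_setU dot_norm A_E) ?Ed ?add0r // -subset0 => t [/=].
  by rewrite !in_itv /= => /andP [_ td] /andP []; rewrite ltNge td.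
have Pp := E_projection A_E (mitv `]d, 1]).
have [f [of_ Pf ftot]] := projection_onb dot_norm H_separable Pp.
have oB := form_orthonormal_onb dot_norm Pp of_ Pf ftot.
have -> : range (E `]0, 1]%classic) = range (E `]d, 1]%classic).
  by congr image; apply/funext.
by eexists; [exact: oB|eexists; [exact: oB|exact: card_eqxx]].
Qed.

Lemma finite_rank_arises : arises_uniformly dot A A.
Proof.
exists A; first exact: (A_selfadjoint A_pos).
have iterA n x : iter n.+1 A x = A x by elim: n => // n IH; rewrite iterS IH AA.
apply/cvgrPdist_le => e e0; exists 1%N => // -[//|n] _ /=.
have zero : (fun x => A (iter n A (A (iter n A x))) - A x) = (fun=> 0).
  by apply/funext => x; rewrite -!iterS !iterA AA subrr.
have b0 : bounded_by 0 (fun=> 0 : H) by move=> x; rewrite rnorm0 mul0r.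
rewrite zero sub0r normrN ger0_norm; last exact: opnorm_ge0 b0 (lexx 0).
by apply: le_trans (ltW e0); apply: opnorm_le => // x _; rewrite rnorm0.
Qed.

(** The range of a projection consists of fixed vectors, so [A] is 0 here. *)
Lemma finite_rank_C_dot0 : (forall x, A x - x = 0 -> x = 0) -> C_dot0 dot A.
Proof.
move=> ker0; exists A; first exact: (A_selfadjoint A_pos).
have A0 x : A x = 0 by apply: ker0; rewrite AA subrr.
move=> x; apply/cvg_rnormP => e e0; exists 1%N => -[//|n] _.
by rewrite iterS A0 subrr rnorm0.
Qed.

End FiniteRank.

End Conclusion.

Theorem theorem2 (R : realType) (H : completeNormedModType R[i])
    (dot : {dot H for (@conjC R[i])}) (dot_norm : induces_norm dot)
    (H_separable : separable_space H)
    (H_infinite : ~ finite_dim [set: H])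
    (A : {linear H -> H}) (A_pos : positive_contraction dot A)
    (E : set R -> {linear H -> H}) (A_E : is_spectral_measure dot A E) :
  let cond_i :=
    exists T : {linear H -> H}, contraction_op T /\ arises_asymptotically dot A T in
  let cond_ii :=
    exists T : {linear H -> H}, contraction_op T /\ arises_uniformly dot A T in
  let cond_iii :=
    ess_spectral_radius A = 1 \/ finite_rank_projection dot A in
  let cond_iv :=
    forall delta : R, 0 <= delta < 1 ->
      hdim_eq dot (range (E `]0, 1]%classic)) (range (E `]delta, 1]%classic)) in
  [/\ cond_i <-> cond_ii, cond_ii <-> cond_iii, cond_iii <-> cond_iv &
      [\/ cond_i, cond_ii, cond_iii | cond_iv] ->
      hdim_is dot (ker_sub_id A) (set0 : set nat) \/
      hdim_is dot (ker_sub_id A) [set: nat] ->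
      exists T : {linear H -> H},
        [/\ contraction_op T, C_dot0 dot T, arises_asymptotically dot A T &
            arises_uniformly dot A T]].
Proof.
move=> cond_i cond_ii cond_iii cond_iv.
pose alt := infinite_near_one E \/ finite_rank_projection dot A.
have bA : bounded_by 1 A by move=> x; rewrite mul1r (rnorm_A_le dot_norm A_pos).
have strong (T : {linear H -> H}) : bounded_by 1 T -> arises_uniformly dot A T ->
    arises_asymptotically dot A T.
  exact: uniform_asymptotic.
have i_alt : cond_i -> alt.
  move=> [T [/contraction_opP Tb [Ts TTs Tlim]]].
  have [Dinf|Dfin] := pselect (infinite_near_one E); [by left|right].
  exact: (asymptotic_finite_rank dot_norm A_pos A_E Tb TTs Tlim Dfin).
have alt_ii : alt -> cond_ii.
  case=> [Dinf|Afin].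
    have [T [Tb TA _]] := shift_exists dot_norm H_separable A_pos A_E Dinf.
    by exists T; split=> //; apply/contraction_opP.
  exists A; split; first exact/contraction_opP.
  exact: finite_rank_arises.
have ii_i : cond_ii -> cond_i.
  by move=> [T [Tc TA]]; exists T; split=> //; apply: strong => //; apply/contraction_opP.
have iii_alt : cond_iii -> alt.
  case=> [re1|Afin]; [left|by right]; apply: contrapT => /not_infinite_near_one.
  move=> [d [d01 fd]].
  have := ess_spectral_radius_lt1 dot_norm H_separable A_pos A_E d01 fd.
  by rewrite re1 ltxx.
have alt_iii : alt -> cond_iii.
  case=> [Dinf|Afin]; [left|by right].
  exact: (ess_spectral_radius1 dot_norm H_separable A_pos A_E Dinf).
have iv_alt : cond_iv -> alt.
  move=> hdim; have [Dinf|Dfin] := pselect (infinite_near_one E); [by left|right].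
  exact: (equal_dimensions_finite_rank dot_norm A_pos A_E hdim Dfin).
have alt_iv : alt -> cond_iv.
  case=> [Dinf|Afin].
    exact: (infinite_equal_dimensions dot_norm H_separable A_E Dinf).
  exact: (finite_rank_equal_dimensions dot_norm H_separable A_pos A_E Afin).
split; [by split=> [/i_alt/alt_ii|/ii_i]|by split=> [/ii_i/i_alt/alt_iii|/iii_alt/alt_ii]| |].
  by split=> [/iii_alt/alt_iv|/iv_alt/alt_iii].
move=> conds kerdim.
have [Dinf|Afin] : alt by case: conds => // /ii_i.
  have [T [Tb TA Tdot0]] := shift_exists dot_norm H_separable A_pos A_E Dinf.
  exists T; split=> //; [exact/contraction_opP| |exact: strong].
  apply: Tdot0; case: kerdim => [ker0|kerinf]; [left=> x|right=> fin1].
    by apply: (hdim_zero ker0); rewrite /ker_sub_id /= (E_block0_fixed dot_norm A_pos A_E) subrr.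
  apply: (hdim_infinite fin1 kerinf) => x /eqP; rewrite subr_eq0 => /eqP Ax.
  by exists x => //; exact: (fixed_E_block0 dot_norm A_pos A_E).
have A_arises := finite_rank_arises A_pos Afin.
exists A; split=> //; [exact/contraction_opP| |exact: strong].
case: kerdim => [ker0|kerinf].
  by apply: finite_rank_C_dot0 => // x; exact: hdim_zero ker0.
(* Fixed vectors lie in the range of [A], which is finite-dimensional, so ker (A - I) cannot have
   dimension aleph_0. *)
exfalso; apply: (hdim_infinite (proj2 Afin) kerinf) => x /eqP; rewrite subr_eq0 => /eqP Ax.
by exists x.
Qed.
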